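(* Let $d \ge 1$ and $k \ge 1$ be integers, and let $\mu$ be a compactly supported non-negative Borel measure on $\mathbb{R}^d$ for which there exist $s_\mu \in \left(\frac{d+1}{2}, d\right]$ and a constant $C_0>0$ such that $\mu(B(x,r)) \le C_0 r^{s_\mu}$ for all $x \in \mathbb{R}^d$ and all $r>0$. Then there exists a constant $C>0$ such that for any $t_1, \dots, t_k > 0$ and any $\epsilon > 0$, $$ \mu \times \mu \times \cdots \times \mu \left\{ (x^1, x^2, \dots, x^{k+1}) \in (\mathbb{R}^d)^{k+1} : t_i - \epsilon \le |x^{i+1}-x^i| \le t_i + \epsilon, \ i = 1, 2, \dots, k \right\} \le C \epsilon^k, $$ where the product measure has $k+1$ factors.
   Context: $B(x,r)$ is the ball of radius $r>0$ centered at $x \in \mathbb{R}^d$, and $|\cdot|$ is the Euclidean norm. *)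

(* Defs.v *)
From mathcomp Require Import all_boot all_order all_algebra.
From mathcomp Require Import all_classical all_reals all_analysis.

Set Implicit Arguments.
Unset Strict Implicit.
Unset Printing Implicit Defensive.

Import Order.TTheory GRing.Theory Num.Theory.
Import numFieldNormedType.Exports.

Local Open Scope classical_set_scope.
Local Open Scope ring_scope.

(* The topology of 'rV[R]_d is the entrywise one, which is the Euclidean one. *)
Notation borelRd R d := (g_sigma_algebraType (@open 'rV[R]_d)).

(* The library norm `|x| on row vectors is the sup norm. *)
Definition enorm (R : realType) (d : nat) (x : 'rV[R]_d) : R :=
  Num.sqrt (\sum_(i < d) x ord0 i ^+ 2).

Definition eball (R : realType) (d : nat) (x : 'rV[R]_d) (r : R)
    : set 'rV[R]_d :=
  [set y | enorm (y - x) < r].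

Definition supp_measure (R : realType) (d : nat)
    (mu : set (borelRd R d) -> \bar R) : set 'rV[R]_d :=
  [set x | forall U : set 'rV[R]_d, open U -> U x -> (0 < mu U)%E].

(* The library has no n-fold product measure: this one is the binary product of
   mu and its m-fold product, carried from T * m.-tuple T to m.+1.-tuple T. *)
Fixpoint power_measure (R : realType) (disp : measure_display)
    (T : measurableType disp) (mu : set T -> \bar R) (n : nat)
    : set (n.-tuple T) -> \bar R :=
  match n with
  | 0 => dirac [tuple]
  | m.+1 =>
      pushforward (mu \x @power_measure R disp T mu m)%E
        (fun p : T * m.-tuple T => [tuple of p.1 :: p.2])
  end.
Arguments power_measure {R disp T} mu n.

(* x = (x^1, ..., x^{k+1}) is indexed from 0, so the i-th gap joins entries
   i and i+1. *)
Definition chain_set (R : realType) (d k : nat) (t : 'I_k -> R) (eps : R)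
    : set (k.+1.-tuple (borelRd R d)) :=
  [set x | forall i : 'I_k,
     let gap := enorm ((tnth x (lift ord0 i) : 'rV[R]_d)
                       - tnth x (widen_ord (leqnSn k) i)) in
     t i - eps <= gap <= t i + eps].

(* Main.v *)
Require Import Defs.
From HB Require Import structures.
From mathcomp Require Import all_boot all_order all_algebra.
From mathcomp Require Import all_classical all_reals all_analysis.
From mathcomp Require Import measurable_realfun.
From mathcomp Require Import ring lra.

Import Order.TTheory GRing.Theory Num.Theory.
Import numFieldNormedType.Exports.

Local Open Scope classical_set_scope.
Local Open Scope ring_scope.
Set Implicit Arguments.
Unset Strict Implicit.
Unset Printing Implicit Defensive.

(** Two consecutive points of a chain interact through the indicator of the
    annulus t - eps <= |x - y| <= t + eps.  The whole matter is that the
    integral operator with this kernel has norm O(eps) on L^2(mu), with a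
    constant depending on mu only: a chain integral arises by applying such an
    operator once per link to the constant 1, and mu is finite, so k links
    give O(eps^k) ([chain_integral_le]).  Since the kernel is nonnegative, the
    norm is controlled by the quadratic form on nonnegative functions
    ([operator_norm_le]), that is by the bound of [annulus_form_bound],
    form(f, f) <= C eps |f|^2.

    When eps is comparable with t this is Schur's test and the growth of mu on
    balls; when t exceeds the diameter of the support the form vanishes.  The
    case in between ([annulus_form_le]) is Fourier analytic.  With
    u = |x - y|^2 / t^2 and N about (t / eps)^2, the kernel
    K = (u e^(1 - u))^N peaks on the sphere |x - y| = t, is at least e^-9 on
    the annulus ([annulus_kernel_ge]), and has an explicit Fourier transform M:
    a Gaussian times a Laguerre polynomial of degree N ([laguerre_fourier]).
    Therefore the form of K is the integral of M(xi) S(xi), where S is the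
    squared modulus of the Fourier transform of f mu ([spectral_identity]).

    - Size of M.  Suitably rescaled, M solves Bessel's equation with an extra
      friction term, and an energy estimate gives it the decay
      |xi|^(-(d-1)/2) of the Fourier transform of a sphere, uniformly in N
      ([damped_bessel_bound], [laguerre_wave_bound]).  As long as t is bounded,
      its amplitude is O(eps) by Stirling's formula ([pochhammer_stirling],
      [laguerre_coef_le]).  So at each point |M| is below one of the Gaussians
      C eps 2^(-j(d-1)) exp(-|xi|^2 / 16^j) ([laguerre_wave_majorant]).
    - Size of S.  With a Gaussian in place of M the spectral identity is read
      from right to left: Schur's test and the mass of Gaussian balls
      ([gauss_ball_integral]) bound the integral of exp(-|xi|^2 / 16^j) S by
      C 4^(j(d-s)) |f|^2.

    The product of the two is eps |f|^2 times 2^(j(d+1-2s)), which is summable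
    over j precisely because s > (d+1)/2. *)

(** * Laguerre polynomials and their differential equation *)

(** The generalised Laguerre polynomial of degree N and index h - 1, divided
    by its value at 0.  The recursion is the one produced by differentiating
    in the width of a Gaussian, which is how these polynomials enter
    [laguerre_fourier]. *)
Fixpoint laguerre (R : realType) (h : R) (N : nat) : {poly R} :=
  match N with
  | 0 => 1
  | M.+1 => laguerre h M
            + (h + M%:R)^-1 *: ('X * ((laguerre h M)^`() - laguerre h M))
  end.

Lemma laguerre_at0 (R : realType) (h : R) N : (laguerre h N).[0] = 1.
Proof.
elim: N => [|N IH]; first by rewrite hornerE.
by rewrite /= hornerD hornerZ hornerM hornerX IH; ring.
Qed.

(** A first-order relation between degrees N and N + 1.  Differentiating it
    expresses the second derivative in degree N + 1 through degree N, which
    is what the induction for [laguerre_ode] needs. *)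
Lemma laguerre_ode_derivS (R : realType) (h : R) N : 0 < h ->
  'X * (laguerre h N)^`()^`() =
    ('X - h%:P) * (laguerre h N)^`() - N%:R%:P * laguerre h N ->
  (h + N%:R)%:P * (laguerre h N.+1)^`() =
    N.+1%:R%:P * ((laguerre h N)^`() - laguerre h N).
Proof.
move=> h0 ode; have hN : h + N%:R != 0 by rewrite gt_eqF// ltr_wpDr.
rewrite /=; set l := laguerre h N in ode *.
rewrite derivD derivZ derivM derivX mul1r derivB mulrDr -mul_polyC mulrA.
rewrite -polyCM mulfV// mul1r -[N.+1%:R]natr1 !polyCD.
have -> : 'X * (l^`()^`() - l^`())
    = ('X - h%:P) * l^`() - N%:R%:P * l - 'X * l^`() by ring: ode.
by ring.
Qed.

Lemma laguerre_ode (R : realType) (h : R) N : 0 < h ->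
  'X * (laguerre h N)^`()^`() =
    ('X - h%:P) * (laguerre h N)^`() - N%:R%:P * laguerre h N.
Proof.
move=> h0; elim: N => [|N IH].
  by rewrite /= -polyC1 !derivC; ring.
have hN : h + N%:R != 0 by rewrite gt_eqF// ltr_wpDr.
have d1 := laguerre_ode_derivS h0 IH.
have d2 : (h + N%:R)%:P * (laguerre h N.+1)^`()^`() =
    N.+1%:R%:P * ((laguerre h N)^`()^`() - (laguerre h N)^`()).
  move: (congr1 (@deriv R) d1).
  by rewrite !derivM !derivC !mul0r !add0r derivB.
apply: (@mulfI _ (h + N%:R)%:P); first by rewrite polyC_eq0.
rewrite mulrCA d2 [RHS]mulrBr [X in _ = X - _]mulrCA d1 [X in _ = _ - X]mulrCA.
have e0 : (h + N%:R)%:P * laguerre h N.+1 = (h + N%:R)%:P * laguerre h N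
    + 'X * ((laguerre h N)^`() - laguerre h N).
  by rewrite /= mulrDr -mul_polyC mulrA -polyCM mulfV// mul1r.
rewrite e0 -[N.+1%:R]natr1 !polyCD; ring: IH.
Qed.

(** * Decay of damped Bessel functions *)
Lemma is_derive_nincr (R : realType) (f df : R -> R) (a : R) :
  (forall x, a <= x -> is_derive x 1 f (df x)) ->
  (forall x, a < x -> df x <= 0) ->
  forall x y, a <= x -> x <= y -> f y <= f x.
Proof.
move=> fdf df0; apply: ler0_derive1_nincry.
- by move=> x; rewrite in_itv/= andbT => /ltW ax; case: (fdf _ ax).
- move=> x; rewrite in_itv/= andbT => ax.
  by rewrite derive1E; case: (fdf _ (ltW ax)) => _ ->; exact: df0.
- apply: derivable_within_continuous => x; rewrite in_itv/= andbT => ax.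
  by case: (fdf _ ax).
Qed.

(** With b = 0 and w = 1 this is Bessel's equation, satisfied by the Fourier
    transform of the unit sphere of dimension a.  The term b x^2 f' is
    additional friction.  The estimates are uniform in b and w as long as
    a b <= 1 and w stays bounded. *)
Section damped_bessel.
Variables (R : realType) (m : nat) (a b w : R) (f f1 f2 : R -> R).
Hypothesis aE : a = m.+1%:R.
Let a_ge1 : 1 <= a. Proof. by rewrite aE -natr1 lerDr. Qed.
Let a0 : 0 <= a. Proof. exact: le_trans a_ge1. Qed.
Hypothesis b0 : 0 <= b.
Hypothesis ab1 : a * b <= 1.
Let ab2 : 1 + a * b <= 2. Proof. by rewrite -[2]/(1 + 1) lerD2l. Qed.
Hypothesis w1 : 1 <= w.
Hypothesis df : forall x : R, is_derive x 1 f (f1 x).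
Hypothesis df1 : forall x : R, is_derive x 1 f1 (f2 x).
Hypothesis ode : forall x, x * f2 x = - (a + b * x ^+ 2) * f1 x - w * (x * f x).

(** Friction dissipates the sum of the kinetic and potential energies. *)
Lemma damped_energy_le x : 0 <= x ->
  f1 x ^+ 2 + w * f x ^+ 2 <= f1 0 ^+ 2 + w * f 0 ^+ 2.
Proof.
move=> x0; pose E := fun x => f1 x ^+ 2 + w * f x ^+ 2.
apply: (@is_derive_nincr _ E
  (fun x => 2 * f1 x * f2 x + 2 * w * f x * f1 x) 0 _ _ 0 x) => // {x0}x x0.
- have := df x; have := df1 x => ? ?.
  by apply: is_derive_eq; rewrite /GRing.scale/=; ring.
- suff : x * (2 * f1 x * f2 x + 2 * w * f x * f1 x) <= 0.
    by rewrite pmulr_rle0.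
  have -> : x * (2 * f1 x * f2 x + 2 * w * f x * f1 x)
     = - (2 * (a + b * x ^+ 2) * f1 x ^+ 2) by ring: (ode x).
  rewrite oppr_le0; apply: mulr_ge0; last exact: sqr_ge0.
  by apply: mulr_ge0 => //; rewrite addr_ge0 // mulr_ge0// sqr_ge0.
Qed.

(* The energy weighted by x^a.  The cross term cancels the leading part of the
   derivative; what remains is absorbed by the friction up to a multiple of
   V / x^2. *)
Let V x := x ^+ m.+1 * (f1 x ^+ 2 + w * f x ^+ 2)
  + a * (1 + a * b) * x ^+ m * (f x * f1 x).

Let cross_le (x c : R) : 0 <= c -> c <= 2 ->
  - (f x ^+ 2 + f1 x ^+ 2) <= c * (f x * f1 x).
Proof.
move=> c0 c2; have [p|/ltW p] := leP 0 (f x * f1 x).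
  apply: (@le_trans _ _ 0); last exact: mulr_ge0.
  by rewrite oppr_le0 addr_ge0// sqr_ge0.
apply: (@le_trans _ _ (2 * (f x * f1 x))); last exact: ler_wnM2r.
by have := sqr_ge0 (f x + f1 x); rewrite -subr_ge0; lra.
Qed.

Let V_ge x : 2 * a <= x -> 2^-1 * x ^+ m.+1 * (f x ^+ 2 + f1 x ^+ 2) <= V x.
Proof.
move=> ax; have x0 : 0 <= x by rewrite (le_trans _ ax)// mulr_ge0.
have -> : V x = x ^+ m * (x * (f1 x ^+ 2 + w * f x ^+ 2)
                          + a * ((1 + a * b) * (f x * f1 x))).
  by rewrite /V (exprS x m); ring.
have -> : 2^-1 * x ^+ m.+1 * (f x ^+ 2 + f1 x ^+ 2)
    = x ^+ m * (2^-1 * x * (f x ^+ 2 + f1 x ^+ 2)) by rewrite (exprS x m); ring.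
apply: ler_wpM2l; first exact: exprn_ge0.
have ab0 : 0 <= a * b by rewrite mulr_ge0.
have /(ler_wpM2l a0) : - (f x ^+ 2 + f1 x ^+ 2) <= (1 + a * b) * (f x * f1 x).
  by apply: cross_le => //; lra.
have : x * f x ^+ 2 <= x * (w * f x ^+ 2).
  by apply: ler_wpM2l => //; rewrite ler_peMl// sqr_ge0.
have : 2 * a * (f x ^+ 2 + f1 x ^+ 2) <= x * (f x ^+ 2 + f1 x ^+ 2).
  by apply: ler_wpM2r => //; rewrite addr_ge0// sqr_ge0.
lra.
Qed.

Let dV x := a * x ^+ m * (f1 x ^+ 2 + w * f x ^+ 2)
  + x ^+ m.+1 * (2 * f1 x * f2 x + 2 * w * f x * f1 x)
  + a * (1 + a * b) * ((a - 1) * x ^+ m.-1 * (f x * f1 x)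
       + x ^+ m * (f1 x ^+ 2 + f x * f2 x)).

Let is_derive_V (x : R) : is_derive x 1 V (dV x).
Proof.
have ? := df x; have ? := df1 x.
have dX n : is_derive x 1 (fun y : R => y ^+ n) (n%:R * x ^+ n.-1).
  have := @is_deriveX _ _ id n x 1 1 (is_derive_id _ _).
  by rewrite exprfctE /GRing.scale/= mulr1.
have d1 := dX m.+1; have d2 := dX m.
have amE : a - 1 = m%:R by rewrite aE -natr1 addrK.
rewrite /V; apply: is_derive_eq; rewrite /dV /GRing.scale/= -aE amE.
ring.
Qed.

Let dVE x : x * dV x = x ^+ m * (- (2 * b * x ^+ 3 * f1 x ^+ 2)
   + a ^+ 2 * b * x * f1 x ^+ 2 - a ^+ 2 * b * w * x * f x ^+ 2
   - a * (1 + a * b) * (1 + b * x ^+ 2) * (f x * f1 x)).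
Proof.
have e : (a - 1) * x ^+ m.-1 * x = (a - 1) * x ^+ m.
  have -> : a - 1 = m%:R by rewrite aE -natr1 addrK.
  by case: m => [|k]; rewrite ?mul0r//= exprSr mulrA.
have -> : x * dV x = x ^+ m * (a * x * (f1 x ^+ 2 + w * f x ^+ 2)
   + x * (2 * f1 x * (x * f2 x) + 2 * w * x * (f x * f1 x)))
   + a * (1 + a * b) * ((a - 1) * x ^+ m.-1 * x * (f x * f1 x)
       + x ^+ m * (x * f1 x ^+ 2 + f x * (x * f2 x))).
  by rewrite /dV (exprS x m); ring.
by rewrite e !ode; ring.
Qed.

Let dV_le x : 2 * a <= x -> x ^+ 2 * dV x <= 2 * a * V x.
Proof.
move=> ax; have x0 : 0 <= x by rewrite (le_trans _ ax)// mulr_ge0.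
have ab0 : 0 <= a * b by rewrite mulr_ge0.
apply: (@le_trans _ _ (2 * a * (2^-1 * x ^+ m.+1 * (f x ^+ 2 + f1 x ^+ 2))));
  last first.
  by apply: ler_wpM2l (V_ge ax); rewrite mulr_ge0.
rewrite expr2 -mulrA dVE (exprS x m).
have -> : 2 * a * (2^-1 * (x * x ^+ m) * (f x ^+ 2 + f1 x ^+ 2))
  = x * (x ^+ m * (a * (f x ^+ 2 + f1 x ^+ 2))) by field.
apply: ler_wpM2l => //; apply: ler_wpM2l; first exact: exprn_ge0.
have /(ler_wpM2l a0) : - (f x ^+ 2 + f1 x ^+ 2) <= (1 + a * b) * (f x * f1 x).
  by apply: cross_le => //; lra.
suff : b * x * (- (2 * x ^+ 2 * f1 x ^+ 2) + a ^+ 2 * f1 x ^+ 2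
     - a ^+ 2 * w * f x ^+ 2 - a * (1 + a * b) * x * (f x * f1 x)) <= 0.
  by lra.
apply: mulr_ge0_le0; first exact: mulr_ge0.
have h1 : a ^+ 2 * f x ^+ 2 <= a ^+ 2 * w * f x ^+ 2.
  by rewrite -mulrA ler_wpM2l ?sqr_ge0// ler_peMl// sqr_ge0.
have h2 : a ^+ 2 * f1 x ^+ 2 <= x ^+ 2 * f1 x ^+ 2.
  by rewrite ler_wpM2r ?sqr_ge0// lerXn2r ?nnegrE//; lra.
have h3 : - (x ^+ 2 * f1 x ^+ 2 + a ^+ 2 * f x ^+ 2)
    <= a * (1 + a * b) * x * (f x * f1 x).
  have -> : a * (1 + a * b) * x * (f x * f1 x) =
    (1 + a * b) * (a * f x * (x * f1 x)) by ring.
  have [p|/ltW p] := leP 0 (a * f x * (x * f1 x)).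
    apply: (@le_trans _ _ 0); last by rewrite mulr_ge0// addr_ge0.
    by rewrite oppr_le0 addr_ge0// mulr_ge0// sqr_ge0.
  apply: (@le_trans _ _ (2 * (a * f x * (x * f1 x)))); last exact: ler_wnM2r.
  by have := sqr_ge0 (a * f x + x * f1 x); rewrite -subr_ge0; lra.
lra.
Qed.

(** By [dV_le], V e^(2a/x) does not increase beyond 2a, and the factor stays
    between 1 and e there. *)
Lemma damped_bessel_decay x : 2 * a <= x ->
  x ^+ m.+1 * f x ^+ 2 <= 2 * expR 1 * V (2 * a).
Proof.
move=> ax; have a_gt0 : 0 < a by rewrite (lt_le_trans _ a_ge1).
have x0 : 0 < x by rewrite (lt_le_trans _ ax)// mulr_gt0.
(* Gronwall's factor for V' <= 2 a V / x^2. *)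
pose W x := V x * expR (2 * a * x^-1).
have : W x <= W (2 * a).
  apply: (@is_derive_nincr _ W (fun x => (dV x - 2 * a * V x / x ^+ 2)
      * expR (2 * a * x^-1)) (2 * a)) => // {ax x0}x ax.
  - have x0 : 0 < x by rewrite (lt_le_trans _ ax)// mulr_gt0.
    have dinv : is_derive x 1 (fun y : R => y^-1) (- x ^- 2).
      apply: is_derive_eq; first exact: (@is_deriveV _ id x 1 1 (lt0r_neq0 x0)).
      by rewrite /GRing.scale/= mulr1.
    have dE : is_derive x 1 (fun y : R => expR (2 * a * y^-1))
        (expR (2 * a * x^-1) * (2 * a * - x ^- 2)).
      apply: (@is_derive1_comp _ expR (fun y : R => 2 * a * y^-1)).
    have dV' := is_derive_V x.
    rewrite /W; apply: is_derive_eq; rewrite /GRing.scale/=.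
    ring.
  - have x0 : 0 < x by rewrite (le_lt_trans _ ax)// mulr_ge0.
    apply: mulr_le0_ge0; last exact: expR_ge0.
    rewrite subr_le0 ler_pdivlMr ?exprn_gt0// mulrC.
    exact/dV_le/ltW.
rewrite /W mulfV ?mulf_neq0 ?lt0r_neq0// => WW.
have := V_ge ax; have h : 1 <= expR (2 * a * x^-1).
  by rewrite -expR0 ler_expR divr_ge0 ?(ltW x0)// mulr_ge0.
have V0 : 0 <= V x.
  apply: le_trans (V_ge ax); apply: mulr_ge0.
    by rewrite mulr_ge0 ?invr_ge0// exprn_ge0// ltW.
  by rewrite addr_ge0// sqr_ge0.
have : V x <= W x by rewrite /W ler_peMr.
move=> VW VV.
have : 2^-1 * x ^+ m.+1 * f x ^+ 2 <= 2^-1 * x ^+ m.+1 * (f x ^+ 2 + f1 x ^+ 2).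
  apply: ler_wpM2l; last by rewrite lerDl sqr_ge0.
  by rewrite mulr_ge0 ?invr_ge0// exprn_ge0// ltW.
move: WW VW VV; rewrite /W; lra.
Qed.

Hypothesis f0 : f 0 = 1.
Hypothesis f10 : f1 0 = 0.

Let energy_le x : 0 <= x -> f1 x ^+ 2 + w * f x ^+ 2 <= w.
Proof.
move=> x0; apply: le_trans (damped_energy_le x0) _.
by rewrite f0 f10 expr1n expr0n/= add0r mulr1.
Qed.

Lemma damped_bessel_le1 x : 0 <= x -> `|f x| <= 1.
Proof.
move=> x0; rewrite -(@ler_pXn2r _ 2) ?nnegrE// expr1n -normrX
  ger0_norm ?sqr_ge0//.
have w0 : 0 < w by rewrite (lt_le_trans _ w1).
rewrite -(ler_pM2l w0) mulr1; apply: le_trans (energy_le x0).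
by rewrite lerDr sqr_ge0.
Qed.

Lemma damped_bessel_bound x : 0 <= x ->
  x ^+ m.+1 * f x ^+ 2 <= 4 * expR 1 * (2 * a) ^+ m.+1 * w.
Proof.
move=> x0; have a20 : 0 <= 2 * a by rewrite mulr_ge0.
have P0 : 0 <= (2 * a) ^+ m.+1 by exact: exprn_ge0.
have e1 : 1 <= expR (1 : R) by rewrite -expR0 ler_expR.
have [ax|/ltW xa] := leP (2 * a) x.
  apply: le_trans (damped_bessel_decay ax) _.
  have -> : 4 * expR 1 * (2 * a) ^+ m.+1 * w =
    2 * expR 1 * (2 * (2 * a) ^+ m.+1 * w) by ring.
  apply: ler_wpM2l; first by rewrite mulr_ge0// expR_ge0.
  rewrite /V; have E := energy_le a20.
  have h1 := ler_wpM2l P0 E.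
  have h2 : a * (1 + a * b) * (2 * a) ^+ m * (f (2 * a) * f1 (2 * a)) <=
    (2 * a) ^+ m.+1 * w.
    have -> : (2 * a) ^+ m.+1 * w = a * (2 * a) ^+ m * (2 * w)
      by rewrite exprS; ring.
    have -> : a * (1 + a * b) * (2 * a) ^+ m * (f (2 * a) * f1 (2 * a)) =
      a * (2 * a) ^+ m * ((1 + a * b) * (f (2 * a) * f1 (2 * a))) by ring.
    apply: ler_wpM2l; first by rewrite mulr_ge0// exprn_ge0.
    have ff : f (2 * a) * f1 (2 * a) <= w.
      have := sqr_ge0 (f (2 * a) - f1 (2 * a)).
      have : f (2 * a) ^+ 2 <= w * f (2 * a) ^+ 2 by rewrite ler_peMl// sqr_ge0.
      by have := sqr_ge0 (f1 (2 * a)); have := sqr_ge0 (f (2 * a));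
        rewrite sqrrB; lra.
    have w0 : 0 <= w by exact: le_trans w1.
    have ab0 : 0 <= a * b by rewrite mulr_ge0.
    apply: (@le_trans _ _ ((1 + a * b) * w)); last exact: ler_wpM2r.
    by apply: ler_wpM2l => //; lra.
  lra.
apply: (@le_trans _ _ ((2 * a) ^+ m.+1 * 1)).
  have hx : x ^+ m.+1 <= (2 * a) ^+ m.+1 by apply: lerXn2r; rewrite ?nnegrE.
  have hf : f x ^+ 2 <= 1.
    rewrite -[X in X <= _]ger0_norm ?sqr_ge0// normrX.
    by rewrite exprn_ile1// damped_bessel_le1.
  by apply: ler_pM => //; [exact: exprn_ge0|exact: sqr_ge0].
rewrite mulr1 [4 * expR 1 * _]mulrC -mulrA; apply: ler_peMr => //.
have ew : 1 <= expR 1 * w by rewrite mulr_ege1.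
by rewrite -mulrA; lra.
Qed.

End damped_bessel.

Definition laguerre_exp (R : realType) (h : R) (N : nat) (s : R) : R :=
  expR (- s) * (laguerre h N).[s].

(** At the argument x^2 / (4N) the Laguerre function of degree N oscillates
    like a Bessel function of x, at a rate independent of N. *)
Definition laguerre_wave (R : realType) (h : R) (N : nat) (x : R) : R :=
  laguerre_exp h N (x ^+ 2 / (4 * N%:R)).

Lemma is_derive_comp_half_sqr (R : realType) (p : {poly R}) (b x : R) :
  is_derive x 1 (fun y : R => expR (- (b * y ^+ 2 / 2)) * p.[b * y ^+ 2 / 2])
    (b * x * (expR (- (b * x ^+ 2 / 2)) * (p^`() - p).[b * x ^+ 2 / 2])).
Proof.
have ds : is_derive x 1 (fun y : R => b * y ^+ 2 / 2) (b * x).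
  apply: is_derive_eq; rewrite /GRing.scale/=.
  by field.
have de : is_derive x 1 (fun y : R => expR (- (b * y ^+ 2 / 2)))
    (expR (- (b * x ^+ 2 / 2)) * (- (b * x))).
  exact: (@is_derive1_comp _ expR (fun y : R => - (b * y ^+ 2 / 2))).
have dp : is_derive x 1 (fun y : R => p.[b * y ^+ 2 / 2])
    (p^`().[b * x ^+ 2 / 2] * (b * x)).
  exact: (@is_derive1_comp _ (horner p) (fun y : R => b * y ^+ 2 / 2)).
by apply: is_derive_eq; rewrite /GRing.scale/= hornerD hornerN; ring.
Qed.

(** The wave solves the damped equation with friction b = 1 / (2N) and
    w = 1 + h / N; the condition m.+2 <= N gives a b <= 1 and w <= 2. *)
Lemma laguerre_wave_bound (R : realType) (m N : nat) : (m.+2 <= N)%N ->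
  forall x : R, 0 <= x ->
  `|laguerre_wave (m.+2%:R / 2) N x| <= 1 /\
    x ^+ m.+1 * laguerre_wave (m.+2%:R / 2) N x ^+ 2
    <= 8 * expR 1 * (2 * m.+1%:R) ^+ m.+1.
Proof.
move=> mN x x0; set h : R := m.+2%:R / 2.
have h0 : 0 < h by rewrite divr_gt0.
have N0 : 0 < N%:R :> R by rewrite ltr0n (leq_trans _ mN).
pose b : R := (2 * N%:R)^-1.
have b0 : 0 <= b by rewrite invr_ge0 mulr_ge0// ltW.
(* In the variable s = b x^2 / 2, Laguerre's equation for l becomes the damped
   equation for e^-s l, with w = 2 b (N + h). *)
pose w : R := 1 + h / N%:R.
have w1 : 1 <= w by rewrite lerDl divr_ge0// ltW.
have mNR : m.+2%:R <= N%:R :> R by rewrite ler_nat.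
have w2 : w <= 2.
  rewrite /w -[2]/(1 + 1) lerD2l ler_pdivrMr// mul1r /h.
  by rewrite ler_pdivrMr// (le_trans mNR)// ler_peMr ?ler1n// ltW.
have ab1 : m.+1%:R * b <= 1.
  rewrite /b ler_pdivrMr ?mulr_gt0// mul1r.
  have : m.+1%:R <= N%:R :> R by rewrite ler_nat ltnW.
  by lra.
pose l := laguerre h N; pose s (x : R) := b * x ^+ 2 / 2.
pose f x : R := expR (- s x) * l.[s x].
pose g x : R := expR (- s x) * (l^`() - l).[s x].
pose g1 x : R := expR (- s x) * ((l^`() - l)^`() - (l^`() - l)).[s x].
have dg (x1 : R) :
  is_derive x1 1 (fun x => b * x * g x) (b * g x1 + (b * x1) ^+ 2 * g1 x1).
  have dg := is_derive_comp_half_sqr (l^`() - l) b x1.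
  by apply: is_derive_eq; rewrite /GRing.scale/= /g /g1 /s; ring.
have ode x1 : x1 * (b * g x1 + (b * x1) ^+ 2 * g1 x1)
    = - (m.+1%:R + b * x1 ^+ 2) * (b * x1 * g x1) - w * (x1 * f x1).
  have odes : s x1 * l^`()^`().[s x1] =
      (s x1 - h) * l^`().[s x1] - N%:R * l.[s x1].
    have := congr1 (horner^~ (s x1)) (laguerre_ode N h0).
    by rewrite /= -/l hornerM hornerX hornerD !hornerM !hornerN !hornerM hornerD
      hornerX hornerN !hornerC.
  have sE : b * x1 ^+ 2 = 2 * s x1 by rewrite /s; field.
  have hE : m.+1%:R = 2 * h - 1 by rewrite /h -[m.+2%:R]natr1; field.
  have wE : w = b * (2 * N%:R + 2 * h) by rewrite /w /b; field; rewrite gt_eqF.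
  have -> : x1 * (b * g x1 + (b * x1) ^+ 2 * g1 x1)
    = b * x1 * (g x1 + (b * x1 ^+ 2) * g1 x1) by ring.
  rewrite sE hE wE /f /g /g1 !derivB !hornerD !hornerN !hornerD !hornerN.
  ring: odes.
have laguerre_waveE x1 : laguerre_wave h N x1 = f x1.
  by rewrite /laguerre_wave /laguerre_exp /f /s /b; congr (expR (- _) * _.[_]);
    field; rewrite gt_eqF.
have f0 : f 0 = 1.
  by rewrite /f /s expr0n/= mulr0 mul0r oppr0 expR0 mul1r laguerre_at0.
have f10 : b * 0 * g 0 = 0 by rewrite mulr0 mul0r.
rewrite laguerre_waveE; split.
  exact: (@damped_bessel_le1 R m m.+1%:R b w f (fun x => b * x * g x) _ erefl
    b0 w1 (is_derive_comp_half_sqr l b) dg ode f0 f10).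
apply: le_trans (@damped_bessel_bound R m m.+1%:R b w f (fun x =>
  b * x * g x) _ erefl
    b0 ab1 w1 (is_derive_comp_half_sqr l b) dg ode f0 f10 _ x0) _.
have : 0 <= 4 * expR 1 * (2 * m.+1%:R) ^+ m.+1 :> R.
  by rewrite !mulr_ge0 ?expR_ge0// exprn_ge0// mulr_ge0.
move=> /ler_wpM2l/(_ _ _ w2); lra.
Qed.

(** * A Stirling bound *)

(** The Cayley transform (1 + y) / (1 - y) exceeds e^(2y), with an error of
    third order in y.  The cruder 1 + z <= e^z loses too much to close the
    induction below. *)
Lemma expR2_cayley (R : realType) (y : R) : 0 <= y ->
  (1 - y) * expR (2 * y) <= 1 + y.
Proof.
move=> y0; pose F (z : R) := (1 - z) * expR z - (1 + z) * expR (- z).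
have : F y <= F 0.
  apply: (@is_derive_nincr _ F (fun z => - (z * (expR z - expR (- z)))) 0) =>
    // z z0.
    by apply: is_derive_eq; rewrite /GRing.scale/=; ring.
  by rewrite oppr_le0 mulr_ge0 ?(ltW z0)// subr_ge0 ler_expR; lra.
have -> : F 0 = 0 by rewrite /F oppr0 expR0; ring.
rewrite /F => Fy.
have -> : expR (2 * y) = expR y * expR y by rewrite -expRD; congr expR; lra.
have : ((1 - y) * expR y - (1 + y) * expR (- y)) * expR y <= 0.
  by rewrite mulr_le0_ge0// expR_ge0.
have : expR (- y) * expR y = 1 by rewrite -expRD addNr expR0.
move=> e; rewrite mulrBl -[X in _ - X]mulrA e; lra.
Qed.

(** The upper half of Stirling's formula for h (h + 1) ... (h + N), squared
    because 2 h is an integer while h may not be: with n = N + 1 it says that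
    e^n times the product is at most e h n^(n + h - 1/2). *)
Lemma pochhammer_stirling (R : realType) (m N : nat) (h : R) :
  h = m.+2%:R / 2 ->
  expR 2 ^+ N.+1 * (\prod_(i < N.+1) (h + i%:R)) ^+ 2
    <= expR 2 * h ^+ 2 * N.+1%:R ^+ (2 * N.+1 + m.+1).
Proof.
move=> hE; have hm : 2 * h = m%:R + 2.
  by rewrite hE -[m.+2]addn2 natrD; field.
have h1 : 1 <= h by have := ler0n R m; lra.
elim: N => [|N IH].
  by rewrite big_ord_recr big_ord0/= addr0 mul1r expr1n mulr1 expr1.
rewrite big_ord_recr/=; set P := \prod_(i < N.+1) _ in IH *.
set n : R := N.+1%:R in IH *.
have n1 : 1 <= n by rewrite /n ler1n.
rewrite -[N.+2%:R]natr1 -/n.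
set k := (2 * N.+1 + m.+1)%N in IH *.
have -> : (2 * N.+2 + m.+1 = k.+2)%N by rewrite /k mulnS.
have kE : k%:R = 2 * n + 2 * h - 1.
  by rewrite /k natrD natrM -/n hm -[m.+1%:R]natr1; ring.
suff step : expR 2 * (h + n) ^+ 2 * n ^+ k <= (n + 1) ^+ k.+2.
  rewrite exprS exprMn.
  apply: (@le_trans _ _ (expR 2 * (h + n) ^+ 2 * (expR 2 * h ^+ 2 * n ^+ k))).
    have -> : expR 2 * expR 2 ^+ N.+1 * (P ^+ 2 * (h + n) ^+ 2) =
      expR 2 * (h + n) ^+ 2 * (expR 2 ^+ N.+1 * P ^+ 2) by ring.
    by apply: ler_wpM2l IH; rewrite mulr_ge0 ?expR_ge0 ?sqr_ge0.
  have -> : expR 2 * (h + n) ^+ 2 * (expR 2 * h ^+ 2 * n ^+ k) =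
    expR 2 * h ^+ 2 * (expR 2 * (h + n) ^+ 2 * n ^+ k) by ring.
  by apply: ler_wpM2l step; rewrite mulr_ge0 ?expR_ge0 ?sqr_ge0.
have n0 : 0 < n by rewrite (lt_le_trans _ n1).
have n10 : 0 < n + 1 by rewrite addr_gt0.
have n20 : 0 < 2 * n + 1 by rewrite addr_gt0// mulr_gt0.
(* u bounds the growth of the product and v that of n^k; v has an error of
   order n^-3 only, which lets 2 + 2 u <= k v hold with no correction. *)
set u := (h - 1) / (n + 1).
set v := 2 / (2 * n + 1).
have hn : h + n <= (n + 1) * expR u.
  apply: (@le_trans _ _ ((n + 1) * (1 + u))); last first.
    by apply: ler_wpM2l; [exact: ltW n10|exact: expR_ge1Dx].
  by rewrite /u mulrDr mulr1 mulrCA divff ?gt_eqF// mulr1; lra.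
have nn : n * expR v <= n + 1.
  have y0 : 0 <= (2 * n + 1)^-1 by rewrite invr_ge0 ltW.
  have := expR2_cayley y0; rewrite -/v.
  have -> : 1 - (2 * n + 1)^-1 = 2 * n / (2 * n + 1) by field; rewrite gt_eqF.
  have -> : 1 + (2 * n + 1)^-1 = 2 * (n + 1) / (2 * n + 1)
    by field; rewrite gt_eqF.
  by rewrite mulrAC ler_pM2r ?invr_gt0// -!mulrA ler_pM2l.
have uv : 2 + 2 * u <= k%:R * v.
  have -> : k%:R * v = 2 + 4 * (h - 1) / (2 * n + 1).
    by rewrite kE /v; field; rewrite gt_eqF.
  rewrite lerD2l /u mulrA ler_pdivlMr// mulrAC ler_pdivrMr//.
  have : 0 <= (h - 1) by lra.
  by move=> /(mulr_ge0 (ltW n10)); lra.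
apply: (@le_trans _ _ (expR 2 * ((n + 1) * expR u) ^+ 2 * n ^+ k)).
  apply: ler_wpM2r; first by rewrite exprn_ge0// ltW.
  apply: ler_wpM2l; first exact: expR_ge0.
  by apply: lerXn2r; rewrite // nnegrE ?mulr_ge0 ?expR_ge0//; lra.
have -> : expR 2 * ((n + 1) * expR u) ^+ 2 * n ^+ k
   = (n + 1) ^+ 2 * (expR (2 + 2 * u) * n ^+ k).
  have -> : expR (2 + 2 * u) = expR 2 * expR u ^+ 2 by rewrite expRD expRM_natl.
  by ring.
have -> : k.+2 = (2 + k)%N by [].
rewrite exprD; apply: ler_wpM2l; first exact: sqr_ge0.
apply: (@le_trans _ _ ((n * expR v) ^+ k)).
  rewrite exprMn mulrC -expRM_natl; apply: ler_wpM2l; first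
    by rewrite exprn_ge0// ltW.
  by rewrite ler_expR.
by apply: lerXn2r; rewrite // nnegrE ?mulr_ge0 ?expR_ge0//; lra.
Qed.

(** * Differentiation and integration tools *)
Lemma le_integrableT (d : measure_display) (T : measurableType d) (R : realType)
    (m : {measure set T -> \bar R}) (f g : T -> R) :
  measurable_fun setT f -> (forall x, `|f x| <= g x) ->
  m.-integrable setT (EFin \o g) -> m.-integrable setT (EFin \o f).
Proof.
move=> mf fg; apply: le_integrable => //; first exact/measurable_EFinP.
by move=> x _ /=; rewrite lee_fin (le_trans (fg x))// ler_norm.
Qed.

Lemma is_derive_Rintegral (d : measure_display) (T : measurableType d)
    (R : realType) (m : {measure set T -> \bar R}) (f df : R -> T -> R)
    (G : T -> R) (a u v : R) :
  u < a < v ->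
  (forall x, u < x < v -> m.-integrable setT (EFin \o f x)) ->
  (forall x t, u < x < v -> is_derive x 1 (f^~ t) (df x t)) ->
  (forall x t, u < x < v -> `|df x t| <= G t) ->
  m.-integrable setT (EFin \o G) ->
  is_derive a 1 (fun x => \int[m]_t f x t) (\int[m]_t df a t).
Proof.
move=> uav intf dfE dfG intG.
have Iuv (x : R) : `]u, v[%classic x -> u < x < v by rewrite /= in_itv.
have p1E x t : u < x < v -> partial1of2 f x t = df x t.
  by move=> /(dfE _ t) [_]; rewrite partial1of2E.
have G0 t : 0 <= G t by apply: le_trans (dfG a t uav); exact: normr_ge0.
have Ia : `]u, v[%classic a by rewrite /= in_itv.
have intf' x : `]u, v[%classic x -> m.-integrable setT (EFin \o f x).
  by move=> /Iuv; exact: intf.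
have der x t : `]u, v[%classic x -> setT t -> derivable (f^~ t) x 1.
  by move=> /Iuv /(dfE _ t) [].
have dom x t : `]u, v[%classic x -> setT t -> `|partial1of2 f x t| <= G t.
  by move=> /Iuv xuv _; rewrite p1E// dfG.
apply: DeriveDef.
  exact: (derivable_under_integral measurableT Ia intf' der G0 intG dom).
rewrite -derive1E.
rewrite (differentiation_under_integral measurableT Ia intf' der G0 intG dom).
by apply: eq_Rintegral => t _; rewrite p1E.
Qed.

Lemma horner_le_expR (R : realType) (p : {poly R}) (a : R) : 0 < a ->
  exists2 C : R, 0 <= C & forall q, 0 <= q -> `|p.[q]| <= C * expR (a * q).
Proof.
move=> a0; elim/poly_ind: p => [|p c [C C0 HC]].
  by exists 0 => // q _; rewrite horner0 normr0 mul0r.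
have [{}C {}C0 {}HC] : exists2 C : R, 0 <= C &
    forall q, 0 <= q -> `|p.[q]| * q <= C * expR (a * q).
  have [n nE] : exists n, size p = n by exists (size p).
  exists (\sum_(i < n) `|p`_i| * (i.+1`!%:R / a ^+ i.+1)).
    by apply: sumr_ge0 => i _; rewrite mulr_ge0// divr_ge0 ?exprn_ge0// ltW.
  move=> q q0; rewrite horner_coef nE mulr_suml.
  apply: (@le_trans _ _ (\sum_(i < n) `|p`_i| * q ^+ i.+1)).
    rewrite -[X in _ * X](ger0_norm q0) -normrM mulr_suml.
    apply: le_trans (ler_norm_sum _ _ _) _; apply: ler_sum => i _.
    by rewrite -mulrA normrM -exprSr (ger0_norm (exprn_ge0 _ q0)).
  apply: ler_sum => i _; rewrite -mulrA; apply: ler_wpM2l => //.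
  have := expR_ge1Dxn i (mulr_ge0 (ltW a0) q0).
  have ai : 0 < a ^+ i.+1 by rewrite exprn_gt0.
  have fi : 0 < i.+1`!%:R :> R by rewrite ltr0n fact_gt0.
  rewrite exprMn => H; rewrite -mulrA [_^-1 * _]mulrC mulrA.
  rewrite ler_pdivlMr// mulrC mulrC -ler_pdivrMl//.
  apply: le_trans H; rewrite mulrA [_^-1 * _]mulrC; lra.
exists (C + `|c|); first by rewrite addr_ge0.
move=> q q0; rewrite hornerMXaddC mulrDl.
apply: le_trans (ler_normD _ _) _; apply: lerD.
  by rewrite normrM (ger0_norm q0) HC.
by rewrite ler_peMr// -expR0 ler_expR mulr_ge0// ltW.
Qed.

(** The fundamental theorem of calculus between -n and n, and dominated
    convergence.  With a product for F this is integration by parts. *)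
Lemma integral_derive_cvg0 (R : realType) (F f : R -> R) :
  (forall x : R, is_derive x 1 F (f x)) -> continuous f ->
  lebesgue_measure.-integrable setT (EFin \o f) ->
  F n%:R @[n --> \oo] --> 0 -> F (- n%:R) @[n --> \oo] --> 0 ->
  \int[lebesgue_measure]_x f x = 0.
Proof.
move=> dF cf intf F0 FN0.
pose I n : set R := `[- n.+1%:R, n.+1%:R]%classic.
have mI n : measurable (I n) by exact: measurable_itv.
pose g n x := ((f \_ (I n)) x)%:E.
have mf : measurable_fun setT f
  by move: intf => /measurable_int/measurable_EFinP.
have [|||||_ _] :=
  @dominated_convergence _ _ _ lebesgue_measure setT measurableT
  g (EFin \o f) (abse \o (EFin \o f)).
- move=> n; apply/measurable_EFinP; apply/(measurable_restrictT f) => //.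
  exact: measurable_funTS.
- exact/measurable_EFinP.
- apply: aeW => x _; apply: cvg_near_cst.
  near=> n; rewrite /g patchE ifT// inE /I /= in_itv/=.
  rewrite -ler_norml; near: n.
  exists `|Num.ceil `|x| |%N => // n /= xn.
  apply: le_trans (Num.Theory.ceil_ge _) _.
  rewrite -[_%:~R]ger0_norm ?ler0z ?ceil_ge0//; last
    by rewrite (lt_le_trans _ (normr_ge0 x)).
  rewrite -intr_norm -natr_absz ler_nat.
  by rewrite (leq_trans xn).
- exact: integrable_abse.
- apply: aeW => x n _ /=; rewrite /g patchE; case: ifP => // _.
  by rewrite normr0 lee_fin normr_ge0.
move=> cvgI; rewrite /Rintegral.
suff -> : (\int[lebesgue_measure]_x (f x)%:E = 0)%E by [].
apply/esym; apply: (cvg_unique _ _ cvgI) => //.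
rewrite (_ : [sequence _]_n = fun n =>
  (F n.+1%:R - F (- n.+1%:R))%:E); last first.
  apply/funext => n /=; rewrite /g.
  have -> : (fun x => ((f \_ (I n)) x)%:E) = (EFin \o f) \_ (I n).
    by apply/funext => x; rewrite !patchE; case: ifP.
  rewrite -integral_mkcond.
  have nn : - n.+1%:R < n.+1%:R :> R by rewrite gtrN.
  rewrite (@continuous_FTC2 _ f F)//.
  - exact: continuous_subspaceT.
  - split.
    + by move=> x _; case: (dF x).
    + apply: cvg_at_right_filter; apply: differentiable_continuous.
      by apply/derivable1_diffP; case: (dF (- n.+1%:R)).
    + apply: cvg_at_left_filter; apply: differentiable_continuous.
      by apply/derivable1_diffP; case: (dF n.+1%:R).
  - by move=> x _; rewrite derive1E; case: (dF x).
apply: cvg_EFin; first exact: nearW.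
rewrite -[0]subr0; apply: cvgB.
  by move: F0; rewrite -cvg_shiftS.
by move: FN0; rewrite -cvg_shiftS.
Unshelve. all: by end_near. Qed.

Lemma integrableT_scale (d : measure_display) (T : measurableType d)
    (R : realType) (m : {measure set T -> \bar R}) (k : R) (f : T -> R) :
  m.-integrable setT (EFin \o f) ->
  m.-integrable setT (EFin \o (fun x => k * f x)).
Proof.
move=> intf; rewrite (_ : _ \o _ = fun x => (k%:E * (f x)%:E)%E).
  exact: integrableZl.
by apply/funext => x; rewrite /= EFinM.
Qed.

(** * Fourier transforms of Gaussians *)
Section gauss_integrable.
Variables (R : realType) (a : R).
Hypothesis a0 : 0 < a.
Local Notation mu := (@lebesgue_measure R).
Let G (x : R) : R := expR (- (a * x ^+ 2)).

Let sigma := Num.sqrt (2 * a)^-1.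
Let sigma0 : sigma != 0.
Proof. by rewrite gt_eqF// sqrtr_gt0 invr_gt0 mulr_gt0. Qed.

Let GE x : G x = normal_fun 0 sigma x.
Proof.
rewrite /G /normal_fun subr0 sqr_sqrtr; last by rewrite invr_ge0 mulr_ge0// ltW.
by congr expR; field; rewrite gt_eqF.
Qed.

Let G_pdf x : G x = (normal_peak sigma)^-1 * normal_pdf 0 sigma x.
Proof.
by rewrite normal_pdfE//= mulKf ?GE// gt_eqF// normal_peak_gt0//.
Qed.

Lemma integrable_gauss :
  mu.-integrable setT (fun x => (expR (- (a * x ^+ 2)))%:E).
Proof.
rewrite (_ : (fun x => _) =
  (fun x => ((normal_peak sigma)^-1%:E * (normal_pdf 0 sigma x)%:E)%E)).
  by apply: integrableZl => //; exact: integrable_normal_pdf.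
by apply/funext => x; rewrite -EFinM -G_pdf.
Qed.

Lemma Rintegral_gauss : \int[mu]_x (expR (- (a * x ^+ 2))) = Num.sqrt (pi / a).
Proof.
transitivity (\int[mu]_x ((normal_peak sigma)^-1 * normal_pdf 0 sigma x)).
  by apply: eq_Rintegral => x _; rewrite -G_pdf.
rewrite RintegralZl//; last exact: integrable_normal_pdf.
rewrite /Rintegral integral_normal_pdf//= mulr1 /normal_peak invrK.
rewrite sqr_sqrtr; last by rewrite invr_ge0 mulr_ge0// ltW.
by congr Num.sqrt; field; rewrite gt_eqF.
Qed.

End gauss_integrable.

Section gauss_cos.
Variables (R : realType) (a : R).
Hypothesis a0 : 0 < a.
Local Notation mu := (@lebesgue_measure R).
Let G (x : R) : R := expR (- (a * x ^+ 2)).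

Let cG : continuous G.
Proof.
move=> x; apply: continuous_comp; last exact: continuous_expR.
apply: continuousN; apply: continuousM; first exact: cst_continuous.
exact: exprn_continuous.
Qed.

Let integrable_xG : mu.-integrable setT (fun x => ((1 + x ^+ 2) * G x)%:E).
Proof.
have a20 : 0 < a / 2 by rewrite divr_gt0.
have [C C0 HC] := @horner_le_expR R (1%:P + 'X) _ a20.
have hint : mu.-integrable setT
  (EFin \o (fun x => C * expR (- (a / 2 * x ^+ 2)))).
  by apply: integrableT_scale; apply: integrable_gauss.
apply: (@le_integrableT _ _ _ _ _ _ _ _ hint).
  apply: measurable_funM; last exact: continuous_measurable_fun.
  by apply: measurable_funD => //; exact: exprn_measurable.
move=> x; rewrite normrM [X in _ * X]ger0_norm ?expR_ge0//.
have := HC _ (sqr_ge0 x); rewrite hornerD hornerX hornerC => /ler_wpM2r =>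
  /(_ (G x) (expR_ge0 _)).
move/le_trans; apply; rewrite -[X in X <= _]mulrA /G -expRD;
  apply: ler_wpM2l => //.
have e (z : R) : a / 2 * z + - (a * z) = - (a / 2 * z) by field.
by rewrite ler_expR e.
Qed.

Let integrable_wave (g : R -> R) : measurable_fun setT g ->
  (forall x, `|g x| <= 1) -> mu.-integrable setT (fun x => (G x * g x)%:E).
Proof.
move=> mg g1; apply: (@le_integrableT _ _ _ _ _ _ _ _ (integrable_gauss a0)).
  by apply: measurable_funM => //; exact: continuous_measurable_fun.
by move=> x; rewrite normrM ger0_norm ?expR_ge0// ler_piMr// expR_ge0.
Qed.

Variable theta : R.

Let F (y : R) : R := \int[mu]_x (G x * cos (x * y + theta)).

Let cphase (y : R) : continuous (fun x : R => x * y + theta).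
Proof.
move=> x; apply: cvgD; last exact: cvg_cst.
by apply: cvgM; [exact: cvg_id|exact: cvg_cst].
Qed.

Let mcos (y : R) : measurable_fun setT (fun x : R => cos (x * y + theta)).
Proof.
apply: continuous_measurable_fun => x.
by apply: continuous_comp; [exact: cphase|exact: continuous_cos].
Qed.

Let msin (y : R) : measurable_fun setT (fun x : R => sin (x * y + theta)).
Proof.
apply: continuous_measurable_fun => x.
by apply: continuous_comp; [exact: cphase|exact: continuous_sin].
Qed.

Let integrable_Gcos (y : R) :
  mu.-integrable setT (EFin \o (fun x => G x * cos (x * y + theta))).
Proof.
apply: (@integrable_wave (fun x => cos (x * y + theta))); first exact: mcos.
by move=> x; rewrite ler_norml cos_geN1 cos_le1.
Qed.

Let dom_xG (z x : R) : `|G x * (- x * sin (x * z + theta))| <=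
  (1 + x ^+ 2) * G x.
Proof.
rewrite normrM [X in X * _]ger0_norm ?expR_ge0// mulrC.
apply: ler_wpM2r; first exact: expR_ge0.
rewrite normrM normrN; apply: (@le_trans _ _ `|x|).
  by rewrite ler_piMr// ler_norml sin_geN1 sin_le1.
have := sqr_ge0 (`|x| - 1); rewrite -(real_normK (num_real x)).
by have := normr_ge0 x; rewrite sqrrB expr1n mulr1 mulr2n; lra.
Qed.

Let is_derive_F (y : R) :
  is_derive y 1 F (\int[mu]_x (G x * (- x * sin (x * y + theta)))).
Proof.
apply: (@is_derive_Rintegral _ _ _ mu (fun y x => G x * cos (x * y + theta))
  (fun y x => G x * (- x * sin (x * y + theta))) (fun x => (1 + x ^+ 2) * G x)
  y (y - 1) (y + 1)).
- by rewrite ltrBlDr !ltrDl ltr01.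
- by move=> z _; exact: integrable_Gcos.
- move=> z x _; have dc :
    is_derive z 1 (fun z : R => cos (x * z + theta))
    (- sin (x * z + theta) * x).
    apply: (@is_derive1_comp _ (@cos R) (fun z : R => x * z + theta)).
    by apply: is_derive_eq; rewrite /GRing.scale/= mulr1 addr0.
  by apply: is_derive_eq; rewrite /GRing.scale/=; ring.
- by move=> z x _; exact: dom_xG.
- exact: integrable_xG.
Qed.

Let parts (y : R) : \int[mu]_x (G x * (- x * sin (x * y + theta))) =
  - (y / (2 * a)) * F y.
Proof.
(* H vanishes at infinity, and its derivative h is the difference of the two
   integrands. *)
pose H (x : R) := (2 * a)^-1 * (G x * sin (x * y + theta)).
pose h (x : R) := G x * (- x * sin (x * y + theta)) + y / (2 * a) *
  (G x * cos (x * y + theta)).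
have i1 : mu.-integrable setT
  (EFin \o (fun x => G x * (- x * sin (x * y + theta)))).
  apply: (@le_integrableT _ _ _ _ _ _ _ _ integrable_xG).
    apply: measurable_funM; first exact: continuous_measurable_fun.
    by apply: measurable_funM; [exact: oppr_measurable|exact: msin].
  exact: dom_xG.
have i2 : mu.-integrable setT
  (EFin \o (fun x => y / (2 * a) * (G x * cos (x * y + theta)))).
  by apply: integrableT_scale; exact: integrable_Gcos.
have H0 (g : R -> R) : (forall x, g x ^+ 2 = x ^+ 2) ->
  H (g n%:R) @[n --> \oo] --> 0.
  move=> gE; apply: norm_cvg0.
  have inv0 : (2 * a)^-1 * (a^-1 * harmonic n) @[n --> \oo] --> 0.
    rewrite -[0](mulr0 (2 * a)^-1); apply: cvgM; first exact: cvg_cst.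
    rewrite -[0](mulr0 a^-1); apply: cvgM; first exact: cvg_cst.
    exact: cvg_harmonic.
  rewrite -(cvg_shiftS (fun n => `|H (g n%:R)|)).
  apply: (squeeze_cvgr _ _ inv0); last exact: (@cvg_cst _ (0 : R)).
  apply: nearW => n; rewrite normr_ge0/= /H normrM ger0_norm; last first.
    by rewrite invr_ge0 mulr_ge0// ltW.
  apply: ler_wpM2l; first by rewrite invr_ge0 mulr_ge0// ltW.
  rewrite normrM ger0_norm ?expR_ge0// /G gE.
  apply: (@le_trans _ _ (expR (- (a * n.+1%:R ^+ 2)))).
    by rewrite ler_piMr ?expR_ge0// ler_norml sin_geN1 sin_le1.
  rewrite expRN /harmonic -invfM lef_pV2 ?posrE ?expR_gt0 ?mulr_gt0//.
  apply: le_trans (expR_ge1Dx _); apply: (@le_trans _ _ (a * n.+1%:R ^+ 2)).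
    by rewrite ler_pM2l// expr2 ler_peMr// ler1n.
  by rewrite lerDr.
have h0 : \int[mu]_x h x = 0.
  apply: (@integral_derive_cvg0 _ H h).
  - move=> x.
    have ds : is_derive x 1 (fun x : R => sin (x * y + theta))
      (cos (x * y + theta) * y).
      apply: (@is_derive1_comp _ (@sin R) (fun x : R => x * y + theta)).
      by apply: is_derive_eq; rewrite /GRing.scale/=; ring.
    have dG : is_derive x 1 G (G x * (- (a * (2 * x)))).
      apply: (@is_derive1_comp _ expR (fun x : R => - (a * x ^+ 2))).
      by apply: is_derive_eq; rewrite /GRing.scale/=; ring.
    rewrite /H; apply: is_derive_eq; rewrite /GRing.scale/= /h.
    by field; rewrite gt_eqF.
  - move=> x; apply: cvgD; apply: cvgM.
    + exact: cG.
    + apply: cvgM; first by apply: cvgN; exact: cvg_id.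
      by apply: continuous_comp; [exact: cphase|exact: continuous_sin].
    + exact: cvg_cst.
    + apply: cvgM; first exact: cG.
      by apply: continuous_comp; [exact: cphase|exact: continuous_cos].
  - by rewrite /h; apply: (@integrableD _ _ _ mu setT measurableT _ _ i1 i2).
  - exact: (@H0 id).
  - by apply: (@H0 -%R) => x; rewrite sqrrN.
have iG := integrable_Gcos y.
move: h0; rewrite /h (RintegralD measurableT i1 i2)
  (RintegralZl _ measurableT iG).
by move=> /eqP; rewrite addr_eq0 => /eqP ->; rewrite mulNr.
Qed.

(** The integral F satisfies F' = - y / (2a) F by parts.  The phase theta lets
    one coordinate be integrated out at a time in higher dimension, where the
    other coordinates contribute to the phase. *)
Lemma Rintegral_gauss_cos (y : R) :
  \int[mu]_x (expR (- (a * x ^+ 2)) * cos (x * y + theta)) =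
  Num.sqrt (pi / a) * cos theta * expR (- (y ^+ 2 / (4 * a))).
Proof.
pose P y := F y * expR (y ^+ 2 / (4 * a)).
have dP (z : R) : is_derive z 1 P 0.
  have dF := is_derive_F z.
  have de : is_derive z 1 (fun y : R => expR (y ^+ 2 / (4 * a)))
    (expR (z ^+ 2 / (4 * a)) * (z / (2 * a))).
    apply: (@is_derive1_comp _ expR (fun y : R => y ^+ 2 / (4 * a))).
    apply: is_derive_eq; rewrite /GRing.scale/=.
    by field; rewrite gt_eqF.
  rewrite /P; apply: is_derive_eq; rewrite /GRing.scale/= parts; ring.
have := is_derive_0_is_cst y 0 dP;
  rewrite /P -/(F y) expr0n/= mul0r expR0 mulr1 => PE.
have F0 : F 0 = Num.sqrt (pi / a) * cos theta.
  rewrite /F; under eq_Rintegral do rewrite mulr0 add0r.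
  by rewrite RintegralZr// ?Rintegral_gauss//; exact: integrable_gauss.
by rewrite expRN -F0 -PE mulfK// gt_eqF// expR_gt0.
Qed.

End gauss_cos.

(** * Fubini's theorem under product domination *)

(** Wherever two integrations are exchanged below, the integrand is dominated
    by a product of integrable functions of one variable each. *)
Section fubini_dominated.
Context d1 d2 (T1 : measurableType d1) (T2 : measurableType d2) (R : realType).
Variables (m1 : {sigma_finite_measure set T1 -> \bar R}).
Variables (m2 : {sigma_finite_measure set T2 -> \bar R}).
Variables (f : T1 * T2 -> R) (g1 : T1 -> R) (g2 : T2 -> R).
Hypothesis mf : measurable_fun setT f.
Hypothesis fg : forall x y, `|f (x, y)| <= g1 x * g2 y.
Hypothesis ig1 : m1.-integrable setT (EFin \o g1).
Hypothesis ig2 : m2.-integrable setT (EFin \o g2).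

Lemma dominated_section1 x : m2.-integrable setT (fun y => (f (x, y))%:E).
Proof.
apply: (@le_integrableT _ _ _ _ _ (fun y => g1 x * g2 y)) => //.
  exact: (measurableT_comp mf (pair1_measurable x)).
exact: integrableT_scale.
Qed.

Lemma dominated_section2 y : m1.-integrable setT (fun x => (f (x, y))%:E).
Proof.
apply: (@le_integrableT _ _ _ _ _ (fun x => g2 y * g1 x)) => //.
- exact: (measurableT_comp mf (pair2_measurable y)).
- by move=> x; rewrite mulrC.
- exact: integrableT_scale.
Qed.

Lemma dominated_integrable_prod : (m1 \x m2)%E.-integrable setT (EFin \o f).
Proof.
apply/integrable12ltyP; first exact/measurable_EFinP.
have mg1 : measurable_fun setT (fun x => (`|g1 x|)%:E).
  by apply/measurable_EFinP/measurableT_comp => //;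
    apply/measurable_EFinP/(measurable_int _ ig1).
have mg2 : measurable_fun setT (fun x => (`|g2 x|)%:E).
  by apply/measurable_EFinP/measurableT_comp => //;
    apply/measurable_EFinP/(measurable_int _ ig2).
case/integrableP: (ig1) => mm1 /= lty1; case/integrableP: (ig2) => mm2 /= lty2.
apply: (@le_lt_trans
  _ _ (\int[m1]_x ((`|g1 x|)%:E * \int[m2]_y (`|g2 y|)%:E))%E).
  apply: ge0_le_integral => //.
  - by move=> x _; apply: integral_ge0.
  - apply: (@measurable_fun_fubini_tonelli_F _ _ _ _ R m2
      (fun z => (`|f z|)%:E)) => //=.
    exact/measurable_EFinP/measurableT_comp.
  - by apply: emeasurable_funM => //; exact: measurable_cst.
  move=> x _; rewrite -ge0_integralZl//.
  apply: ge0_le_integral => //.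
  - apply/measurable_EFinP; apply: measurableT_comp => //.
    exact: (measurableT_comp mf (pair1_measurable x)).
  - by apply: emeasurable_funM => //; exact: measurable_cst.
  move=> y _; rewrite /= -EFinM lee_fin; apply: le_trans (fg x y) _.
  by rewrite -normrM ler_norm.
rewrite ge0_integralZr//; last by apply: integral_ge0.
rewrite -ge0_fin_numE ?integral_ge0// in lty1.
rewrite -ge0_fin_numE ?integral_ge0// in lty2.
rewrite -ge0_fin_numE; first by rewrite fin_numM.
by rewrite mule_ge0// integral_ge0.
Qed.

Lemma Rintegral_prod :
  \int[(m1 \x m2)%E]_z f z = \int[m1]_x \int[m2]_y f (x, y).
Proof.
rewrite /Rintegral -(integral12_prod_meas1
  dominated_integrable_prod)/fubini_F/=.
congr fine; apply: eq_integral => x _; rewrite fineK//.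
by apply: integrable_fin_num => //; exact: dominated_section1.
Qed.

Lemma Rintegral_swap :
  \int[m1]_x \int[m2]_y f (x, y) = \int[m2]_y \int[m1]_x f (x, y).
Proof.
rewrite -Rintegral_prod
  /Rintegral -(integral21_prod_meas1 dominated_integrable_prod)/fubini_G/=.
congr fine; apply: eq_integral => x _; rewrite fineK//.
by apply: integrable_fin_num => //; exact: dominated_section2.
Qed.

Lemma dominated_measurable1 :
  measurable_fun setT (fun x => \int[m2]_y f (x, y)).
Proof.
apply/measurable_EFinP.
have := measurable_int _ (integrable_fubini_F dominated_integrable_prod).
apply: eq_measurable_fun => x _ /=; rewrite fineK//.
by apply: integrable_fin_num => //; exact: dominated_section1.
Qed.

Lemma dominated_integrable1 :
  m1.-integrable setT (EFin \o fun x => \int[m2]_y f (x, y)).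
Proof.
have := integrable_fubini_F dominated_integrable_prod.
apply: eq_integrable => // x _ /=; rewrite fineK//.
by apply: integrable_fin_num => //; exact: dominated_section1.
Qed.

End fubini_dominated.

Lemma sigma_finite_measure_pack d (T : measurableType d) (R : realType)
    (P : {measure set T -> \bar R}) : sigma_finite setT P ->
  exists M : {sigma_finite_measure set T -> \bar R},
    M = P :> (set T -> \bar R).
Proof.
move=> fin.
pose H1 := isSFinite.Build _ _ _ (Measure.sort P)
  (sfinite_measure_sigma_finite fin).
pose H2 := isSigmaFinite.Build _ _ _ (Measure.sort P) fin.
pose M := HB.pack_for (SigmaFiniteMeasure.type T R) (Measure.sort P) H1 H2.
by exists M.
Qed.

Lemma product_sigma_finite d1 d2 (T1 : measurableType d1)
    (T2 : measurableType d2) (R : realType)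
    (m1 : {sigma_finite_measure set T1 -> \bar R})
    (m2 : {sigma_finite_measure set T2 -> \bar R}) :
  exists M : {sigma_finite_measure set (T1 * T2)%type -> \bar R},
    M = (m1 \x m2)%E :> (set (T1 * T2) -> \bar R).
Proof.
have fin : sigma_finite setT (m1 \x m2)%E.
  have /sigma_finiteP[F [TF ndF Foo]] := sigma_finiteT m1.
  have /sigma_finiteP[G [TG ndG Goo]] := sigma_finiteT m2.
  exists (fun n => F n `*` G n) => [|k].
    rewrite -setXTT TF TG predeqE => -[x y]; split.
      move=> [/= [n _ Fnx] [k _ Gky]]; exists (maxn n k) => //; split.
      - by move: x Fnx; exact/subsetPset/ndF/leq_maxl.
      - by move: y Gky; exact/subsetPset/ndG/leq_maxr.
    by move=> [n _ []/= ? ?]; split; exists n.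
  have [? ?] := Foo k; have [? ?] := Goo k.
  split; first exact: measurableX.
  by rewrite product_measure1E// lte_mul_pinfty// ge0_fin_numE.
exact: (@sigma_finite_measure_pack _ _ _ (m1 \x m2)%E fin).
Qed.

(** * The frequency space and the Fourier transform of Laguerre functions *)

(** The space T is R^n with Lebesgue measure and coordinate functions xi,
    built as an iterated product.  The Fourier transform of Gaussians is the
    only fact about it that the sequel uses, so T can stay abstract. *)
Lemma gauss_features (R : realType) n : exists (d : measure_display)
  (T : measurableType d) (m : {sigma_finite_measure set T -> \bar R})
  (xi : 'I_n -> T -> R), (forall i, measurable_fun setT (xi i)) /\
  forall a, 0 < a ->
    m.-integrable setT (EFin \o fun t => expR (- (a * \sum_i xi i t ^+ 2))) /\
    forall (x : 'I_n -> R) theta,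
      \int[m]_t (expR (- (a * \sum_i xi i t ^+ 2))
                 * cos (\sum_i xi i t * x i + theta))
      = Num.sqrt (pi / a) ^+ n * cos theta *
        expR (- ((\sum_i x i ^+ 2) / (4 * a))).
Proof.
elim: n => [|n [d [T [m [xi [mxi IH]]]]]].
  exists _, unit, (dirac tt), (fun _ _ => 0); split => [i|a a0];
    first exact: measurable_cst.
  have iC : (dirac tt : {measure set unit -> \bar R}).-integrable setT
    (EFin \o (fun=> 1 : R)).
    exact: finite_measure_integrable_cst.
  split.
    by under eq_fun do rewrite big_ord0 mulr0 oppr0 expR0.
  move=> x theta; have -> : \sum_(i < 0) x i ^+ 2 = 0 by rewrite big_ord0.
  rewrite expr0 mul0r oppr0 expR0 mulr1 mul1r.
  rewrite /Rintegral integral_dirac//= indicT mul1r.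
  by rewrite !big_ord0 mulr0 oppr0 expR0 mul1r add0r.
pose xi' (i : 'I_n.+1) (z : measurableTypeR R * T) : R :=
  if unlift ord0 i is Some j then xi j z.2 else z.1.
pose leb : {sigma_finite_measure set (measurableTypeR R) -> \bar R} :=
  @lebesgue_measure R.
have [M ME] := product_sigma_finite leb m.
exists _, (measurableTypeR R * T)%type, M, xi'; rewrite ME; split.
  move=> i; rewrite /xi'; case: unliftP => [j|] _.
    exact: (measurableT_comp (mxi j) measurable_snd).
  exact: measurable_fst.
move=> a a0; have [ia IHa] := IH a a0.
have qE z : \sum_i xi' i z ^+ 2 = z.1 ^+ 2 + \sum_i xi i z.2 ^+ 2.
  rewrite big_ord_recl /xi' unlift_none; congr (_ + _).
  by apply: eq_bigr => i _; rewrite liftK.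
have pE x z : \sum_i xi' i z * x i =
  z.1 * x ord0 + \sum_i xi i z.2 * x (lift ord0 i).
  rewrite big_ord_recl /xi' unlift_none; congr (_ + _).
  by apply: eq_bigr => i _; rewrite liftK.
have eE z : expR (- (a * \sum_i xi' i z ^+ 2)) =
    expR (- (a * z.1 ^+ 2)) * expR (- (a * \sum_i xi i z.2 ^+ 2)).
  by rewrite -expRD qE mulrDr opprD.
have m1 : measurable_fun setT (fun y : measurableTypeR R =>
  expR (- (a * y ^+ 2))).
  by have /measurable_int/measurable_EFinP := integrable_gauss a0.
have m2 : measurable_fun setT (fun t => expR (- (a * \sum_i xi i t ^+ 2))).
  by have /measurable_int/measurable_EFinP := ia.
have me : measurable_fun setT (fun z : measurableTypeR R * T =>
    expR (- (a * z.1 ^+ 2)) * expR (- (a * \sum_i xi i z.2 ^+ 2))).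
  apply: measurable_funM.
    exact: (measurableT_comp m1 measurable_fst).
  exact: (measurableT_comp m2 measurable_snd).
split.
  rewrite (_ : EFin \o _ = EFin \o (fun z : measurableTypeR R * T =>
    expR (- (a * z.1 ^+ 2)) * expR (- (a * \sum_i xi i z.2 ^+ 2)))); last first.
    by apply/funext => z /=; rewrite eE.
  apply: (dominated_integrable_prod me _ (integrable_gauss a0) ia) => y t.
  by rewrite /= ger0_norm// mulr_ge0 ?expR_ge0.
move=> x theta.
pose f (z : measurableTypeR R * T) :=
  expR (- (a * z.1 ^+ 2)) * expR (- (a * \sum_i xi i z.2 ^+ 2))
  * cos (\sum_i xi i z.2 * x (lift ord0 i) + (z.1 * x ord0 + theta)).
have fE z : expR (- (a * \sum_i xi' i z ^+ 2)) *
  cos (\sum_i xi' i z * x i + theta) = f z.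
  by rewrite eE pE /f; congr (_ * cos _); rewrite addrCA addrA.
have mfc : measurable_fun setT f.
  apply: measurable_funM => //; apply: measurableT_comp.
    by apply: continuous_measurable_fun; exact: continuous_cos.
  apply: measurable_funD.
    apply: measurable_sum => i; apply: measurable_funM;
      last exact: measurable_cst.
    exact: (measurableT_comp (mxi i) measurable_snd).
  apply: measurable_funD; last exact: measurable_cst.
  by apply: measurable_funM; [exact: measurable_fst|exact: measurable_cst].
have fg y t : `|f (y, t)| <=
  expR (- (a * y ^+ 2)) * expR (- (a * \sum_i xi i t ^+ 2)).
  rewrite /f normrM ger0_norm ?mulr_ge0 ?expR_ge0//=.
  by rewrite ler_piMr ?mulr_ge0 ?expR_ge0// ler_norml cos_geN1 cos_le1.
under eq_Rintegral do rewrite fE.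
transitivity (\int[(leb \x m)%E]_z f z); first
  by rewrite /Rintegral; congr (fine (integral _ _ _)); exact: ME.
rewrite (@Rintegral_prod _ _ _ _ R leb m f _ _ mfc fg (integrable_gauss a0) ia).
set S := Num.sqrt (pi / a);
  set E := expR (- ((\sum_i x (lift ord0 i) ^+ 2) / (4 * a))).
transitivity (\int[lebesgue_measure]_y
  ((S ^+ n * E) * (expR (- (a * y ^+ 2)) * cos (y * x ord0 + theta)))).
  apply: eq_Rintegral => y _.
  transitivity (\int[m]_t
    (expR (- (a * y ^+ 2)) * (expR (- (a * \sum_i xi i t ^+ 2))
  * cos (\sum_i xi i t * x (lift ord0 i) + (y * x ord0 + theta))))).
    by apply: eq_Rintegral => t _; rewrite /f /= mulrA.
  rewrite RintegralZl//.
    by rewrite (IHa (fun i => x (lift ord0 i))) -/S -/E; ring.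
  apply: (@le_integrableT _ _ _ _ _ _ _ _ ia).
    apply: measurable_funM => //; apply: measurableT_comp.
    by apply: continuous_measurable_fun; exact: continuous_cos.
    apply: measurable_funD; last exact: measurable_cst.
    by apply: measurable_sum => i; apply: measurable_funM;
      [exact: mxi|exact: measurable_cst].
  move=> t; rewrite normrM ger0_norm ?expR_ge0//.
  by rewrite ler_piMr ?expR_ge0// ler_norml cos_geN1 cos_le1.
rewrite RintegralZl//; last first.
  apply: (@le_integrableT _ _ _ _ _ _ _ _ (integrable_gauss a0)).
    apply: measurable_funM => //; apply: measurableT_comp.
    by apply: continuous_measurable_fun; exact: continuous_cos.
    apply: measurable_funD; last exact: measurable_cst.
    by apply: measurable_funM; last exact: measurable_cst.
  move=> y; rewrite normrM ger0_norm ?expR_ge0//.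
  by rewrite ler_piMr ?expR_ge0// ler_norml cos_geN1 cos_le1.
have -> : expR (- ((\sum_i x i ^+ 2) / (4 * a))) =
  expR (- (x ord0 ^+ 2 / (4 * a))) * E.
  by rewrite /E -expRD big_ord_recl; congr expR; field; rewrite gt_eqF.
by rewrite Rintegral_gauss_cos// -/S (exprSr S); ring.
Qed.

Section laguerre_features.
Context (R : realType) (n : nat) (d : measure_display) (T : measurableType d).
Variables (m : {sigma_finite_measure set T -> \bar R}) (xi : 'I_n -> T -> R).
Local Notation q t := (\sum_i xi i t ^+ 2).
Hypothesis mxi : forall i, measurable_fun setT (xi i).
Hypothesis Hxi : forall a, 0 < a ->
    m.-integrable setT (EFin \o fun t => expR (- (a * q t))) /\
    forall (x : 'I_n -> R) theta,
      \int[m]_t (expR (- (a * q t)) * cos (\sum_i xi i t * x i + theta))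
      = Num.sqrt (pi / a) ^+ n * cos theta *
        expR (- ((\sum_i x i ^+ 2) / (4 * a))).

Let q_ge0 t : 0 <= q t.
Proof. by apply: sumr_ge0 => i _; exact: sqr_ge0. Qed.

Let measurable_q : measurable_fun setT (fun t => q t).
Proof. by apply: measurable_sum => i; exact: measurable_funX. Qed.

Lemma measurable_cos_dot (x : 'I_n -> R) :
  measurable_fun setT (fun t => cos (\sum_i xi i t * x i)).
Proof.
apply: measurableT_comp.
  by apply: continuous_measurable_fun; exact: continuous_cos.
by apply: measurable_sum => i; apply: measurable_funM;
  [exact: mxi|exact: measurable_cst].
Qed.

Lemma measurable_horner (p : {poly R}) : measurable_fun setT (horner p).
Proof.
apply: continuous_measurable_fun => x.
by apply: differentiable_continuous; apply/derivable1_diffP;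
  exact: derivable_horner.
Qed.

Lemma measurable_laguerre_type (p : {poly R}) (a : R) :
  measurable_fun setT (fun t => expR (- (a * q t)) * p.[a * q t]).
Proof.
have maq : measurable_fun setT (fun t => a * q t).
  by apply: measurable_funM; [exact: measurable_cst|exact: measurable_q].
apply: measurable_funM.
  by apply: measurableT_comp => //; exact: measurableT_comp.
exact: (measurableT_comp (measurable_horner p) maq).
Qed.

Lemma laguerre_type_le (p : {poly R}) : exists2 C : R, 0 <= C &
  forall s : R, 0 <= s -> `|expR (- s) * p.[s]| <= C * expR (- (s / 2)).
Proof.
have [|C C0 HC] := @horner_le_expR R p 2^-1; first by rewrite invr_gt0.
exists C => // s s0; rewrite normrM ger0_norm ?expR_ge0//.
have := ler_wpM2l (expR_ge0 (- s)) (HC _ s0); move/le_trans; apply.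
rewrite mulrCA -expRD; apply: ler_wpM2l => //.
by rewrite ler_expR; lra.
Qed.

Lemma integrable_laguerre_type (p : {poly R}) (a : R) (c : T -> R) : 0 < a ->
  measurable_fun setT c -> (forall t, `|c t| <= 1) ->
  m.-integrable setT (EFin \o fun t => expR (- (a * q t)) * p.[a * q t] * c t).
Proof.
move=> a0 mc c1; have [C C0 HC] := laguerre_type_le p.
have [ia _] := Hxi (divr_gt0 a0 (ltr0Sn R 1)).
apply: (@le_integrableT _ _ _ _ _ _ _ _ (integrableT_scale C ia)).
  by apply: measurable_funM => //; exact: measurable_laguerre_type.
move=> t; rewrite normrM;
  apply: (@le_trans _ _ `|expR (- (a * q t)) * p.[a * q t]|).
  by rewrite ler_piMr.
have := HC (a * q t); rewrite mulr_ge0 ?q_ge0 ?(ltW a0)// => /(_ isT).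
by rewrite mulrAC.
Qed.

Local Notation h := (n%:R / 2 : R).

Let is_derive_sqrt_pow (a : R) : 0 < a ->
  is_derive a 1 (fun a => Num.sqrt (pi / a) ^+ n)
    (- (h / a) * Num.sqrt (pi / a) ^+ n).
Proof.
move=> a0; have pa : 0 < pi / a by rewrite divr_gt0// pi_gt0.
have dinv : is_derive a 1 (fun y : R => pi / y) (- (pi / a / a)).
  have di := @is_deriveV _ id a 1 1 (lt0r_neq0 a0) (is_derive_id _ _).
  apply: is_derive_eq; rewrite /GRing.scale/=.
  by field; rewrite gt_eqF.
have ds : is_derive a 1 (fun y => Num.sqrt (pi / y))
  ((2 * Num.sqrt (pi / a))^-1 * (- (pi / a / a))).
  apply: (@is_derive1_comp _ Num.sqrt (fun y : R => pi / y)).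
  exact: is_derive1_sqrt.
have := @is_deriveX _ _ _ n a 1 _ ds.
rewrite exprfctE /GRing.scale/= => H.
apply: is_derive_eq.
set S := Num.sqrt (pi / a).
have S0 : 0 < S by rewrite sqrtr_gt0.
have SS : pi / a = S ^+ 2 by rewrite sqr_sqrtr// ltW.
rewrite SS; case: (n) => [|k]; first by rewrite !mul0r oppr0 mul0r.
by rewrite /= (exprS S k); field; rewrite !gt_eqF.
Qed.

Lemma laguerre_expS N (s : R) : 0 < h ->
  (h + N%:R) * laguerre_exp h N.+1 s =
  (h + N%:R) * laguerre_exp h N s
  + s * (expR (- s) * ((laguerre h N)^`() - laguerre h N).[s]).
Proof.
move=> h0; have hN : h + N%:R != 0 by rewrite gt_eqF// ltr_wpDr.
rewrite /laguerre_exp /= !hornerD hornerZ hornerM hornerX hornerD.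
by move: (h + N%:R) hN => c c0; field.
Qed.

(** Induction on N by differentiating the identity in the scale a.  On the
    left this multiplies the integrand by what [laguerre_expS] adds to pass
    from degree N to N + 1; on the right, with z = r / (4a), the derivative of
    a^(-n/2) z^N e^(-z) has one term in z^(N+1) and one proportional to the
    function itself, and the two proportional parts match. *)
Lemma laguerre_fourier N (a : R) (x : 'I_n -> R) : 0 < h -> 0 < a ->
  (\prod_(i < N) (h + i%:R)) *
    \int[m]_t (laguerre_exp h N (a * q t) * cos (\sum_i xi i t * x i)) =
  Num.sqrt (pi / a) ^+ n * ((\sum_i x i ^+ 2) / (4 * a)) ^+ N
    * expR (- ((\sum_i x i ^+ 2) / (4 * a))).
Proof.
move=> h0; elim: N a => [|N IH] a a0.
  rewrite big_ord0 mul1r expr0 mulr1; have [_ /(_ x 0)] := Hxi a0.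
  rewrite cos0 mulr1 => <-; apply: eq_Rintegral => t _.
  by rewrite /laguerre_exp /= hornerC mulr1 addr0.
set r := \sum_i x i ^+ 2 in IH *.
pose p := (laguerre h N)^`() - laguerre h N.
pose I b := \int[m]_t (laguerre_exp h N (b * q t) * cos (\sum_i xi i t * x i)).
pose J := \int[m]_t
  (expR (- (a * q t)) * ('X * p).[a * q t] * cos (\sum_i xi i t * x i)).
have cos1 t : `|cos (\sum_i xi i t * x i)| <= 1
  by rewrite ler_norml cos_geN1 cos_le1.
have mc := measurable_cos_dot x.
have [C C0 HC] := laguerre_type_le ('X * p).
have [iC _] := Hxi (divr_gt0 a0 (ltr0Sn R 3)).
have dI : is_derive a 1 I (a^-1 * J).
  rewrite -RintegralZl//; last exact: integrable_laguerre_type.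
  apply: (@is_derive_Rintegral _ _ _ m _ (fun b t =>
    b^-1 * (expR (- (b * q t)) * ('X * p).[b * q t] *
    cos (\sum_i xi i t * x i)))
    (fun t => 2 / a * (C * expR (- (a / 4 * q t)))) a (a / 2) (2 * a)).
  - by apply/andP; split; lra.
  - by move=> b /andP[ab _]; apply: integrable_laguerre_type => //; lra.
  - move=> b t /andP[ab _]; have b0 : b != 0 by rewrite gt_eqF//; lra.
    have dg : is_derive b 1 (fun b => laguerre_exp h N (b * q t))
      (expR (- (b * q t)) * p.[b * q t] * q t).
      have dl : is_derive b 1 (fun b : R => b * q t) (q t).
        by apply: is_derive_eq; rewrite /GRing.scale/=; ring.
      have de : is_derive b 1 (fun b : R => expR (- (b * q t)))
        (expR (- (b * q t)) * - q t).
        exact: (@is_derive1_comp _ expR (fun b : R => - (b * q t))).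
      have dp : is_derive b 1 (fun b : R => (laguerre h N).[b * q t])
        ((laguerre h N)^`().[b * q t] * q t).
        exact: (@is_derive1_comp _ (horner _) (fun b : R => b * q t)).
      rewrite /laguerre_exp; apply: is_derive_eq;
        rewrite /GRing.scale/= /p hornerD hornerN.
      by ring.
    apply: is_derive_eq; rewrite /GRing.scale/= hornerM hornerX.
    by field.
  - move=> b t /andP[ab _]; have b0 : 0 < b by lra.
    rewrite normrM gtr0_norm ?invr_gt0//; apply: ler_pM => //.
    + by rewrite invr_ge0 ltW.
    + rewrite -[2 / a]invf_div lef_pV2 ?posrE ?divr_gt0//; exact: ltW.
    rewrite normrM; apply: (@le_trans _ _ `|expR (- (b * q t)) *
      ('X * p).[b * q t]|).
      by rewrite ler_piMr.
    have bq0 : 0 <= b * q t by rewrite mulr_ge0 ?q_ge0// ltW.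
    apply: le_trans (HC _ bq0) _; apply: ler_wpM2l => //.
    rewrite ler_expR lerN2; have := ler_wpM2r (q_ge0 t) (ltW ab); lra.
  - exact: integrableT_scale (integrableT_scale _ iC).
have dRHS : is_derive a 1 (fun a =>
  Num.sqrt (pi / a) ^+ n * (r / (4 * a)) ^+ N * expR (- (r / (4 * a))))
  (a^-1 * (Num.sqrt (pi / a) ^+ n * (r / (4 * a)) ^+ N.+1 *
    expR (- (r / (4 * a)))
    - (h + N%:R) * (Num.sqrt (pi / a) ^+ n * (r / (4 * a)) ^+ N *
        expR (- (r / (4 * a)))))).
  have dS := is_derive_sqrt_pow a0.
  have dt : is_derive a 1 (fun a : R => r / (4 * a)) (- (r / (4 * a) / a)).
    have di := @is_deriveV _ id a 1 1 (lt0r_neq0 a0) (is_derive_id _ _).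
    rewrite (_ : (fun a => _) = (fun a : R => r / 4 * a^-1)); last first.
      by apply/funext => b; rewrite invfM mulrA.
    apply: is_derive_eq; rewrite /GRing.scale/=.
    by field; rewrite gt_eqF.
  have dtN : is_derive a 1 (fun a : R => (r / (4 * a)) ^+ N)
    (- (N%:R / a) * (r / (4 * a)) ^+ N).
    have := @is_deriveX _ _ _ N a 1 _ dt.
    rewrite exprfctE => H; apply: is_derive_eq; rewrite /GRing.scale/=.
    case: (N) => [|k]; first by rewrite !mul0r oppr0 mul0r.
    by rewrite /= (exprS (r / (4 * a)) k); ring.
  have de : is_derive a 1 (fun a : R => expR (- (r / (4 * a))))
    (expR (- (r / (4 * a))) * (r / (4 * a) / a)).
    rewrite -[r / (4 * a) / a]opprK.
    exact: (@is_derive1_comp _ expR (fun a : R => - (r / (4 * a)))).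
  apply: is_derive_eq; rewrite /GRing.scale/= (exprS (r / (4 * a)) N).
  by field; rewrite gt_eqF.
have : (\prod_(i < N) (h + i%:R)) * (a^-1 * J) =
  a^-1 * (Num.sqrt (pi / a) ^+ n * (r / (4 * a)) ^+ N.+1 *
    expR (- (r / (4 * a)))
    - (h + N%:R) * (Num.sqrt (pi / a) ^+ n * (r / (4 * a)) ^+ N *
        expR (- (r / (4 * a))))).
  have d1 : is_derive a 1 (fun b => (\prod_(i < N) (h + i%:R)) * I b)
    ((\prod_(i < N) (h + i%:R)) * (a^-1 * J)).
    by apply: is_derive_eq; rewrite /GRing.scale/=; ring.
  rewrite -[LHS](@derive_val _ _ _ _ _ _ _ d1)
    -[RHS](@derive_val _ _ _ _ _ _ _ dRHS).
  (* The identity of degree N holds for all scales near a. *)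
  apply: near_eq_derive.
  by near=> b; apply: IH; near: b; exact: lt_nbhsr.
rewrite mulrCA => /(mulfI (invr_neq0 (lt0r_neq0 a0))) JE.
rewrite big_ord_recr/= -mulrA.
have -> : (h + N%:R) * \int[m]_t
  (laguerre_exp h N.+1 (a * q t) * cos (\sum_i xi i t * x i))
   = (h + N%:R) * I a + J.
  have i1 : m.-integrable setT (EFin \o fun t =>
    laguerre_exp h N (a * q t) * cos (\sum_i xi i t * x i)).
    exact: integrable_laguerre_type.
  have i2 : m.-integrable setT (EFin \o fun t =>
    laguerre_exp h N.+1 (a * q t) * cos (\sum_i xi i t * x i)).
    exact: integrable_laguerre_type.
  have i3 : m.-integrable setT (EFin \o fun t =>
    expR (- (a * q t)) * ('X * p).[a * q t] * cos (\sum_i xi i t * x i)).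
    exact: integrable_laguerre_type.
  rewrite -(RintegralZl _ measurableT i2) -(RintegralZl _ measurableT i1).
  rewrite -(RintegralD measurableT (integrableT_scale (h + N%:R) i1) i3).
  apply: eq_Rintegral => t _;
    rewrite mulrA (laguerre_expS _ _ h0) hornerM hornerX -/p.
  by ring.
by rewrite mulrDr JE mulrCA (IH a a0); ring.
Unshelve. all: by end_near. Qed.

End laguerre_features.

(** * Geometric sums of integrals and Schur's test *)

(** A pointwise choice among countably many majorants costs no more than their
    sum. *)
Lemma integral_le_geometric (d : measure_display) (T : measurableType d)
    (R : realType) (m : {measure set T -> \bar R}) (g : T -> R)
    (f : nat -> T -> R) (A r : R) :
  measurable_fun setT g -> (forall x, 0 <= g x) ->
  (forall k, measurable_fun setT (f k)) -> (forall k x, 0 <= f k x) ->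
  (forall x, exists k, g x <= f k x) -> 0 <= r < 1 -> 0 <= A ->
  (forall k, (\int[m]_x (f k x)%:E <= (A * r ^+ k)%:E)%E) ->
  (\int[m]_x (g x)%:E <= (A / (1 - r))%:E)%E.
Proof.
move=> mg g0 mf f0 gf /andP[r0 r1] A0 fA.
have r10 : 0 < 1 - r by rewrite subr_gt0.
apply: (@le_trans _ _ (\int[m]_x (\sum_(0 <= k <oo) (f k x)%:E))%E).
  apply: ge0_le_integral => //.
  - by move=> x _; rewrite lee_fin.
  - exact/measurable_EFinP.
  - apply: ge0_emeasurable_sum => // k; first by move=> x _ _; rewrite lee_fin.
    by move=> _; exact/measurable_EFinP.
  move=> x _; have [k gk] := gf x.
  apply: (@le_trans _ _ (f k x)%:E); first by rewrite lee_fin.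
  apply: le_trans (@nneseries_lim_ge _ _ xpredT 0%N k.+1 _); last first.
    by move=> i _; rewrite lee_fin.
  rewrite big_nat_recr//= leeDr// sume_ge0// => i _; by rewrite lee_fin.
rewrite integral_nneseries//; last 2 first.
- by move=> k; exact/measurable_EFinP.
- by move=> k x _; rewrite lee_fin.
apply: (@le_trans _ _ (\sum_(0 <= k <oo) (A * r ^+ k)%:E)%E).
  apply: lee_nneseries => [k _ _|k _].
    by apply: integral_ge0 => x _; rewrite lee_fin.
  exact: fA k.
apply: lime_le.
  by apply: is_cvg_nneseries => k _ _; rewrite lee_fin mulr_ge0// exprn_ge0.
apply: nearW => n; rewrite sumEFin lee_fin -mulr_sumr ler_wpM2l//.
rewrite big_mkord -[_^-1]mul1r ler_pdivlMr//.
have -> : (\sum_(i < n) r ^+ i) * (1 - r) = 1 - r ^+ n.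
  by rewrite mulrC -[1 - r]opprB mulNr -subrX1 opprB.
by rewrite lerBlDr lerDl exprn_ge0.
Qed.

Section schur.
Context (d : measure_display) (X : measurableType d) (R : realType).
Variables (mu : {finite_measure set X -> \bar R}).

Lemma bounded_integrable (f : X -> R) (B : R) : measurable_fun setT f ->
  (forall x, `|f x| <= B) -> mu.-integrable setT (EFin \o f).
Proof.
move=> mf fB; apply: (@le_integrableT _ _ _ _ _ (fun=> B) mf fB).
exact: finite_measure_integrable_cst.
Qed.

Variables (k : X * X -> R) (B L : R) (f : X -> R) (b : R).
Hypothesis mk : measurable_fun setT k.
Hypothesis k0 : forall z, 0 <= k z.
Hypothesis kB : forall z, k z <= B.
Hypothesis ksym : forall x y, k (x, y) = k (y, x).
Hypothesis kL : forall x, \int[mu]_y k (x, y) <= L.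
Hypothesis mf : measurable_fun setT f.
Hypothesis fb : forall x, `|f x| <= b.

Lemma schur_test :
  \int[mu]_x \int[mu]_y (k (x, y) * (f x * f y)) <= L * \int[mu]_x (f x ^+ 2).
Proof.
pose g (z : X * X) := k z * (f z.1 ^+ 2 / 2 + f z.2 ^+ 2 / 2).
pose g1 (z : X * X) := k z * (f z.1 ^+ 2 / 2).
pose g2 (z : X * X) := k z * (f z.2 ^+ 2 / 2).
pose p (z : X * X) := k z * (f z.1 * f z.2).
have f1 : measurable_fun setT (fun z : X * X => f z.1).
  exact: (measurableT_comp mf measurable_fst).
have f2 : measurable_fun setT (fun z : X * X => f z.2).
  exact: (measurableT_comp mf measurable_snd).
have mg1 : measurable_fun setT g1.
  apply: measurable_funM => //; apply: measurable_funM;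
    last exact: measurable_cst.
  exact: measurable_funX.
have mg2 : measurable_fun setT g2.
  apply: measurable_funM => //; apply: measurable_funM;
    last exact: measurable_cst.
  exact: measurable_funX.
have mp : measurable_fun setT p by do 2 apply: measurable_funM => //.
have f2b x : f x ^+ 2 / 2 <= b ^+ 2.
  have : f x ^+ 2 <= b ^+ 2.
    rewrite -[f x ^+ 2]ger0_norm ?sqr_ge0// normrX.
    apply: lerXn2r; rewrite // nnegrE//.
    exact: le_trans (normr_ge0 _) (fb x).
  by have := sqr_ge0 b; lra.
have f20 x : 0 <= f x ^+ 2 / 2 by rewrite divr_ge0// sqr_ge0.
have kk z : `|k z| <= B by rewrite ger0_norm.
have g1b x y : `|g1 (x, y)| <= B * b ^+ 2 * 1.
  by rewrite mulr1 /g1 normrM; apply: ler_pM => //; rewrite ger0_norm.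
have g2b x y : `|g2 (x, y)| <= B * b ^+ 2 * 1.
  by rewrite mulr1 /g2 normrM; apply: ler_pM => //; rewrite ger0_norm.
have pb x y : `|p (x, y)| <= B * b ^+ 2 * 1.
  rewrite mulr1 /p normrM; apply: ler_pM => //; rewrite normrM expr2.
  by apply: ler_pM.
have iB (c : R) : mu.-integrable setT (EFin \o (fun=> c : R)).
  exact: finite_measure_integrable_cst.
have i2 : mu.-integrable setT (EFin \o fun x => f x ^+ 2 / 2).
  apply: (@bounded_integrable _ (b ^+ 2)).
    by apply: measurable_funM; [exact: measurable_funX|exact: measurable_cst].
  by move=> x; rewrite ger0_norm.
have I1 : \int[mu]_x \int[mu]_y g1 (x, y) <= L * \int[mu]_x (f x ^+ 2 / 2).
  rewrite -RintegralZl//; apply: le_Rintegral => //.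
  - exact: (dominated_integrable1 mg1 g1b (iB _) (iB _)).
  - exact: integrableT_scale.
  move=> x _; rewrite /g1/=.
  rewrite RintegralZr//; first by apply: ler_wpM2r.
  apply: (@bounded_integrable _ B) => //.
  exact: (measurableT_comp mk (pair1_measurable x)).
have I2 : \int[mu]_x \int[mu]_y g2 (x, y) = \int[mu]_x \int[mu]_y g1 (x, y).
  rewrite (Rintegral_swap mg2 g2b (iB _) (iB _)).
  apply: eq_Rintegral => y _; apply: eq_Rintegral => x _.
  by rewrite /g1 /g2/= ksym.
have -> : L * \int[mu]_x (f x ^+ 2) =
    L * \int[mu]_x (f x ^+ 2 / 2) + L * \int[mu]_x (f x ^+ 2 / 2).
  rewrite -mulrDr -RintegralD//; congr (_ * _); apply: eq_Rintegral => x _.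
  by field.
apply: le_trans (lerD I1 I1); rewrite -[X in _ <= _ + X]I2.
rewrite -(Rintegral_prod mg1 g1b (iB _) (iB _)) -(Rintegral_prod mg2 g2b
  (iB _) (iB _)).
rewrite -(Rintegral_prod mp pb (iB _) (iB _)).
have ig1 := dominated_integrable_prod mg1 g1b (iB _) (iB _).
have ig2 := dominated_integrable_prod mg2 g2b (iB _) (iB _).
have ip := dominated_integrable_prod mp pb (iB _) (iB _).
rewrite -RintegralD//; apply: le_Rintegral => //.
  rewrite (_ : EFin \o _ = (EFin \o g1) \+ (EFin \o g2));
    first exact: integrableD.
  by apply/funext.
move=> z _; rewrite /p /g1 /g2 -mulrDr; apply: ler_wpM2l => //.
by have := sqr_ge0 (f z.1 - f z.2); rewrite sqrrB; lra.
Qed.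

End schur.

(** * The spectral identity *)

(** Here u stands for cosine or sine: the cosine of a difference of phases
    splits into one product of each kind, and both are treated alike. *)
Section phase_component.
Context (dX dT : measure_display) (X : measurableType dX)
  (T : measurableType dT) (R : realType).
Variables (mu : {finite_measure set X -> \bar R}).
Variables (m : {sigma_finite_measure set T -> \bar R}).
Variables (p : X * T -> R) (f : X -> R) (b : R).
Hypothesis mp : measurable_fun setT p.
Hypothesis mf : measurable_fun setT f.
Hypothesis fb : forall x, `|f x| <= b.

(** The squared modulus of the Fourier transform of f mu, with p (x, t) as the
    phase at the point x and frequency t. *)
Definition power_spectrum (t : T) : R :=
  (\int[mu]_x (f x * cos (p (x, t)))) ^+ 2
  + (\int[mu]_x (f x * sin (p (x, t)))) ^+ 2.

Lemma power_spectrum_ge0 t : 0 <= power_spectrum t.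
Proof. by rewrite addr_ge0// sqr_ge0. Qed.

Variable (M : T -> R).
Hypothesis iM : m.-integrable setT (EFin \o M).

Let mM : measurable_fun setT M.
Proof. by case/integrableP: iM => /measurable_EFinP. Qed.

Let inM : m.-integrable setT (EFin \o (fun t => `|M t|)).
Proof.
apply: (@le_integrable _ _ _ _ _ _ _ (EFin \o M)) => //.
  by apply/measurable_EFinP; exact: measurableT_comp.
by move=> t _ /=; rewrite normr_id.
Qed.

Let mcos : measurable_fun setT (@cos R).
Proof. by apply: continuous_measurable_fun; exact: continuous_cos. Qed.
Let msin : measurable_fun setT (@sin R).
Proof. by apply: continuous_measurable_fun; exact: continuous_sin. Qed.

Let swapXT : measurable_fun setT (fun z : T * X => (z.2, z.1)).
Proof. exact: measurable_swap. Qed.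

Let ic (c : R) : mu.-integrable setT (EFin \o (fun=> c)).
Proof. exact: finite_measure_integrable_cst. Qed.

Variable (u : R -> R).
Hypothesis mu_ : measurable_fun setT u.
Hypothesis u1 : forall y, `|u y| <= 1.

Let integrable_fu t : mu.-integrable setT (EFin \o fun x => f x * u (p (x, t))).
Proof.
apply: (@bounded_integrable _ _ _ _ _ b).
  apply: measurable_funM => //; apply: (measurableT_comp mu_).
  exact: (measurableT_comp mp (pair2_measurable t)).
move=> x; rewrite normrM -[b]mulr1; exact: ler_pM.
Qed.

Let a t := \int[mu]_x (f x * u (p (x, t))).
Let F (z : T * X) := f z.2 * u (p (z.2, z.1)).

Let mF : measurable_fun setT F.
Proof.
apply: measurable_funM; first exact: (measurableT_comp mf measurable_snd).
by apply: (measurableT_comp mu_); exact: (measurableT_comp mp swapXT).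
Qed.

Let ma : measurable_fun setT a.
Proof.
apply: (@measurableT_comp _ _ _ _ _ _ fine) => //=.
pose Fp := (EFin \o F)^\+%E; pose Fn := (EFin \o F)^\-%E.
rewrite (_ : (fun t => _) =
  (fun t => \int[mu]_x Fp (t, x) - \int[mu]_x Fn (t, x))%E).
  apply: emeasurable_funB.
    apply: (@measurable_fun_fubini_tonelli_F _ _ _ _ R mu Fp).
    - by apply: measurable_funepos; exact/measurable_EFinP.
    - by move=> z; exact: funepos_ge0.
  apply: (@measurable_fun_fubini_tonelli_F _ _ _ _ R mu Fn).
  - by apply: measurable_funeneg; exact/measurable_EFinP.
  - by move=> z; exact: funeneg_ge0.
apply/funext => t; rewrite integralE; congr (_ - _)%E;
  apply: eq_integral => x _.
  by rewrite /Fp !funeposE.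
by rewrite /Fn !funenegE.
Qed.

Let c0 := b * fine (mu setT).

Let a_le t : `|a t| <= c0.
Proof.
apply: le_trans (le_normr_Rintegral measurableT (integrable_fu t)) _.
apply: (@le_trans _ _ (\int[mu]_x b)).
  apply: le_Rintegral => //.
  - apply: (@le_integrable _ _ _ _ _ _ _ (EFin \o fun x =>
      f x * u (p (x, t)))) => //.
    + apply/measurable_EFinP; apply: measurableT_comp => //.
      by have /integrableP[/measurable_EFinP] := integrable_fu t.
    + by move=> x _ /=; rewrite normr_id.
  - by move=> x _; rewrite normrM -[X in _ <= X]mulr1; exact: ler_pM.
by rewrite Rintegral_cst.
Qed.

Let F1 x (z : X * T) := f z.1 * (M z.2 * (u (p (x, z.2)) * u (p (z.1, z.2)))).
Let mF1 x : measurable_fun setT (F1 x).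
Proof.
apply: measurable_funM; first exact: (measurableT_comp mf measurable_fst).
apply: measurable_funM; first exact: (measurableT_comp mM measurable_snd).
apply: measurable_funM; apply: (measurableT_comp mu_).
  exact: (measurableT_comp (measurableT_comp mp (pair1_measurable x))
    measurable_snd).
by apply: eq_measurable_fun mp => -[].
Qed.

Let F1_le x y t : `|F1 x (y, t)| <= b * `|M t|.
Proof.
rewrite /F1/= !normrM; apply: ler_pM => //.
by rewrite ler_piMr// mulr_ile1.
Qed.

Let Kt x y := \int[m]_t (M t * (u (p (x, t)) * u (p (y, t)))).

Let Kt_int x y : m.-integrable setT (EFin \o fun t =>
  M t * (u (p (x, t)) * u (p (y, t)))).
Proof.
apply: (@le_integrableT _ _ _ _ _ (fun t => `|M t|)) => //.
  apply: measurable_funM => //; apply: measurable_funM.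
    by apply: (measurableT_comp mu_);
      exact: (measurableT_comp mp (pair1_measurable x)).
  by apply: (measurableT_comp mu_);
    exact: (measurableT_comp mp (pair1_measurable y)).
by move=> t; rewrite !normrM ler_piMr// mulr_ile1.
Qed.

Let fKt_int x : mu.-integrable setT (EFin \o fun y => f y * Kt x y).
Proof.
have := dominated_integrable1 (mF1 x) (F1_le x) (ic b) inM.
apply: eq_integrable => // y _ /=; congr EFin.
by rewrite /F1/= RintegralZl//; exact: Kt_int.
Qed.

Let innerE x : \int[mu]_y (f y * Kt x y) =
  \int[m]_t (M t * (u (p (x, t)) * a t)).
Proof.
transitivity (\int[mu]_y \int[m]_t F1 x (y, t)).
  by apply: eq_Rintegral => y _; rewrite /F1/= RintegralZl//; exact: Kt_int.
rewrite (Rintegral_swap (mF1 x) (F1_le x) (ic b) inM).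
apply: eq_Rintegral => t _; rewrite /F1/= /a mulrA -RintegralZl//.
  by apply: eq_Rintegral => y _; ring.
Qed.

Let F2 (z : X * T) := f z.1 * (M z.2 * (u (p z) * a z.2)).
Let mF2 : measurable_fun setT F2.
Proof.
apply: measurable_funM; first exact: (measurableT_comp mf measurable_fst).
apply: measurable_funM; first exact: (measurableT_comp mM measurable_snd).
apply: measurable_funM; first by apply: (measurableT_comp mu_).
exact: (measurableT_comp ma measurable_snd).
Qed.

Let F2_le x t : `|F2 (x, t)| <= (b * c0) * `|M t|.
Proof.
rewrite /F2/= !normrM -mulrA; apply: ler_pM => //.
rewrite mulrC; apply: ler_wpM2r => //.
by rewrite -[c0]mul1r; exact: ler_pM.
Qed.

Let Ma_int x : m.-integrable setT (EFin \o fun t => M t * (u (p (x, t)) * a t)).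
Proof.
apply: (@le_integrableT _ _ _ _ _ (fun t => c0 * `|M t|)).
- apply: measurable_funM => //; apply: measurable_funM => //.
  by apply: (measurableT_comp mu_);
    exact: (measurableT_comp mp (pair1_measurable x)).
- move=> t; rewrite !normrM mulrC; apply: ler_wpM2r => //.
  by rewrite -[c0]mul1r; exact: ler_pM.
exact: integrableT_scale.
Qed.

Lemma double_integrable_component :
  mu.-integrable setT (EFin \o fun x => \int[mu]_y (f x * f y *
    \int[m]_t (M t * (u (p (x, t)) * u (p (y, t)))))).
Proof.
have := dominated_integrable1 mF2 F2_le (ic _) inM.
apply: eq_integrable => // x _ /=; congr EFin.
rewrite /F2/= (RintegralZl _ measurableT (Ma_int x)).
rewrite -innerE -(RintegralZl _ measurableT (fKt_int x)).
by apply: eq_Rintegral => y _; rewrite /Kt mulrA.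
Qed.

Lemma inner_integrable_component x :
  mu.-integrable setT (EFin \o fun y => f x * f y *
    \int[m]_t (M t * (u (p (x, t)) * u (p (y, t))))).
Proof.
have := integrableT_scale (f x) (fKt_int x).
by apply: eq_integrable => // y _ /=; rewrite mulrA.
Qed.

Lemma square_integrable_component :
  m.-integrable setT (EFin \o fun t =>
    M t * (\int[mu]_x (f x * u (p (x, t)))) ^+ 2).
Proof.
apply: (@le_integrableT _ _ _ _ _ (fun t => c0 ^+ 2 * `|M t|)).
- by apply: measurable_funM => //; exact: (measurable_funX _ ma).
- move=> t; rewrite normrM mulrC; apply: ler_wpM2r => //.
  rewrite normrX; apply: lerXn2r; rewrite // ?nnegrE//; last exact: a_le.
  exact: le_trans (normr_ge0 _) (a_le t).
exact: integrableT_scale.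
Qed.

Lemma double_integral_component :
  \int[mu]_x \int[mu]_y (f x * f y *
    \int[m]_t (M t * (u (p (x, t)) * u (p (y, t))))) =
  \int[m]_t (M t * (\int[mu]_x (f x * u (p (x, t)))) ^+ 2).
Proof.
transitivity (\int[mu]_x \int[m]_t F2 (x, t)).
  apply: eq_Rintegral => x _;
    rewrite /F2/= (RintegralZl _ measurableT (Ma_int x)).
  rewrite -innerE -(RintegralZl _ measurableT (fKt_int x)).
  by apply: eq_Rintegral => y _; rewrite /Kt mulrA.
rewrite (Rintegral_swap mF2 F2_le (ic _) inM).
apply: eq_Rintegral => t _; rewrite /F2/= -/(a t).
transitivity (\int[mu]_x (M t * a t * (f x * u (p (x, t))))).
  by apply: eq_Rintegral => x _; ring.
rewrite (RintegralZl _ measurableT (integrable_fu t)) -/(a t).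
by rewrite expr2 mulrA.
Qed.

End phase_component.

Section power_spectrum.
Context (dX dT : measure_display) (X : measurableType dX)
  (T : measurableType dT) (R : realType).
Variables (mu : {finite_measure set X -> \bar R}).
Variables (m : {sigma_finite_measure set T -> \bar R}).
Variables (p : X * T -> R) (f : X -> R) (b : R).
Hypothesis mp : measurable_fun setT p.
Hypothesis mf : measurable_fun setT f.
Hypothesis fb : forall x, `|f x| <= b.

Let mcos : measurable_fun setT (@cos R).
Proof. by apply: continuous_measurable_fun; exact: continuous_cos. Qed.
Let msin : measurable_fun setT (@sin R).
Proof. by apply: continuous_measurable_fun; exact: continuous_sin. Qed.
Let cos1 (y : R) : `|cos y| <= 1. Proof.
  by rewrite ler_norml cos_geN1 cos_le1. Qed.
Let sin1 (y : R) : `|sin y| <= 1. Proof.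
  by rewrite ler_norml sin_geN1 sin_le1. Qed.

Lemma integrable_power_spectrum (M : T -> R) :
  m.-integrable setT (EFin \o M) ->
  m.-integrable setT (EFin \o fun t => M t * power_spectrum mu p f t).
Proof.
move=> iM.
have ic := square_integrable_component mu mp mf fb iM mcos cos1.
have is_ := square_integrable_component mu mp mf fb iM msin sin1.
rewrite (_ : EFin \o _ =
  (EFin \o fun t => M t * (\int[mu]_x (f x * cos (p (x, t)))) ^+ 2)
   \+ (EFin \o fun t => M t * (\int[mu]_x (f x * sin (p (x, t)))) ^+ 2)).
  exact: integrableD.
by apply/funext => t /=; rewrite /power_spectrum mulrDr.
Qed.

(** A kernel that is a cosine transform with density M acts on f through the
    power spectrum of f mu.  As the spectrum is nonnegative, any majorant of
    |M| bounds the quadratic form. *)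
Lemma spectral_identity (M : T -> R) :
  m.-integrable setT (EFin \o M) ->
  \int[mu]_x \int[mu]_y (f x * f y *
    \int[m]_t (M t * cos (p (x, t) - p (y, t)))) =
  \int[m]_t (M t * power_spectrum mu p f t).
Proof.
move=> iM.
have iC := square_integrable_component mu mp mf fb iM mcos cos1.
have iS := square_integrable_component mu mp mf fb iM msin sin1.
transitivity (\int[m]_t (M t * (\int[mu]_x (f x * cos (p (x, t)))) ^+ 2 +
  M t * (\int[mu]_x (f x * sin (p (x, t)))) ^+ 2)); last first.
  by apply: eq_Rintegral => t _; rewrite /power_spectrum mulrDr.
rewrite (RintegralD measurableT iC iS).
rewrite -(double_integral_component mu mp mf fb iM mcos cos1).
rewrite -(double_integral_component mu mp mf fb iM msin sin1).
rewrite -RintegralD//; last 2 first.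
- exact: (double_integrable_component mu mp mf fb iM mcos cos1).
- exact: (double_integrable_component mu mp mf fb iM msin sin1).
apply: eq_Rintegral => x _; rewrite -RintegralD//; last 2 first.
- exact: (inner_integrable_component mu mp mf fb iM mcos cos1).
- exact: (inner_integrable_component mu mp mf fb iM msin sin1).
apply: eq_Rintegral => y _; rewrite -mulrDr; congr (_ * _).
have mx z : measurable_fun setT (fun t => p (z, t)).
  exact: (measurableT_comp mp (pair1_measurable z)).
have iP (u v : T -> R) : measurable_fun setT u -> measurable_fun setT v ->
    (forall t, `|u t| <= 1) -> (forall t, `|v t| <= 1) ->
    m.-integrable setT (EFin \o fun t => M t * (u t * v t)).
  move=> mu_ mv u1 v1;
    apply: (@integrableMl _ _ _ _ _ measurableT (EFin \o M)) => //.
    exact: measurable_funM.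
  exists 1; split; first exact: num_real.
  move=> y0 y01 t _; apply: le_trans (ltW y01).
  by rewrite normrM mulr_ile1.
rewrite -RintegralD//.
- by apply: eq_Rintegral => t _; rewrite cosB mulrDr.
- by apply: iP => //; exact: measurableT_comp.
- by apply: iP => //; exact: measurableT_comp.
Qed.

End power_spectrum.

(** * Euclidean balls and Gaussian averages of the measure *)
Lemma pow_bracket (R : realType) (B : nat) (u : R) : 1 < B%:R :> R -> 1 <= u ->
  exists k, B%:R ^+ k <= u < B%:R ^+ k.+1.
Proof.
rewrite ltr1n => B1 u1.
have ex : exists k, u < B%:R ^+ k.+1.
  exists (Num.bound u); apply: lt_le_trans (archi_boundP (le_trans ler01 u1)) _.
  set n := Num.bound u; rewrite -natrX ler_nat.
  by rewrite (leq_trans (ltnW (ltn_expl n B1)))// leq_exp2l.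
case: (ex_minnP ex) => k uk kmin; exists k; rewrite uk andbT.
case: k uk kmin => [|k] _ kmin; first by rewrite expr0.
by rewrite leNgt; apply/negP => /kmin; rewrite ltnn.
Qed.

Section euclidean.
Variables (R : realType) (d : nat).
Implicit Types x y : 'rV[R]_d.

Lemma enorm_ge0 x : 0 <= enorm x.
Proof. exact: sqrtr_ge0. Qed.

Lemma sqr_enorm x : enorm x ^+ 2 = \sum_(i < d) x ord0 i ^+ 2.
Proof. by rewrite /enorm sqr_sqrtr// sumr_ge0// => i _; exact: sqr_ge0. Qed.

Lemma enormB x y : enorm (x - y) = enorm (y - x).
Proof.
congr Num.sqrt; apply: eq_bigr => i _.
by rewrite -opprB mxE sqrrN.
Qed.

Lemma measurable_coord (i : 'I_d) :
  measurable_fun setT (fun x : borelRd R d => (x : 'rV[R]_d) ord0 i).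
Proof.
have co : continuous (fun x : 'rV[R]_d => x ord0 i) by exact: coord_continuous.
apply: (measurability _ (RGenOpens.measurableE R)) => _ [_ [a [b ->]] <-].
rewrite setTI; apply: sub_sigma_algebra.
by apply: open_comp; [move=> x _; exact: co|exact: interval_open].
Qed.

Let X := borelRd R d.

Definition dist2 (z : X * X) : R :=
  \sum_(i < d) ((z.1 : 'rV[R]_d) ord0 i - (z.2 : 'rV[R]_d) ord0 i) ^+ 2.

Lemma dist2E x y : dist2 (x, y) = enorm (y - x) ^+ 2.
Proof. by rewrite enormB sqr_enorm; apply: eq_bigr => i _; rewrite !mxE. Qed.

Lemma dist2_ge0 z : 0 <= dist2 z.
Proof. by apply: sumr_ge0 => i _; exact: sqr_ge0. Qed.

Lemma dist2C x y : dist2 (x, y) = dist2 (y, x).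
Proof. by rewrite !dist2E enormB. Qed.

Lemma measurable_dist2 : measurable_fun setT dist2.
Proof.
apply: measurable_sum => i; apply: measurable_funX; apply: measurable_funB.
  exact: (measurableT_comp (measurable_coord i) measurable_fst).
exact: (measurableT_comp (measurable_coord i) measurable_snd).
Qed.

Lemma measurable_gap :
  measurable_fun setT (fun z : X * X => enorm ((z.2 : 'rV[R]_d) - z.1)).
Proof.
have := measurableT_comp (continuous_measurable_fun (@sqrt_continuous R))
  measurable_dist2.
apply: eq_measurable_fun => -[x y] _ /=.
by rewrite dist2E sqrtr_sqr ger0_norm// enorm_ge0.
Qed.

Lemma measurable_eball x r : measurable (eball x r : set X).
Proof.
rewrite (_ : eball x r = (fun y => enorm (y - x)) @^-1` `]-oo, r[).
  have mg : measurable_fun setT (fun y : X => enorm ((y : 'rV[R]_d) - x)).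
    exact: (measurableT_comp measurable_gap (pair1_measurable (x : X))).
  by rewrite -[X in measurable X]setTI; exact: mg.
by apply/seteqP; split => y /=; rewrite /eball/= in_itv/=.
Qed.

Variables (mu : {finite_measure set X -> \bar R}) (s C0 : R).
Hypothesis s0 : 0 <= s.
Hypothesis sd : s <= d%:R.
Hypothesis C00 : 0 <= C0.
Hypothesis ball : forall x r, 0 < r -> (mu (eball x r) <= (C0 * r `^ s)%:E)%E.

(** The points at distance about 2^k / rho from x have mass at most
    C 2^(k s) rho^(-s), and there the Gaussian is below 2^(-k(d+1)), which
    wins because s <= d. *)
Lemma gauss_ball_integral : exists2 C : R, 0 <= C &
  forall (x : X) rho, 0 < rho ->
    \int[mu]_y expR (- (rho ^+ 2 * dist2 (x, y))) <= C * rho `^ (- s).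
Proof.
have [A A0 HA] := @horner_le_expR R ('X ^+ d.+1) 1 ltr01.
pose C := 1 + A * 2 ^+ (2 * d.+1).
have C1 : 0 <= C by rewrite addr_ge0// mulr_ge0// exprn_ge0.
exists (C * C0 * 2) => [|x rho rho0]; first by rewrite !mulr_ge0.
pose g (y : X) := expR (- (rho ^+ 2 * dist2 (x, y))).
(* f k takes care of the shell at distance about 2^k / rho. *)
pose f (k : nat) (y : X) := C * 2 ^- (k * d.+1) * \1_(eball x (2 ^+ k / rho)) y.
have mg : measurable_fun setT g.
  apply: measurableT_comp => //; apply: measurableT_comp => //.
  apply: measurable_funM; first exact: measurable_cst.
  exact: (measurableT_comp measurable_dist2 (pair1_measurable x)).
have mf k : measurable_fun setT (f k).
  apply: measurable_funM; first exact: measurable_cst.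
  by apply: measurable_indic; exact: measurable_eball.
have f0 k y : 0 <= f k y.
  rewrite /f indicE; apply: mulr_ge0; last exact: ler0n.
  by rewrite mulr_ge0.
have g0 y : 0 <= g y by exact: expR_ge0.
have gf y : exists k, g y <= f k y.
  pose u := rho * enorm ((y : 'rV[R]_d) - x).
  have u0 : 0 <= u by rewrite mulr_ge0 ?enorm_ge0 ?(ltW rho0).
  have gE : g y = expR (- u ^+ 2) by rewrite /g dist2E /u exprMn.
  have inE k : u < 2 ^+ k -> f k y = C * 2 ^- (k * d.+1).
    move=> uk; rewrite /f indicE mem_set ?mulr1//.
    by rewrite /eball/= ltr_pdivlMr// mulrC.
  have [u1|u1] := ltP u 1.
    exists 0%N; rewrite inE ?expr0//.
    rewrite invr1 mulr1 gE (@le_trans _ _ 1)//.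
      by rewrite -expR0 ler_expR oppr_le0 sqr_ge0.
    by rewrite lerDl mulr_ge0// exprn_ge0.
  have [k /andP[ku uk]] := pow_bracket (ltr1n R 2) u1.
  exists k.+1; rewrite inE// gE expRN.
  have := HA _ (sqr_ge0 u);
    rewrite mul1r hornerXn ger0_norm ?exprn_ge0 ?sqr_ge0// => HA'.
  have P0 : 0 < 2 ^+ (k.+1 * d.+1) :> R by rewrite exprn_gt0.
  rewrite ler_pdivlMr// mulrC ler_pdivrMr ?expR_gt0//.
  apply: (@le_trans _ _ (2 ^+ (2 * d.+1) * (u ^+ 2) ^+ d.+1)); last first.
    apply: (@le_trans _ _ (2 ^+ (2 * d.+1) * (A * expR (u ^+ 2)))).
      by apply: ler_wpM2l => //; rewrite exprn_ge0.
    rewrite mulrA; apply: ler_wpM2r; first exact: expR_ge0.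
    by rewrite mulrC /C lerDr.
  rewrite !(exprM 2) -exprMn; apply: lerXn2r.
  - by rewrite nnegrE exprn_ge0.
  - by rewrite nnegrE mulr_ge0 ?sqr_ge0.
  apply: (@le_trans _ _ (2 ^+ 2 * (2 ^+ k) ^+ 2)).
    rewrite -exprM -exprD; apply: ler_weXn2l; first by rewrite ler1n.
    by rewrite muln2 -addnn addnA -add1n leq_add.
  apply: ler_wpM2l; first exact: sqr_ge0.
  by apply: lerXn2r; rewrite ?nnegrE ?exprn_ge0.
have intf k : (\int[mu]_y (f k y)%:E <=
  (C * C0 * rho `^ (- s) * 2^-1 ^+ k)%:E)%E.
  rewrite /f; under eq_integral do rewrite EFinM.
  have c0 : 0 <= C * 2 ^- (k * d.+1) by rewrite mulr_ge0.
  have mI : measurable_fun setT (fun y : X =>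
    (\1_(eball x (2 ^+ k / rho)) y)%:E : \bar R).
    by apply/measurable_EFinP; apply: measurable_indic; exact: measurable_eball.
  rewrite ge0_integralZl//.
  rewrite integral_indic ?setIT//; last exact: measurable_eball.
  have r0 : 0 < 2 ^+ k / rho by rewrite divr_gt0// exprn_gt0.
  apply: le_trans (lee_wpmul2l _ (ball x r0)) _; first by rewrite lee_fin.
  rewrite -EFinM lee_fin.
  have -> : (2 ^+ k / rho) `^ s = (2 ^+ k) `^ s * rho `^ (- s).
    rewrite powRM ?exprn_ge0 ?invr_ge0 ?(ltW rho0)//; congr (_ * _).
    by rewrite -powR_inv1 ?(ltW rho0)// -powRrM mulN1r.
  have P2 : (2 ^+ k) `^ s <= 2 ^+ (k * d).
    rewrite exprM -[(2 ^+ k) ^+ d]powR_mulrn ?exprn_ge0//.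
    by apply: ler_powR => //; rewrite exprn_ege1// ler1n.
  have Q0 : 0 <= rho `^ (- s) by exact: powR_ge0.
  have -> : C * C0 * rho `^ (- s) * 2^-1 ^+ k
    = C * 2 ^- (k * d.+1) * (C0 * (2 ^+ (k * d) * rho `^ (- s))).
    have -> : 2 ^- (k * d.+1) = 2^-1 ^+ k * 2 ^- (k * d) :> R.
      by rewrite mulnS exprD invfM exprVn.
    have K0 : 2 ^+ (k * d) != 0 :> R by rewrite expf_neq0.
    by field.
  apply: ler_wpM2l => //; apply: ler_wpM2l => //.
  exact: ler_wpM2r.
have half : 0 <= (2^-1 : R) < 1 by rewrite invr_ge0 ler0n invf_lt1// ltr1n.
have CC : 0 <= C * C0 * rho `^ (- s) by rewrite !mulr_ge0// powR_ge0.
have := integral_le_geometric mg g0 mf f0 gf half CC intf.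
have ig : mu.-integrable setT (EFin \o g).
  apply: (@bounded_integrable _ _ _ _ _ 1) => // y.
  by rewrite ger0_norm// -expR0 ler_expR oppr_le0 mulr_ge0 ?sqr_ge0 ?dist2_ge0.
rewrite -(fineK (integrable_fin_num measurableT ig)) lee_fin => H.
apply: le_trans H _; rewrite le_eqVlt; apply/orP; left; apply/eqP.
have -> : 1 - 2^-1 = 2^-1 :> R by field.
by rewrite invrK mulrAC.
Qed.

End euclidean.

(** * The smooth annulus kernel *)

(** The logarithm of u e^(1-u) is at least - (u - 1)^2 / u, and on the annulus
    |u - 1| is of order eps / t, hence of order 1 / n. *)
Lemma annulus_kernel_ge (R : realType) (n : nat) (t eps g u : R) :
  u = g ^+ 2 / t ^+ 2 ->
  0 < eps -> 2 * eps <= t -> n%:R * eps <= t -> t - eps <= g <= t + eps ->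
  expR (- 9) <= (u * expR (1 - u)) ^+ (n ^ 2).
Proof.
move=> uE' e0 et nt /andP[g1 g2].
have t0 : 0 < t by lra.
have g0 : 0 < g by lra.
have u0 : 0 < u by rewrite uE' divr_gt0 ?exprn_gt0.
(* Replacing log u by 1 - 1/u gives the exponent - N (u - 1)^2 / u. *)
have uE : expR (1 - u^-1) <= u.
  have := expR_ge1Dx (u^-1 - 1); rewrite addrC subrK => H.
  rewrite -[1 - u^-1]opprB expRN -[X in _ <= X]invrK lef_pV2 ?posrE
    ?expR_gt0 ?invr_gt0//.
apply: (@le_trans _ _ ((expR (1 - u^-1) * expR (1 - u)) ^+ (n ^ 2)));
  last first.
  apply: lerXn2r; rewrite ?nnegrE.
  - by rewrite mulr_ge0 ?expR_ge0.
  - by rewrite mulr_ge0 ?expR_ge0// ltW.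
  by apply: ler_wpM2r => //; exact: expR_ge0.
rewrite -expRD -expRM_natl ler_expR.
have -> : (n ^ 2)%:R * (1 - u^-1 + (1 - u)) =
    - ((n%:R * (g - t)) ^+ 2 * ((g + t) / (t * g)) ^+ 2).
  rewrite uE' natrX; field.
  by rewrite !gt_eqF.
rewrite lerN2 -exprMn.
have -> : n%:R * (g - t) * ((g + t) / (t * g)) =
  n%:R * (g - t) / t * ((g + t) / g).
  by field; rewrite !gt_eqF.
rewrite exprMn.
have h1 : (n%:R * (g - t) / t) ^+ 2 <= 1.
  rewrite -real_normK ?num_real// exprn_ile1//.
  rewrite !normrM [`|n%:R|]ger0_norm// [`|t^-1|]gtr0_norm ?invr_gt0//.
  rewrite ler_pdivrMr// mul1r; apply: le_trans nt; apply: ler_wpM2l => //.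
  by rewrite ler_norml; lra.
have h2 : ((g + t) / g) ^+ 2 <= 9.
  have -> : 9 = 3 ^+ 2 :> R by rewrite -natrX.
  apply: lerXn2r; rewrite ?nnegrE ?divr_ge0//; try lra.
  by rewrite ler_pdivrMr//; lra.
rewrite -[9]mul1r; apply: ler_pM => //; exact: sqr_ge0.
Qed.

(** The left-hand side is the factor by which [laguerre_fourier] has to be
    normalised to represent (u e^(1-u))^N.  By Stirling it is of order
    t^d / n, where n is about t / eps. *)
Lemma laguerre_coef_le (R : realType) (m n N : nat) (t eps h a : R) :
  h = m.+2%:R / 2 -> N = (n ^ 2)%N -> a = t ^+ 2 / (4 * N%:R) ->
  (0 < n)%N -> 0 < eps -> 0 < t -> t < n.+1%:R * eps ->
  expR N%:R * N%:R ^- N * (\prod_(i < N) (h + i%:R)) / Num.sqrt (pi / a) ^+ m.+2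
  <= 2 * expR 1 * h * eps * t ^+ m.+1.
Proof.
move=> hE NN aE n0 e0 t0 tn.
have n0R : 0 < n%:R :> R by rewrite ltr0n.
have NE : N%:R = n%:R ^+ 2 :> R by rewrite NN natrX.
have N0 : 0 < N%:R :> R by rewrite NE exprn_gt0.
have a0 : 0 < a by rewrite aE divr_gt0 ?exprn_gt0// mulr_gt0.
have h0 : 0 <= h by rewrite hE divr_ge0.
set P := \prod_(i < N) _.
have P0 : 0 <= P by apply: prodr_ge0 => i _; rewrite addr_ge0.
apply: (@le_trans _ _ (expR 1 * h * t ^+ m.+2 / n%:R)); last first.
  rewrite ler_pdivrMr// exprSr.
  have tt : t <= 2 * n%:R * eps.
    have : n.+1%:R * eps <= 2 * n%:R * eps.
      apply: ler_wpM2r; first exact: ltW.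
      by rewrite -natrM ler_nat mul2n -addnn -addn1 leq_add2l.
    by lra.
  have c0 : 0 <= expR 1 * h * t ^+ m.+1.
    by rewrite mulr_ge0 ?exprn_ge0 ?mulr_ge0 ?expR_ge0// ltW.
  have := ler_wpM2l c0 tt; lra.
have s0 : 0 < Num.sqrt (pi / a) ^+ m.+2.
  by rewrite exprn_gt0// sqrtr_gt0 divr_gt0// pi_gt0.
rewrite -(@ler_pXn2r _ 2) ?nnegrE//; last 2 first.
- apply: divr_ge0; last exact: ltW.
  by rewrite mulr_ge0// mulr_ge0 ?expR_ge0// invr_ge0 exprn_ge0.
- by rewrite divr_ge0// mulr_ge0 ?exprn_ge0 ?(ltW t0)// mulr_ge0 ?expR_ge0.
have -> : (expR N%:R * N%:R ^- N * P / Num.sqrt (pi / a) ^+ m.+2) ^+ 2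
   = expR 2 ^+ N * P ^+ 2 / (N%:R ^+ (2 * N) * (pi / a) ^+ m.+2).
  have eS : (Num.sqrt (pi / a) ^+ m.+2) ^+ 2 = (pi / a) ^+ m.+2.
    by rewrite exprAC sqr_sqrtr// divr_ge0 ?pi_ge0// ltW.
  have eN : (N%:R ^+ N) ^+ 2 = N%:R ^+ (2 * N) :> R by rewrite -exprM mulnC.
  have eE : expR N%:R ^+ 2 = expR 2 ^+ N :> R.
    by rewrite -!expRM_natl mulrC.
  rewrite -eS -eN -eE.
  have K1 : N%:R ^+ N != 0 :> R by rewrite expf_neq0// gt_eqF.
  have K2 : Num.sqrt (pi / a) ^+ m.+2 != 0 by rewrite gt_eqF.
  move: (N%:R ^+ N) (Num.sqrt (pi / a) ^+ m.+2) (expR N%:R) K1 K2 =>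
    c1 c2 c3 K1 K2.
  by field; rewrite K1 K2.
have -> : (expR 1 * h * t ^+ m.+2 / n%:R) ^+ 2 =
  expR 2 * h ^+ 2 * (t ^+ 2) ^+ m.+2 / N%:R.
  have -> : expR 2 = expR 1 ^+ 2 :> R by rewrite -expRM_natl mulr1.
  rewrite NE [(t ^+ 2) ^+ _]exprAC; move: (t ^+ m.+2) => c.
  by field; rewrite gt_eqF.
have st : expR 2 ^+ N * P ^+ 2 <= expR 2 * h ^+ 2 * N%:R ^+ (2 * N + m.+1).
  have : (0 < N)%N by rewrite NN expn_gt0 n0.
  by rewrite /P; case: (N) => // N' _; exact: pochhammer_stirling.
have pa : N%:R / t ^+ 2 <= pi / a.
  have -> : pi / a = (4 * pi) * (N%:R / t ^+ 2).
    by rewrite aE; field; rewrite !gt_eqF.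
  by rewrite ler_peMl ?divr_ge0 ?ltW// ?exprn_gt0//; have := pi_ge2 R; lra.
have pa0 : 0 < N%:R / t ^+ 2 by rewrite divr_gt0// exprn_gt0.
have pia0 := lt_le_trans pa0 pa.
apply: (@le_trans _ _ (expR 2 * h ^+ 2 * N%:R ^+ (2 * N + m.+1) /
  (N%:R ^+ (2 * N) * (N%:R / t ^+ 2) ^+ m.+2))).
  apply: ler_pM => //.
  - by rewrite mulr_ge0 ?sqr_ge0// exprn_ge0// expR_ge0.
  - by rewrite invr_ge0 mulr_ge0 ?exprn_ge0 ?(ltW pia0).
  have X0 : 0 < N%:R ^+ (2 * N) :> R by rewrite exprn_gt0.
  rewrite lef_pV2 ?posrE; last 2 first.
  - by apply: mulr_gt0 => //; rewrite exprn_gt0.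
  - by apply: mulr_gt0 => //; rewrite exprn_gt0.
  apply: ler_wpM2l; first exact: ltW.
  by apply: lerXn2r; rewrite ?nnegrE ?(ltW pa0) ?(ltW pia0).
rewrite le_eqVlt; apply/orP; left; apply/eqP.
have tt0 : t ^+ 2 != 0 by rewrite gt_eqF// exprn_gt0.
rewrite exprD [(N%:R / _) ^+ _]exprMn exprVn invfM invfM invrK
  [N%:R ^+ m.+2]exprS.
have K1 : N%:R ^+ (2 * N) != 0 :> R by rewrite expf_neq0// gt_eqF.
have K2 : N%:R ^+ m.+1 != 0 :> R by rewrite expf_neq0// gt_eqF.
by field; rewrite K1 K2 gt_eqF.
Qed.

(** For q between 16^k and 16^(k+1) the wave is evaluated beyond t 4^k, where
    its decay gives the factor 2^(-k(d-1)); the Gaussian of width 4^(k+1) is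
    bounded below at such q. *)
Lemma laguerre_wave_majorant (R : realType) (m : nat) (D : R) : 0 < D ->
  exists2 A : R, 0 <= A & forall (t q : R) (N : nat), 0 < t -> t <= D ->
    (m.+2 <= N)%N -> 0 <= q -> exists k : nat,
    t ^+ m.+1 * `|laguerre_wave (m.+2%:R / 2) N (t * Num.sqrt q)|
      <= A * 2 ^- (k * m.+1) * expR (- (q / 16 ^+ k)).
Proof.
move=> D0; pose C : R := 8 * expR 1 * (2 * m.+1%:R) ^+ m.+1.
have C0 : 0 <= C by rewrite mulr_ge0 ?mulr_ge0 ?expR_ge0 ?exprn_ge0.
pose B := D ^+ m.+1 + Num.sqrt (D ^+ m.+1 * C) * 2 ^+ m.+1.
have B0 : 0 <= B by rewrite addr_ge0 ?exprn_ge0 ?mulr_ge0 ?sqrtr_ge0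
  ?exprn_ge0// ltW.
exists (B * expR 1); first by rewrite mulr_ge0// expR_ge0.
move=> t q N t0 tD mN q0; have t0' := ltW t0; set w := `|_|.
have x0 : 0 <= t * Num.sqrt q by rewrite mulr_ge0 ?sqrtr_ge0// ltW.
have [w1 w2] := laguerre_wave_bound mN x0.
have tDm : t ^+ m.+1 <= D ^+ m.+1 by apply: lerXn2r; rewrite ?nnegrE// ltW.
suff [k [h1 h2]] : exists k : nat, t ^+ m.+1 * w <= B * 2 ^- (k * m.+1) /\
    q <= 16 ^+ k.
  exists k; apply: (le_trans h1).
  have -> : B * expR 1 * 2 ^- (k * m.+1) * expR (- (q / 16 ^+ k))
     = B * 2 ^- (k * m.+1) * (expR 1 * expR (- (q / 16 ^+ k))) by ring.
  rewrite ler_peMr ?mulr_ge0 ?invr_ge0 ?exprn_ge0//.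
  rewrite -expRD -[X in X <= _]expR0 ler_expR subr_ge0.
  by rewrite ler_pdivrMr ?exprn_gt0// mul1r.
have [q1|q1] := ltP q 1.
  exists 0%N; rewrite expr0 invr1 mulr1; split; last exact: ltW.
  apply: (@le_trans _ _ (D ^+ m.+1 * 1)).
    by apply: ler_pM => //; [rewrite exprn_ge0// ltW|exact: normr_ge0].
  by rewrite mulr1 lerDl mulr_ge0 ?sqrtr_ge0 ?exprn_ge0.
have B16 : (1 : R) < 16%:R by rewrite ltr1n.
have [k /andP[kq qk]] := pow_bracket B16 q1.
exists k.+1; split; last exact: ltW.
apply: (@le_trans _ _ (Num.sqrt (D ^+ m.+1 * C) * 2 ^+ m.+1 * 2 ^-
  (k.+1 * m.+1))); last first.
  apply: ler_wpM2r; first by rewrite invr_ge0 exprn_ge0.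
  by rewrite /B lerDr exprn_ge0// ltW.
have -> : Num.sqrt (D ^+ m.+1 * C) * 2 ^+ m.+1 * 2 ^- (k.+1 * m.+1) =
   Num.sqrt (D ^+ m.+1 * C) / 2 ^+ (k * m.+1).
  rewrite mulSn exprD invfM.
  by rewrite -mulrA mulVKf// expf_neq0.
rewrite ler_pdivlMr ?exprn_gt0//.
rewrite -(@ler_pXn2r _ 2) ?nnegrE ?sqrtr_ge0//; last first.
  by rewrite mulr_ge0 ?exprn_ge0// mulr_ge0 ?exprn_ge0 ?normr_ge0 ?(ltW t0).
rewrite sqr_sqrtr; last by rewrite mulr_ge0// exprn_ge0// ltW.
have sq : 4 ^+ k <= Num.sqrt q.
  have -> : 4 ^+ k = Num.sqrt (16%:R ^+ k) :> R.
    have -> : 16%:R = 4 ^+ 2 :> R by rewrite -natrX.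
    by rewrite exprAC sqrtr_sqr ger0_norm// exprn_ge0.
  exact: ler_wsqrtr.
have -> : (t ^+ m.+1 * w * 2 ^+ (k * m.+1)) ^+ 2 =
    t ^+ m.+1 * ((t * 4 ^+ k) ^+ m.+1 * w ^+ 2).
  have -> : 4 = 2 ^+ 2 :> R by rewrite -natrX.
  have e : (2 ^+ (k * m.+1)) ^+ 2 = ((2 ^+ 2) ^+ k) ^+ m.+1 :> R.
    by rewrite -!exprM mulnC mulnA.
  by rewrite [LHS]exprMn e [(t * _) ^+ m.+1]exprMn; ring.
apply: ler_pM => //.
- by rewrite exprn_ge0// ltW.
- by rewrite mulr_ge0 ?sqr_ge0// exprn_ge0// mulr_ge0 ?exprn_ge0// ltW.
apply: le_trans w2; rewrite /w real_normK ?num_real//.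
apply: ler_wpM2r; first exact: sqr_ge0.
apply: lerXn2r; rewrite ?nnegrE ?mulr_ge0 ?exprn_ge0 ?sqrtr_ge0//.
by rewrite ler_pM2l.
Qed.

(** * The quadratic form of the annulus at moderate distances *)
Lemma Rintegral2_le (d : measure_display) (X : measurableType d) (R : realType)
    (mu : {finite_measure set X -> \bar R}) (F G : X * X -> R) (B : R) :
  measurable_fun setT F -> measurable_fun setT G ->
  (forall z, `|F z| <= B) -> (forall z, `|G z| <= B) ->
    (forall z, F z <= G z) ->
  \int[mu]_x \int[mu]_y F (x, y) <= \int[mu]_x \int[mu]_y G (x, y).
Proof.
move=> mF mG FB GB FG.
have iB (c : R) : mu.-integrable setT (EFin \o (fun=> c : R)).
  exact: finite_measure_integrable_cst.
have FB' x y : `|F (x, y)| <= B * 1 by rewrite mulr1.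
have GB' x y : `|G (x, y)| <= B * 1 by rewrite mulr1.
rewrite -(Rintegral_prod mF FB' (iB _) (iB _))
  -(Rintegral_prod mG GB' (iB _) (iB _)).
apply: le_Rintegral => //.
  exact: (dominated_integrable_prod mF FB' (iB _) (iB _)).
exact: (dominated_integrable_prod mG GB' (iB _) (iB _)).
Qed.

Definition annulus_indic (R : realType) d (t eps : R)
  (z : borelRd R d * borelRd R d) : R :=
  (t - eps <= enorm ((z.2 : 'rV[R]_d) - z.1) <= t + eps)%R%:R.

Lemma measurable_annulus_indic (R : realType) d (t eps : R) :
  measurable_fun setT (@annulus_indic R d t eps).
Proof.
pose A := [set z : borelRd R d * borelRd R d | enorm ((z.2 : 'rV[R]_d) - z.1)
  \in `[t - eps, t + eps]].
have mA : measurable A.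
  have := @measurable_gap R d;
    move/(_ measurableT `[t - eps, t + eps]%classic (measurable_itv _)).
  by rewrite setTI.
rewrite (_ : annulus_indic _ _ = \1_A); first exact: measurable_indic.
apply/funext => z; rewrite indicE /annulus_indic; congr (_%:R).
have -> : (z \in A) = (enorm ((z.2 : 'rV[R]_d) - z.1) \in `[t - eps, t + eps]).
  by apply/idP/idP => [/set_mem//|H]; exact/mem_set.
by rewrite in_itv.
Qed.

Lemma powR_exprn (R : realType) (b s : R) k : 0 <= b ->
  (b ^+ k) `^ s = (b `^ s) ^+ k.
Proof.
by move=> b0; rewrite -powR_mulrn// powRAC powR_mulrn ?powR_ge0.
Qed.

Lemma expr_distr3 (R : realType) (x y z : R) i j k :
  (x ^- i * y ^+ j * z) ^+ k = x ^- (k * i) * (y ^+ k) ^+ j * z ^+ k.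
Proof. by rewrite !exprMn exprVn -!exprM [(k * i)%N]mulnC [(k * j)%N]mulnC. Qed.

Section annulus_form.
Variables (R : realType) (m : nat).
Let X := borelRd R m.+2.
Variables (mu : {finite_measure set X -> \bar R}) (s C0 : R).
Hypothesis s1 : (m.+2%:R + 1) / 2 < s.
Hypothesis sd : s <= m.+2%:R.
Hypothesis C00 : 0 <= C0.
Hypothesis ball : forall x r, 0 < r -> (mu (eball x r) <= (C0 * r `^ s)%:E)%E.

(* The ratio 2^(-(d-1)) 4^(d-s) = 2^(d+1-2s) of the final geometric series,
   for d = m.+2. *)
Let rate : R := 2 ^- m.+1 * 4 ^+ m.+2 * 4 `^ (- s).

Let rate01 : 0 <= rate < 1.
Proof.
apply/andP; split; first by rewrite mulr_ge0 ?powR_ge0.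
have four : 4 = 2 `^ 2 :> R by rewrite powR_mulrn// -natrX.
rewrite /rate {2}four -powRrM.
have -> : 2 ^- m.+1 * 4 ^+ m.+2 = 2 `^ (m.+3%:R) :> R.
  rewrite powR_mulrn//.
  have -> : 4 = 2 ^+ 2 :> R by rewrite -natrX.
  have p2 : 2 ^+ m.+1 != 0 :> R by rewrite expf_neq0.
  apply: (mulfI p2); rewrite mulrA mulfV// mul1r -exprM -exprD; congr (_ ^+ _).
  by rewrite mul2n -addnn !addSn !addnS.
rewrite -powRD; last by rewrite pnatr_eq0 implybT.
rewrite /powR gt_eqF// -[X in _ < X]expR0 ltr_expR nmulr_rlt0;
  first exact/ln_gt0/ltr1n.
move: s1; rewrite -[m.+3%:R]natr1; lra.
Qed.

Let gauss_mass_le : exists2 C : R, 0 <= C & forall (k : nat) (x : X),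
  Num.sqrt (pi / (16 ^+ k)^-1) ^+ m.+2 *
    \int[mu]_y expR (- (dist2 (x, y) / (4 * (16 ^+ k)^-1)))
  <= C * 2 ^+ (k * m.+1) * rate ^+ k.
Proof.
have s0 : 0 <= s by move: s1; have := ler0n R m.+2; lra.
have [Cg Cg0 HCg] := gauss_ball_integral sd C00 ball.
exists (Num.sqrt pi ^+ m.+2 * Cg * 2 `^ s).
  by rewrite mulr_ge0 ?powR_ge0// mulr_ge0// exprn_ge0// sqrtr_ge0.
move=> k x.
have p4 : 0 < 4 ^+ k :> R by rewrite exprn_gt0.
have E16 : 16 ^+ k = (4 ^+ k) ^+ 2 :> R.
  by rewrite exprAC; congr (_ ^+ _); rewrite -natrX.
have -> : Num.sqrt (pi / (16 ^+ k)^-1) = Num.sqrt pi * 4 ^+ k :> R.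
  by rewrite invrK E16 sqrtrM ?pi_ge0// sqrtr_sqr ger0_norm// ltW.
have r0 : 0 < 4 ^+ k / 2 :> R by rewrite divr_gt0.
have -> : \int[mu]_y expR (- (dist2 (x, y) / (4 * (16 ^+ k)^-1))) =
   \int[mu]_y expR (- ((4 ^+ k / 2) ^+ 2 * dist2 (x, y))).
  apply: eq_Rintegral => y _; congr (expR (- _)); rewrite E16.
  by field; rewrite gt_eqF.
apply: (@le_trans _ _ ((Num.sqrt pi * 4 ^+ k) ^+ m.+2 *
  (Cg * (4 ^+ k / 2) `^ (- s)))).
  apply: ler_wpM2l; last exact: HCg.
  by rewrite exprn_ge0// mulr_ge0 ?sqrtr_ge0// ltW.
have -> : (4 ^+ k / 2) `^ (- s) = (4 `^ (- s)) ^+ k * 2 `^ s :> R.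
  rewrite powRM ?(ltW p4)//; congr (_ * _).
    exact: powR_exprn.
  by rewrite -powR_inv1// -powRrM mulN1r opprK.
rewrite le_eqVlt; apply/orP; left; apply/eqP.
have -> : rate ^+ k = 2 ^- (k * m.+1) * (4 ^+ k) ^+ m.+2 * (4 `^ (- s)) ^+ k.
  exact: expr_distr3.
rewrite exprMn.
have p2 : 2 ^+ (k * m.+1) != 0 :> R by rewrite expf_neq0.
move: (2 ^+ (k * m.+1)) p2 => c c0;
  move: ((4 ^+ k) ^+ m.+2) ((4 `^ (- s)) ^+ k) => c1 c2.
by field.
Qed.

(** The core estimate.  The lower bound on t / eps makes N at least the
    dimension, so that the wave bounds apply; the upper bound D on t is needed
    because the Fourier transform of the smooth kernel grows with t. *)
Lemma annulus_form_le (D : R) : 0 < D -> exists2 C : R, 0 <= C &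
  forall (t eps b : R) (f : X -> R), 0 < eps -> m.+2%:R * eps <= t -> t <= D ->
    measurable_fun setT f -> (forall x, 0 <= f x) -> (forall x, f x <= b) ->
    \int[mu]_x \int[mu]_y (annulus_indic t eps (x, y) * (f x * f y))
    <= C * eps * \int[mu]_x (f x ^+ 2).
Proof.
move=> D0.
have [A A0 HA] := laguerre_wave_majorant m D0.
have [Cg Cg0 HCg] := gauss_mass_le.
have [dT [T [mT [xi [mxi Hxi]]]]] := gauss_features R m.+2.
pose h : R := m.+2%:R / 2.
have h0 : 0 < h by rewrite divr_gt0.
have /andP[rate0 rate1] := rate01.
have rate1' : 0 < 1 - rate by rewrite subr_gt0.
pose A1 := 2 * expR 1 * h * A.
have A10 : 0 <= A1 by rewrite !mulr_ge0 ?expR_ge0// ltW.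
exists (expR 9 * (A1 * Cg / (1 - rate))).
  by rewrite mulr_ge0 ?expR_ge0// mulr_ge0 ?invr_ge0 ?(ltW rate1')// mulr_ge0.
move=> t eps b f e0 et tD mf f0 fb.
have fb' x : `|f x| <= b by rewrite ger0_norm.
have mR : 2 <= m.+2%:R :> R by rewrite ler_nat.
have te : 2 * eps <= t.
  by apply: le_trans et; apply: ler_wpM2r => //; exact: ltW.
have t0 : 0 < t by lra.
(* With N = n^2 the kernel K has width of order t / n, hence of order eps. *)
pose n := Num.truncn (t / eps).
have /andP[nt tn] : n%:R <= t / eps < n.+1%:R.
  by apply: truncn_itv; rewrite divr_ge0 ?ltW.
rewrite ler_pdivlMr// in nt; rewrite ltr_pdivrMr// in tn.
have mn : (m.+2 <= n)%N.
  by rewrite -ltnS -(ltr_nat R) -(ltr_pM2r e0); exact: le_lt_trans et tn.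
have n0 : (0 < n)%N by rewrite (leq_trans _ mn).
pose N := (n ^ 2)%N.
have mN : (m.+2 <= N)%N by rewrite (leq_trans mn)// /N expnS expn1 leq_pmulr.
have N0 : 0 < N%:R :> R by rewrite ltr0n (leq_trans _ mN).
(* The scale at which r / (4a) equals N u, as K requires. *)
pose a := t ^+ 2 / (4 * N%:R).
have a0 : 0 < a by rewrite divr_gt0 ?mulr_gt0 ?exprn_gt0.
pose q (w : T) := \sum_i xi i w ^+ 2.
have q0 w : 0 <= q w by apply: sumr_ge0 => i _; exact: sqr_ge0.
pose p (z : X * T) := \sum_i xi i z.2 * (z.1 : 'rV[R]_m.+2) ord0 i.
have mp : measurable_fun setT p.
  apply: measurable_sum => i; apply: measurable_funM.
    exact: (measurableT_comp (mxi i) measurable_snd).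
  exact: (measurableT_comp (measurable_coord i) measurable_fst).
pose xy (x y : X) (i : 'I_m.+2) : R :=
  (x : 'rV[R]_m.+2) ord0 i - (y : 'rV[R]_m.+2) ord0 i.
have pB x y w : p (x, w) - p (y, w) = \sum_i xi i w * xy x y i.
  by rewrite /p -sumrB; apply: eq_bigr => i _ /=; rewrite -mulrBr.
pose S := power_spectrum mu p f.
have S0 w : 0 <= S w by exact: power_spectrum_ge0.
have [_ HK] := Hxi _ a0.
have xyE x y : \sum_i xy x y i ^+ 2 = dist2 (x, y) by [].
pose G a (z : X * X) :=
  Num.sqrt (pi / a) ^+ m.+2 * expR (- (dist2 z / (4 * a))).
have HG b' x y : 0 < b' ->
    \int[mT]_w (expR (- (b' * q w)) * cos (p (x, w) - p (y, w))) = G b' (x, y).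
  move=> b0; have [_ /(_ (xy x y) 0)] := Hxi _ b0.
  rewrite cos0 mulr1 xyE /G => <-.
  by apply: eq_Rintegral => w _; rewrite pB addr0.
have i16 k : mT.-integrable setT (EFin \o fun w => expR (- (q w / 16 ^+ k))).
  have k0 : 0 < (16 ^+ k)^-1 :> R by rewrite invr_gt0 exprn_gt0.
  have [+ _] := Hxi _ k0; apply: eq_integrable => // w _ /=.
  by rewrite mulrC.
have gaussI k : mT.-integrable setT (EFin \o fun w =>
  expR (- (q w / 16 ^+ k)) * S w).
  have H := integrable_power_spectrum mu mp mf fb' (i16 k). exact: H.
(* The spectral identity from right to left, then Schur's test. *)
have gaussS k : \int[mT]_w (expR (- (q w / 16 ^+ k)) * S w)
    <= Cg * 2 ^+ (k * m.+1) * rate ^+ k * \int[mu]_x (f x ^+ 2).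
  have k0 : 0 < (16 ^+ k)^-1 :> R by rewrite invr_gt0 exprn_gt0.
  rewrite -(spectral_identity mu mp mf fb' (i16 k)).
  have -> : \int[mu]_x \int[mu]_y (f x * f y * \int[mT]_w
      (expR (- (q w / 16 ^+ k)) * cos (p (x, w) - p (y, w)))) =
    \int[mu]_x \int[mu]_y (G (16 ^+ k)^-1 (x, y) * (f x * f y)).
    apply: eq_Rintegral => x _; apply: eq_Rintegral => y _.
    rewrite mulrC; congr (_ * _); rewrite -(HG (16 ^+ k)^-1 x y k0).
    by apply: eq_Rintegral => w _; rewrite [q w / _]mulrC.
  have sq0 : 0 <= Num.sqrt (pi / (16 ^+ k)^-1) ^+ m.+2 :> R.
    by rewrite exprn_ge0// sqrtr_ge0.
  have mE : measurable_fun setT (fun z : X * X =>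
    expR (- (dist2 z / (4 * (16 ^+ k)^-1)))).
    apply: measurableT_comp => //; apply: measurableT_comp => //.
    by apply: measurable_funM; [exact: measurable_dist2|exact: measurable_cst].
  have E1 (z : X * X) : expR (- (dist2 z / (4 * (16 ^+ k)^-1))) <= 1 :> R.
    by rewrite -[X in _ <= X]expR0 ler_expR oppr_le0 divr_ge0 ?dist2_ge0.
  apply: (@schur_test _ _ _ mu (G (16 ^+ k)^-1)
    (Num.sqrt (pi / (16 ^+ k)^-1) ^+ m.+2) _ f b).
  - by apply: measurable_funM; [exact: measurable_cst|exact: mE].
  - by move=> z; rewrite /G mulr_ge0// expR_ge0.
  - by move=> z; rewrite /G ler_piMr.
  - by move=> x y; rewrite /G dist2C.
  - move=> x.
    have iE : mu.-integrable setT (EFin \o fun y =>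
      expR (- (dist2 (x, y) / (4 * (16 ^+ k)^-1)))).
      apply: (@bounded_integrable _ _ _ _ _ 1).
        exact: (measurableT_comp mE (pair1_measurable x)).
      by move=> y; rewrite ger0_norm ?expR_ge0.
    by rewrite /G (RintegralZl _ measurableT iE).
  - by [].
  - by [].
pose P := \prod_(i < N) (h + i%:R).
pose A2 := expR N%:R * N%:R ^- N * P / Num.sqrt (pi / a) ^+ m.+2.
(* The Fourier transform of K. *)
pose M w := A2 * laguerre_exp h N (a * q w).
have A20 : 0 <= A2.
  apply: divr_ge0; last by rewrite exprn_ge0// sqrtr_ge0.
  apply: mulr_ge0; first
    by rewrite mulr_ge0 ?expR_ge0// invr_ge0 exprn_ge0// ltW.
  by apply: prodr_ge0 => i _; rewrite addr_ge0// ltW.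
have A2le : A2 <= 2 * expR 1 * h * eps * t ^+ m.+1.
  exact: (@laguerre_coef_le R m n N t eps h a).
have iM : mT.-integrable setT (EFin \o M).
  apply: integrableT_scale.
  have mc1 : measurable_fun setT ((fun=> 1) : T -> R) by exact: measurable_cst.
  have c1 (w : T) : `|((fun=> 1) : T -> R) w| <= 1 by rewrite normr1.
  have := integrable_laguerre_type mxi Hxi (laguerre h N) a0 mc1 c1.
  by apply: eq_integrable => // w _ /=; rewrite mulr1.
have sq0 : 0 < Num.sqrt (pi / a) ^+ m.+2.
  by rewrite exprn_gt0// sqrtr_gt0 divr_gt0// pi_gt0.
pose u (z : X * X) := dist2 z / t ^+ 2.
have u0 z : 0 <= u z by rewrite divr_ge0 ?dist2_ge0// sqr_ge0.
pose K (z : X * X) := (u z * expR (1 - u z)) ^+ N.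
have KE x y : \int[mT]_w (M w * cos (p (x, w) - p (y, w))) = K (x, y).
  transitivity (A2 * \int[mT]_w
    (laguerre_exp h N (a * q w) * cos (\sum_i xi i w * xy x y i))).
    rewrite -RintegralZl//; last first.
      apply: integrable_laguerre_type => //; first exact: measurable_cos_dot.
      by move=> w; rewrite ler_norml cos_geN1 cos_le1.
    by apply: eq_Rintegral => w _; rewrite pB /M mulrA.
  have := laguerre_fourier mxi Hxi N (xy x y) h0 a0; rewrite xyE -/h -/P.
  have -> : dist2 (x, y) / (4 * a) = N%:R * u (x, y).
    by rewrite /u /a; field; rewrite !gt_eqF.
  rewrite /A2 => /(congr1 (fun z =>
    expR N%:R * N%:R ^- N / Num.sqrt (pi / a) ^+ m.+2 * z)).
  set J := Rintegral _ _ _ => H.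
  transitivity (expR N%:R * N%:R ^- N / Num.sqrt (pi / a) ^+ m.+2 * (P * J)).
    by ring.
  rewrite H /K.
  have -> : (u (x, y) * expR (1 - u (x, y))) ^+ N =
      u (x, y) ^+ N * (expR N%:R * expR (- (N%:R * u (x, y)))).
    by rewrite [LHS]exprMn -expRM_natl mulrBr mulr1 expRD.
  rewrite [(N%:R * u _) ^+ N]exprMn.
  have NN : N%:R ^+ N != 0 :> R by rewrite expf_neq0// gt_eqF.
  move: (Num.sqrt _ ^+ _) sq0 => c c0.
  move: (N%:R ^+ N) NN => c1 c10.
  by field; rewrite c10 gt_eqF.
have Mle w : exists k, `|M w| <=
  A1 * eps * 2 ^- (k * m.+1) * expR (- (q w / 16 ^+ k)).
  have [k Hk] := HA t (q w) N t0 tD mN (q0 w); exists k.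
  have -> : A1 * eps * 2 ^- (k * m.+1) * expR (- (q w / 16 ^+ k)) =
    2 * expR 1 * h * eps * (A * 2 ^- (k * m.+1) * expR (- (q w / 16 ^+ k))).
    by rewrite /A1; ring.
  have c0 : 0 <= 2 * expR 1 * h * eps by rewrite !mulr_ge0 ?expR_ge0 ?ltW.
  apply: le_trans (ler_wpM2l c0 Hk); rewrite mulrA /M normrM ger0_norm//.
  apply: ler_pM => //; rewrite /laguerre_wave exprMn sqr_sqrtr//.
  by rewrite /a mulrAC.
have form : \int[mu]_x \int[mu]_y (annulus_indic t eps (x, y) * (f x * f y))
   <= expR 9 * \int[mT]_w (M w * S w).
  rewrite -(spectral_identity mu mp mf fb' iM).
  have mu_ : measurable_fun setT u.
    by apply: measurable_funM; [exact: measurable_dist2|exact: measurable_cst].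
  have mK : measurable_fun setT K.
    apply: measurable_funX; apply: measurable_funM => //.
    by apply: measurableT_comp => //; apply: measurable_funB => //;
      exact: measurable_cst.
  have K0 z : 0 <= K z by rewrite exprn_ge0// mulr_ge0 ?expR_ge0.
  have K1 z : K z <= 1.
    apply: exprn_ile1; first by rewrite mulr_ge0 ?expR_ge0.
    rewrite -[1 - u z]opprB expRN ler_pdivrMr ?expR_gt0// mul1r.
    by have := expR_ge1Dx (u z - 1); rewrite addrC subrK.
  have mff : measurable_fun setT (fun z : X * X => f z.1 * f z.2).
    apply: measurable_funM; first exact: (measurableT_comp mf measurable_fst).
    exact: (measurableT_comp mf measurable_snd).
  have ff0 (z : X * X) : 0 <= f z.1 * f z.2 by rewrite mulr_ge0.
  have ffb (z : X * X) : f z.1 * f z.2 <= b * b by exact: ler_pM.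
  have bb (z : X * X) : 0 <= b * b by apply: le_trans (ff0 z) (ffb z).
  have mind := @measurable_annulus_indic R m.+2 t eps.
  have ind0 (z : X * X) : 0 <= annulus_indic t eps z by exact: ler0n.
  have ind1 (z : X * X) : annulus_indic t eps z <= 1.
    by rewrite /annulus_indic; case: (_ <= _ <= _) => //=; rewrite ler01.
  have e91 : 1 <= expR 9 :> R by rewrite -[X in X <= _]expR0 ler_expR.
  apply: (@le_trans _ _ (\int[mu]_x \int[mu]_y
    (expR 9 * K (x, y) * (f x * f y)))).
    apply: (@Rintegral2_le _ _ _ mu (fun z =>
      annulus_indic t eps z * (f z.1 * f z.2))
      (fun z => expR 9 * K z * (f z.1 * f z.2)) (expR 9 * (b * b))).
    - exact: measurable_funM.
    - apply: measurable_funM => //; apply: measurable_funM => //;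
        exact: measurable_cst.
    - move=> z; rewrite ger0_norm ?mulr_ge0//; apply: ler_pM => //.
      exact: le_trans (ind1 z) e91.
    - move=> z; rewrite ger0_norm; last by rewrite !mulr_ge0 ?expR_ge0.
      by apply: ler_pM => //;
        [rewrite mulr_ge0 ?expR_ge0|rewrite ler_piMr ?expR_ge0].
    move=> z; apply: ler_wpM2r => //; rewrite /annulus_indic.
    case Hz : (_ <= _ <= _); last by rewrite mulr_ge0 ?expR_ge0.
    have uz : u z = enorm ((z.2 : 'rV[R]_m.+2) - z.1) ^+ 2 / t ^+ 2.
      by rewrite /u -dist2E; case: (z).
    have := annulus_kernel_ge uz e0 te nt Hz; rewrite -/N -/(K z) => HKz.
    have := ler_wpM2l (expR_ge0 9) HKz; rewrite -expRD subrr expR0.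
    by [].
  rewrite le_eqVlt; apply/orP; left; apply/eqP.
  rewrite -RintegralZl//; last first.
    have gb x y : `|K (x, y) * (f x * f y)| <= (b * b) * 1.
      rewrite mulr1 ger0_norm ?mulr_ge0// -[b * b]mul1r.
      by apply: ler_pM => //; [exact: (ff0 (x, y))|exact: (ffb (x, y))].
    have iB (c : R) : mu.-integrable setT (EFin \o (fun=> c : R)).
      exact: finite_measure_integrable_cst.
    have := @dominated_integrable1 _ _ _ _ _ mu mu (fun z =>
      K z * (f z.1 * f z.2)) _ _ (measurable_funM mK mff) gb (iB _) (iB _).
    apply: eq_integrable => // x _ /=; congr EFin; apply: eq_Rintegral => y _.
    by rewrite KE mulrC.
  apply: eq_Rintegral => x _; rewrite -RintegralZl//.
    by apply: eq_Rintegral => y _; rewrite KE; ring.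
  have : mu.-integrable setT (EFin \o fun y => K (x, y) * (f x * f y)).
    apply: (@bounded_integrable _ _ _ _ _ (b * b)).
      exact: (measurableT_comp (measurable_funM mK mff) (pair1_measurable x)).
    move=> y; rewrite ger0_norm ?mulr_ge0// -[b * b]mul1r.
    by apply: ler_pM => //; [rewrite mulr_ge0|exact: (ffb (x, y))].
  by apply: eq_integrable => // y _ /=; rewrite KE mulrC.
apply: le_trans form _; rewrite -mulrA -mulrA; apply: ler_wpM2l;
  first exact: expR_ge0.
pose I := \int[mu]_x (f x ^+ 2).
have I0 : 0 <= I by apply: Rintegral_ge0 => x _; exact: sqr_ge0.
have iMS := integrable_power_spectrum mu mp mf fb' iM.
pose g w := `|M w| * S w.
have g0 w : 0 <= g w by rewrite mulr_ge0.
have gE w : g w = `|M w * S w| by rewrite normrM [`|S w|]ger0_norm.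
have mg : measurable_fun setT g.
  rewrite (_ : g = Num.norm \o (fun w => M w * S w)); last exact/funext.
  apply: measurableT_comp => //.
  by case/integrableP: iMS => /measurable_EFinP.
pose F k w := A1 * eps * 2 ^- (k * m.+1) * (expR (- (q w / 16 ^+ k)) * S w).
have c0 k : 0 <= A1 * eps * 2 ^- (k * m.+1).
  by rewrite mulr_ge0 ?invr_ge0 ?exprn_ge0// mulr_ge0// ltW.
have mF k : measurable_fun setT (F k).
  by case/integrableP:
    (integrableT_scale (A1 * eps * 2 ^- (k * m.+1)) (gaussI k)) =>
    /measurable_EFinP.
have F0 k w : 0 <= F k w by rewrite mulr_ge0// mulr_ge0 ?expR_ge0.
have gF w : exists k, g w <= F k w.
  by have [k Hk] := Mle w; exists k; rewrite /F mulrA; apply: ler_wpM2r.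
have A30 : 0 <= A1 * Cg * eps * I by rewrite !mulr_ge0// ltW.
have intF k : (\int[mT]_w (F k w)%:E <= (A1 * Cg * eps * I * rate ^+ k)%:E)%E.
  have iF := integrableT_scale (A1 * eps * 2 ^- (k * m.+1)) (gaussI k).
  rewrite -(fineK (integrable_fin_num measurableT iF)) lee_fin.
  rewrite -/(Rintegral mT setT (F k)) /F RintegralZl//.
  apply: le_trans (ler_wpM2l (c0 k) (gaussS k)) _.
  have p2 : 2 ^+ (k * m.+1) != 0 :> R by rewrite expf_neq0.
  rewrite -/I le_eqVlt; apply/orP; left; apply/eqP.
  by move: (2 ^+ (k * m.+1)) p2 (rate ^+ k) => c cn0 r; field.
have := integral_le_geometric mg g0 mF F0 gF rate01 A30 intF.
have ig : mT.-integrable setT (EFin \o g).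
  apply: (@le_integrable _ _ _ _ _ _ _ (EFin \o fun w => M w * S w)) => //.
    exact/measurable_EFinP.
  by move=> w _ /=; rewrite lee_fin gE normr_id.
rewrite -(fineK (integrable_fin_num measurableT ig)) lee_fin => H.
apply: (@le_trans _ _ (\int[mT]_w g w)).
  by apply: le_Rintegral => // w _; rewrite gE ler_norm.
apply: le_trans H _; rewrite le_eqVlt -/I; apply/orP; left; apply/eqP.
by ring.
Qed.

End annulus_form.

(** * The quadratic form of the annulus at all distances *)
Section annulus_indic_theory.
Variables (R : realType) (d : nat) (t eps : R).
Let X := borelRd R d.

Lemma annulus_indic_ge0 (z : X * X) : 0 <= annulus_indic t eps z.
Proof. exact: ler0n. Qed.

Lemma annulus_indic_le1 (z : X * X) : annulus_indic t eps z <= 1.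
Proof. by rewrite /annulus_indic; case: (_ <= _ <= _) => //=; exact: ler01. Qed.

Lemma annulus_indicC (x y : X) : annulus_indic t eps (x, y) =
  annulus_indic t eps (y, x).
Proof. by rewrite /annulus_indic/= enormB. Qed.

Lemma annulus_indic_ball (r : R) (x y : X) : t + eps < r ->
  annulus_indic t eps (x, y) <= \1_(eball x r) y.
Proof.
move=> tr; rewrite /annulus_indic/= indicE.
case Hz : (_ <= _ <= _); last exact: ler0n.
rewrite mem_set//; move/andP: Hz => [_ Hz].
exact: le_lt_trans Hz tr.
Qed.

Lemma annulus_indic_far (D : R) (x y : X) : 0 < D -> 2 * D <= t - eps ->
  annulus_indic t eps (x, y) <= \1_(~` eball 0 D) x + \1_(~` eball 0 D) y.
Proof.
move=> D0 tD; rewrite /annulus_indic/= !indicE.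
case Hz : (_ <= _ <= _); last by rewrite addr_ge0.
have [Hx|Hx] := boolP (x \in ~` eball 0 D); first by rewrite lerDl.
have [Hy|Hy] := boolP (y \in ~` eball 0 D); first by rewrite lerDr.
exfalso; move: Hx Hy; rewrite !in_setC !negbK => /set_mem Hx /set_mem Hy.
rewrite /eball/= !subr0 in Hx Hy.
have {}Hx : enorm (x : 'rV[R]_d) ^+ 2 < D ^+ 2.
  by rewrite ltr_pXn2r ?nnegrE ?enorm_ge0// ltW.
have {}Hy : enorm (y : 'rV[R]_d) ^+ 2 < D ^+ 2.
  by rewrite ltr_pXn2r ?nnegrE ?enorm_ge0// ltW.
have par : enorm ((y : 'rV[R]_d) - x) ^+ 2 <=
    2 * (enorm (x : 'rV[R]_d) ^+ 2) + 2 * (enorm (y : 'rV[R]_d) ^+ 2).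
  rewrite !sqr_enorm !mulr_sumr -big_split/=; apply: ler_sum => i _.
  rewrite !mxE; set u : R := (x : 'rV[R]_d) ord0 i; set v : R :=
    (y : 'rV[R]_d) ord0 i.
  by have := sqr_ge0 (u + v); lra.
move/andP: Hz => [Hz _].
have := le_trans tD Hz.
rewrite -(@ler_pXn2r _ 2) ?nnegrE ?enorm_ge0//; last by rewrite mulr_ge0// ltW.
by lra.
Qed.

End annulus_indic_theory.

Section annulus_form_bound.
Variables (R : realType) (m : nat).
Let X := borelRd R m.+2.
Variables (mu : {finite_measure set X -> \bar R}) (s C0 D : R).
Hypothesis s1 : (m.+2%:R + 1) / 2 < s.
Hypothesis sd : s <= m.+2%:R.
Hypothesis C00 : 0 <= C0.
Hypothesis ball : forall x r, 0 < r -> (mu (eball x r) <= (C0 * r `^ s)%:E)%E.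
Hypothesis D0 : 0 < D.
Hypothesis Dsupp : mu (~` eball 0 D) = 0%E.

Let cE (V : set X) : measurable V ->
  \int[mu]_y \1_V y = fine (mu V).
Proof. by move=> mV; rewrite /Rintegral integral_indic ?setIT. Qed.

Let icst (c : R) : mu.-integrable setT (EFin \o (fun=> c : R)).
Proof. exact: finite_measure_integrable_cst. Qed.

(** Four regimes: eps >= 1, where the total mass suffices; eps comparable with
    t, where the annulus sits inside a ball of radius O(eps); the case of
    [annulus_form_le]; and t larger than the diameter of the support. *)
Lemma annulus_form_bound : exists2 C : R, 0 <= C &
  forall (t eps b : R) (f : X -> R), 0 < t -> 0 < eps ->
    measurable_fun setT f -> (forall x, 0 <= f x) -> (forall x, f x <= b) ->
    \int[mu]_x \int[mu]_y (annulus_indic t eps (x, y) * (f x * f y))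
    <= C * eps * \int[mu]_x (f x ^+ 2).
Proof.
have D1 : 0 < 2 * D + 1 by move: D0; lra.
have [C C_0 HC] := annulus_form_le s1 sd C00 ball D1.
have s_ge1 : 1 <= s
  by move: s1; have := ler0n R m; rewrite -[m.+2%:R]natr1 -[m.+1%:R]natr1; lra.
pose L : R := fine (mu setT); have L0 : 0 <= L by exact: fine_ge0.
pose E : R := m.+4%:R; have E0 : 0 < E by rewrite ltr0n.
pose C1 := C0 * E `^ s; have C10 : 0 <= C1 by rewrite mulr_ge0// powR_ge0.
exists (C + L + C1); first by rewrite !addr_ge0.
move=> t eps b f t0 e0 mf f0 fb.
have fb' x : `|f x| <= b by rewrite ger0_norm.
have I0 : 0 <= \int[mu]_x (f x ^+ 2).
  by apply: Rintegral_ge0 => x _; exact: sqr_ge0.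
have mk := @measurable_annulus_indic R m.+2 t eps.
have msec (x : X) :
  measurable_fun setT (fun y : X => annulus_indic t eps (x, y) : R).
  exact: (measurableT_comp mk (pair1_measurable x)).
have isec (x : X) :
  mu.-integrable setT (EFin \o fun y : X => annulus_indic t eps (x, y) : R).
  apply: (@bounded_integrable _ _ _ _ _ 1) => // y.
  by rewrite ger0_norm ?annulus_indic_ge0// annulus_indic_le1.
have iV (V : set X) : measurable V ->
  mu.-integrable setT (EFin \o (\1_V : X -> R)).
  move=> mV; apply: (@bounded_integrable _ _ _ _ _ 1) => // y.
  by rewrite indicE ger0_norm ?ler0n//; case: (_ \in _).
have schur (c : R) : c <= C + L + C1 ->
    (forall x, \int[mu]_y annulus_indic t eps (x, y) <= c * eps) ->
    \int[mu]_x \int[mu]_y (annulus_indic t eps (x, y) * (f x * f y)) <=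
      (C + L + C1) * eps * \int[mu]_x (f x ^+ 2).
  move=> cC Hc.
  have H := schur_test mk (@annulus_indic_ge0 R m.+2 t eps)
    (@annulus_indic_le1 R m.+2 t eps) (@annulus_indicC R m.+2 t eps) Hc mf fb'.
  apply: le_trans H _; apply: ler_wpM2r => //.
  by apply: ler_wpM2r => //; exact: ltW.
(* eps >= 1: the total mass is at most its product with eps. *)
have [e1|e1] := leP 1 eps.
  apply: (schur L) => [|x]; first
    by rewrite -addrA [L + _]addrC addrA lerDr addr_ge0.
  apply: (@le_trans _ _ L); last exact: ler_peMr.
  rewrite /L -cE//; apply: le_Rintegral => //;
    [exact: isec|exact: (iV setT measurableT)|].
  by move=> y _; rewrite indicT annulus_indic_le1.
(* Here s >= 1 and eps < 1, so that eps^s <= eps. *)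
have [te|te] := ltP t (m.+2%:R * eps).
  apply: (schur C1) => [|x]; first by rewrite lerDr addr_ge0.
  have r0 : 0 < E * eps by rewrite mulr_gt0.
  have mB := measurable_eball (x : 'rV[R]_m.+2) (E * eps).
  apply: (@le_trans _ _ (C0 * (E * eps) `^ s)); last first.
    rewrite /C1 -mulrA; apply: ler_wpM2l => //.
    rewrite powRM ?(ltW E0) ?(ltW e0)//; apply: ler_wpM2l;
      first exact: powR_ge0.
    by apply: ge1r_powR => //; rewrite e0 ltW.
  apply: (@le_trans _ _ (fine (mu (eball x (E * eps))))); last first.
    by rewrite -lee_fin fineK ?fin_num_measure//; exact: ball.
  rewrite -cE//; apply: le_Rintegral => //; [exact: isec|exact: (iV _ mB)|].
  move=> y _; apply: annulus_indic_ball.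
  by rewrite /E -[m.+4%:R]natr1 -[m.+3%:R]natr1; lra.
have [tD|tD] := leP t (2 * D + 1).
  apply: le_trans (HC t eps b f e0 te tD mf f0 fb) _; apply: ler_wpM2r => //.
  apply: ler_wpM2r; first exact: ltW.
  by rewrite -addrA lerDl addr_ge0.
(* t - eps >= 2 D: two points this far apart cannot both lie in the ball that
   carries mu. *)
pose V : set X := ~` eball 0 D.
have mV : measurable V by apply: measurableC; exact: measurable_eball.
have V0 : \int[mu]_y \1_V y = 0 by rewrite cE// Dsupp.
apply: (@le_trans _ _ 0); last first.
  by rewrite mulr_ge0// mulr_ge0 ?(ltW e0)// !addr_ge0.
have b0 : 0 <= b by apply: le_trans (f0 0) (fb 0).
have m1V : measurable_fun setT (\1_V : X -> R) by exact: measurable_indic.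
have mV1 : measurable_fun setT (fun z : X * X => \1_V z.1 : R).
  exact: (measurableT_comp m1V measurable_fst).
have mV2 : measurable_fun setT (fun z : X * X => \1_V z.2 : R).
  exact: (measurableT_comp m1V measurable_snd).
have i01 x : 0 <= (\1_V x : R) <= 1 by rewrite indicE ler0n; case: (_ \in _);
  rewrite /= ?lexx ?ler01.
apply: (@le_trans _ _ (\int[mu]_x \int[mu]_y (b * b * (\1_V x + \1_V y)))).
  apply: (@Rintegral2_le _ _ _ mu (fun z =>
    annulus_indic t eps z * (f z.1 * f z.2))
      (fun z => b * b * (\1_V z.1 + \1_V z.2)) (b * b * 2)).
  - apply: measurable_funM => //; apply: measurable_funM.
      exact: (measurableT_comp mf measurable_fst).
    exact: (measurableT_comp mf measurable_snd).
  - by apply: measurable_funM; [exact: measurable_cst|exact: measurable_funD].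
  - move=> z; rewrite ger0_norm; last by rewrite !mulr_ge0// annulus_indic_ge0.
    rewrite mulrC; apply: ler_pM; rewrite ?mulr_ge0 ?annulus_indic_ge0//.
      exact: ler_pM.
    by apply: le_trans (annulus_indic_le1 _ _ _) _; rewrite ler1n.
  - move=> z; have /andP[a1 a2] := i01 z.1; have /andP[a3 a4] := i01 z.2.
    rewrite ger0_norm; last by rewrite !mulr_ge0// addr_ge0.
    by apply: ler_wpM2l; rewrite ?mulr_ge0//; lra.
  case=> x y; rewrite mulrC; apply: ler_pM;
    rewrite ?mulr_ge0 ?annulus_indic_ge0//.
    exact: ler_pM.
  by apply: annulus_indic_far => //; lra.
rewrite (_ : (fun x => _) = (fun x : X => b * b * L * \1_V x)); last first.
  apply/funext => x; have iV' := iV _ mV.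
  have icV : mu.-integrable setT (EFin \o fun y : X => \1_V x + \1_V y : R).
    exact: integrableD (icst _) iV'.
  rewrite (RintegralZl _ measurableT icV)
    (RintegralD measurableT (icst _) iV') V0 addr0.
  by rewrite (Rintegral_cst _ measurableT) /L; ring.
by rewrite (RintegralZl _ measurableT (iV _ mV)) V0 mulr0.
Qed.

End annulus_form_bound.

(** * From the quadratic form to chains *)
Lemma absorb_le (R : realFieldType) (c F G : R) : 0 < c ->
  (4 * c)^-1 * G <= c * (2 * F + 2 * (4 * c)^-1 ^+ 2 * G) -> G <=
    (4 * c) ^+ 2 * F.
Proof.
move=> c0.
have -> : c * (2 * F + 2 * (4 * c)^-1 ^+ 2 * G) =
  2 * c * F + (4 * c)^-1 * G / 2.
  by field; rewrite gt_eqF.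
have c4 : 0 < 4 * c by rewrite mulr_gt0.
have := gt_eqF c4; set w := (4 * c)^-1 * G => cn0 H.
have -> : G = 4 * c * w by rewrite /w mulrA mulfV ?cn0// mul1r.
have H5 : w <= 4 * c * F by move: w H => w; lra.
by rewrite expr2 -[X in _ <= X]mulrA; apply: ler_wpM2l => //; exact: ltW.
Qed.

Section form_to_operator.
Context (d : measure_display) (X : measurableType d) (R : realType).
Variables (mu : {finite_measure set X -> \bar R}).
Let icst (c : R) : mu.-integrable setT (EFin \o (fun=> c : R)).
Proof. exact: finite_measure_integrable_cst. Qed.

Section kernel_integral.
Variables (k : X * X -> R) (f : X -> R) (b : R).
Hypothesis mk : measurable_fun setT k.
Hypothesis k01 : forall z, 0 <= k z <= 1.
Hypothesis mf : measurable_fun setT f.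
Hypothesis fb : forall x, 0 <= f x <= b.

Let p (z : X * X) := k z * f z.2.

Let mp : measurable_fun setT p.
Proof.
by apply: measurable_funM => //; exact: (measurableT_comp mf measurable_snd).
Qed.

Let pb x y : `|p (x, y)| <= b * 1.
Proof.
have /andP[k0 k1] := k01 (x, y); have /andP[f0 fb'] := fb y.
by rewrite mulrC ger0_norm ?mulr_ge0//; exact: ler_pM.
Qed.

Lemma measurable_kernel_integral :
  measurable_fun setT (fun x => \int[mu]_y (k (x, y) * f y)).
Proof. exact: (dominated_measurable1 mp pb (icst _) (icst _)). Qed.

Lemma kernel_section_integrable x :
  mu.-integrable setT (EFin \o fun y => k (x, y) * f y).
Proof.
apply: (@bounded_integrable _ _ _ _ _ (b * 1)).
  exact: (measurableT_comp mp (pair1_measurable x)).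
by move=> y; exact: pb.
Qed.

Lemma kernel_integral_itv x : 0 <= \int[mu]_y (k (x, y) * f y) <=
  b * fine (mu setT).
Proof.
apply/andP; split.
  apply: Rintegral_ge0 => y _; have /andP[k0 k1] := k01 (x, y).
  by have /andP[f0 fb'] := fb y; rewrite mulr_ge0.
rewrite -(Rintegral_cst mu measurableT).
apply: le_Rintegral => //; first exact: kernel_section_integrable.
by move=> y _; have := pb x y; rewrite mulr1; apply: le_trans; exact: ler_norm.
Qed.

End kernel_integral.

Variables (k : X * X -> R) (c : R).
Hypothesis mk : measurable_fun setT k.
Hypothesis k01 : forall z, 0 <= k z <= 1.
Hypothesis c0 : 0 < c.
Hypothesis form : forall (f : X -> R) (b : R), measurable_fun setT f ->
  (forall x, 0 <= f x) -> (forall x, f x <= b) ->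
  \int[mu]_x \int[mu]_y (k (x, y) * (f x * f y)) <= c * \int[mu]_x (f x ^+ 2).

(** With g the image of f, test the form on f + l g.  As all functions are
    nonnegative, the form is at least its cross term, which is l |g|^2, while
    its upper bound is 2 c (|f|^2 + l^2 |g|^2); the choice l = 1 / (4c) lets
    the last term be absorbed. *)
Lemma operator_norm_le (f : X -> R) (b : R) : measurable_fun setT f ->
  (forall x, 0 <= f x <= b) ->
  \int[mu]_x (\int[mu]_y (k (x, y) * f y)) ^+ 2 <=
    (4 * c) ^+ 2 * \int[mu]_x (f x ^+ 2).
Proof.
move=> mf fb; pose g x := \int[mu]_y (k (x, y) * f y).
have mg : measurable_fun setT g
  by exact: measurable_kernel_integral mk k01 mf fb.
have gb x : 0 <= g x <= b * fine (mu setT) by exact: kernel_integral_itv.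
pose l := (4 * c)^-1.
have l0 : 0 <= l by rewrite invr_ge0 mulr_ge0// ltW.
pose u x := f x + l * g x.
have mu' : measurable_fun setT u.
  by apply: measurable_funD => //; apply: measurable_funM => //;
    exact: measurable_cst.
pose B := b + l * (b * fine (mu setT)).
have u0 x : 0 <= u x.
  by have /andP[? _] := fb x; have /andP[? _] := gb x;
    rewrite addr_ge0// mulr_ge0.
have uB x : u x <= B.
  have /andP[_ ?] := fb x; have /andP[_ ?] := gb x; rewrite lerD//.
  exact: ler_wpM2l.
have isq (h : X -> R) b' : measurable_fun setT h ->
  (forall x, 0 <= h x <= b') ->
    mu.-integrable setT (EFin \o fun x => h x ^+ 2).
  move=> mh hb; apply: (@bounded_integrable _ _ _ _ _ (b' ^+ 2)).
    exact: measurable_funX.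
  move=> x; have /andP[h0 h1] := hb x.
  by rewrite ger0_norm ?sqr_ge0//; apply: lerXn2r => //; rewrite nnegrE//;
    exact: le_trans h1.
have i_f := isq f b mf fb.
have i_g := isq g _ mg gb.
have i_u : mu.-integrable setT (EFin \o fun x => u x ^+ 2).
  by apply: (isq u B) => // x; rewrite u0 uB.
have H1 : l * \int[mu]_x (g x ^+ 2) <=
  \int[mu]_x \int[mu]_y (k (x, y) * (u x * u y)).
  have -> : l * \int[mu]_x (g x ^+ 2) =
      \int[mu]_x \int[mu]_y (k (x, y) * (l * g x * f y)).
    rewrite -RintegralZl//; apply: eq_Rintegral => x _.
    transitivity (l * g x * g x); first by ring.
    rewrite {2}/g -RintegralZl//; last exact: kernel_section_integrable fb _.
    by apply: eq_Rintegral => y _; ring.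
  have m1 (h : X -> R) : measurable_fun setT h ->
    measurable_fun setT (fun z : X * X => h z.1).
    by move=> mh; exact: (measurableT_comp mh measurable_fst).
  have m2 (h : X -> R) : measurable_fun setT h ->
    measurable_fun setT (fun z : X * X => h z.2).
    by move=> mh; exact: (measurableT_comp mh measurable_snd).
  have lgu x : 0 <= l * g x <= u x.
    have /andP[? _] := fb x; have /andP[? _] := gb x.
    by rewrite mulr_ge0//= lerDr.
  have fu x : 0 <= f x <= u x.
    have /andP[f0 _] := fb x; have /andP[? _] := gb x.
    by rewrite f0 lerDl mulr_ge0.
  have main z : k z * (l * g z.1 * f z.2) <= k z * (u z.1 * u z.2).
    have /andP[k0 _] := k01 z; apply: ler_wpM2l => //.
    by have /andP[? ?] := lgu z.1; have /andP[? ?] := fu z.2; exact: ler_pM.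
  have bnd z : k z * (u z.1 * u z.2) <= B * B.
    have /andP[k0 k1] := k01 z; rewrite -[B * B]mul1r; apply: ler_pM => //.
      exact: mulr_ge0.
    exact: ler_pM.
  have pos z : 0 <= k z * (l * g z.1 * f z.2).
    have /andP[k0 _] := k01 z; have /andP[? ?] := lgu z.1;
      have /andP[? ?] := fu z.2.
    by rewrite mulr_ge0// mulr_ge0.
  apply: (@Rintegral2_le _ _ _ mu (fun z => k z * (l * g z.1 * f z.2))
      (fun z => k z * (u z.1 * u z.2)) (B * B)) => //.
  - apply: measurable_funM => //; apply: measurable_funM; last exact: m2.
    by apply: measurable_funM; [exact: measurable_cst|exact: m1].
  - by apply: measurable_funM => //; apply: measurable_funM;
      [exact: m1|exact: m2].
  - by move=> z; rewrite ger0_norm//; exact: le_trans (main z) (bnd z).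
  - by move=> z; rewrite ger0_norm//; exact: le_trans (pos z) (main z).
have H2 : \int[mu]_x (u x ^+ 2) <=
    2 * \int[mu]_x (f x ^+ 2) + 2 * l ^+ 2 * \int[mu]_x (g x ^+ 2).
  have i2f := integrableT_scale 2 i_f.
  have i2g := integrableT_scale (2 * l ^+ 2) i_g.
  rewrite -!RintegralZl// -RintegralD//; apply: le_Rintegral => //.
    exact: integrableD i2f i2g.
  move=> x _; rewrite /u.
  by have := sqr_ge0 (f x - l * g x); lra.
exact: (absorb_le c0
  (le_trans (le_trans H1 (form mu' u0 uB)) (ler_wpM2l (ltW c0) H2))).
Qed.

End form_to_operator.

Section chain.
Context (d : measure_display) (X : measurableType d) (R : realType).
Variables (mu : {finite_measure set X -> \bar R}).

(** The total weight of the chains of n links that start at x, link i being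
    weighted by the kernel k i. *)
Fixpoint chain_integral n : ('I_n -> X * X -> R) -> X -> R :=
  match n with
  | 0 => fun _ _ => 1
  | n'.+1 => fun k x =>
      \int[mu]_y (k ord0 (x, y) * chain_integral (fun i => k (lift ord0 i)) y)
  end.

Lemma chain_integral_itv n (k : 'I_n -> X * X -> R) :
  (forall i, measurable_fun setT (k i)) -> (forall i z, 0 <= k i z <= 1) ->
  measurable_fun setT (chain_integral k) /\
  exists b : R, forall x, 0 <= chain_integral k x <= b.
Proof.
elim: n k => [|n IH] k mk k01.
  by split; [exact: measurable_cst|exists 1 => x; rewrite ler01 lexx].
have [mH [b Hb]] :=
  IH (fun i => k (lift ord0 i)) (fun i => mk _) (fun i => k01 _).
split; first exact: measurable_kernel_integral (mk ord0) (k01 ord0) mH Hb.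
exists (b * fine (mu setT)) => x.
exact: kernel_integral_itv (mk ord0) (k01 ord0) mH Hb x.
Qed.

Lemma chain_integral_le n (k : 'I_n -> X * X -> R) (c : R) : 0 < c ->
  (forall i, measurable_fun setT (k i)) -> (forall i z, 0 <= k i z <= 1) ->
  (forall i (f : X -> R) (b : R), measurable_fun setT f ->
    (forall x, 0 <= f x) -> (forall x, f x <= b) ->
    \int[mu]_x \int[mu]_y (k i (x, y) * (f x * f y)) <=
      c * \int[mu]_x (f x ^+ 2)) ->
  \int[mu]_x chain_integral k x <= (4 * c) ^+ n * fine (mu setT).
Proof.
move=> c0 mk k01 form.
have c4 : 0 < 4 * c by rewrite mulr_gt0.
have sq : \int[mu]_x (chain_integral k x ^+ 2) <=
  ((4 * c) ^+ n) ^+ 2 * fine (mu setT).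
  elim: n k mk k01 form => [|n IH] k mk k01 form.
    rewrite expr0 expr1n -(Rintegral_cst mu measurableT) le_eqVlt;
      apply/orP; left.
    by apply/eqP/eq_Rintegral.
  have mk' i : measurable_fun setT (k (lift ord0 i)) by [].
  have [mH [b Hb]] := chain_integral_itv mk' (fun i => k01 (lift ord0 i)).
  apply: le_trans (operator_norm_le (mk ord0) (k01 ord0) c0
    (form ord0) mH Hb) _.
  rewrite (exprS (4 * c) n) [(_ * (4 * c) ^+ n) ^+ 2]exprMn -[X in _ <= X]mulrA.
  apply: ler_wpM2l; first exact: sqr_ge0.
  exact: (IH _ mk' (fun i => k01 _) (fun i => form _)).
(* Cauchy-Schwarz against the constant 1, as an AM-GM inequality. *)
set H := chain_integral k in sq *; pose r := (4 * c) ^+ n.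
have r0 : 0 < r by rewrite exprn_gt0.
have [mH [b Hb]] := chain_integral_itv mk k01.
have iH : mu.-integrable setT (EFin \o H).
  apply: (@bounded_integrable _ _ _ _ _ b) => // x.
  by have /andP[? ?] := Hb x; rewrite ger0_norm.
have iH2 : mu.-integrable setT (EFin \o fun x => H x ^+ 2).
  apply: (@bounded_integrable _ _ _ _ _ (b ^+ 2)); first exact: measurable_funX.
  move=> x; have /andP[h0 h1] := Hb x.
  by rewrite ger0_norm ?sqr_ge0//; apply: lerXn2r => //; rewrite nnegrE//;
    exact: le_trans h1.
have iH3 := integrableT_scale (2 * r)^-1 iH2.
have ir : mu.-integrable setT (EFin \o (fun=> r / 2 : R)).
  exact: finite_measure_integrable_cst.
apply: (@le_trans _ _ (\int[mu]_x ((2 * r)^-1 * H x ^+ 2 + r / 2))).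
  apply: le_Rintegral => //; first exact: integrableD iH3 ir.
  move=> x _.
  have -> : (2 * r)^-1 * H x ^+ 2 + r / 2 = H x + (2 * r)^-1 * (H x - r) ^+ 2.
    by field; rewrite gt_eqF.
  by rewrite lerDl mulr_ge0 ?sqr_ge0// invr_ge0 mulr_ge0// ltW.
rewrite (RintegralD measurableT iH3 ir) (Rintegral_cst mu measurableT).
rewrite (RintegralZl _ measurableT iH2).
have r20 : 0 <= (2 * r)^-1 by rewrite invr_ge0 mulr_ge0// ltW.
have := ler_wpM2l r20 sq; rewrite -/r.
have -> : (2 * r)^-1 * (r ^+ 2 * fine (mu setT)) = r / 2 * fine (mu setT).
  by field; rewrite gt_eqF.
move=> ?; lra.
Qed.

End chain.

Lemma power_measure_set0 (d : measure_display) (X : measurableType d)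
  (R : realType)
    (mu : {measure set X -> \bar R}) n : power_measure mu n set0 = 0%E.
Proof.
elim: n => [|n IH]; first by rewrite /= diracE in_set0.
rewrite /= /pushforward preimage_set0 /product_measure1.
by apply: integral0_eq => x _; rewrite /= xsection0 IH.
Qed.

Section chain_set.
Variables (R : realType) (d : nat).
Let X := borelRd R d.
Variable eps : R.

Lemma chain_set_cons k (t : 'I_k.+1 -> R) (x y : X) (z : k.-tuple X) :
  chain_set t eps [tuple of x :: y :: z] <->
  t ord0 - eps <= enorm ((y : 'rV[R]_d) - x) <= t ord0 + eps /\
  chain_set (fun i => t (lift ord0 i)) eps [tuple of y :: z].
Proof.
split=> [H|[H0 H] i].
  split; first by have := H ord0; rewrite /= (tnth_nth x) (tnth_nth x)/=.
  move=> i; have := H (lift ord0 i).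
  by rewrite !(tnth_nth x)/=.
case: (unliftP ord0 i) => [j|] -> /=.
  by have := H j; rewrite !(tnth_nth x)/=.
by rewrite !(tnth_nth x)/=.
Qed.

Variable mu : {finite_measure set X -> \bar R}.

(** The product measure is by definition the integral of the measures of
    sections, so the second point of the chain can be integrated out first. *)
Lemma power_measure_chain_section k (t : 'I_k -> R) (x : X) :
  power_measure mu k [set z : k.-tuple X | chain_set t eps [tuple of x :: z]] =
  (chain_integral mu (fun i => annulus_indic (t i) eps) x)%:E.
Proof.
elim: k t x => [|k IH] t x.
  by rewrite /= diracE mem_set//= => -[].
rewrite [LHS]/= /pushforward /product_measure1.
set t' := fun i => t (lift ord0 i).
have k01 i (z : X * X) : 0 <= annulus_indic (t i) eps z <= 1.
  by rewrite annulus_indic_ge0 annulus_indic_le1.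
have mk i := @measurable_annulus_indic R d (t i) eps.
have [mH [b Hb]] := chain_integral_itv mu (fun i => mk (lift ord0 i)) (fun i =>
  k01 (lift ord0 i)).
have iH := kernel_section_integrable mu (mk ord0) (k01 ord0) mH Hb x.
rewrite [RHS]/= /Rintegral fineK;
  last exact: (integrable_fin_num measurableT iH).
apply: eq_integral => y _; rewrite /= EFinM -(IH t' y) /annulus_indic.
case Hxy : (_ <= _ <= _); last first.
  rewrite mul0e (_ : xsection _ _ = set0) ?power_measure_set0//.
  apply/seteqP; split => // z; rewrite /xsection/= inE/=.
  by move/chain_set_cons => []; rewrite Hxy.
rewrite mul1e; congr power_measure.
apply/seteqP; split => z; rewrite /xsection/= inE/=.
  by move/chain_set_cons => [].
by move=> Hz; apply/chain_set_cons.
Qed.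

Lemma power_measure_chain k (t : 'I_k -> R) :
  power_measure mu k.+1 (chain_set t eps) =
  (\int[mu]_x chain_integral mu (fun i => annulus_indic (t i) eps) x)%:E.
Proof.
have k01 i (z : X * X) : 0 <= annulus_indic (t i) eps z <= 1.
  by rewrite annulus_indic_ge0 annulus_indic_le1.
have [mH [b Hb]] :=
  chain_integral_itv mu (fun i => @measurable_annulus_indic R d (t i) eps) k01.
have iH : mu.-integrable setT (EFin \o chain_integral mu (fun i =>
  annulus_indic (t i) eps)).
  apply: (@bounded_integrable _ _ _ _ _ b) => // x.
  by have /andP[? ?] := Hb x; rewrite ger0_norm.
rewrite /Rintegral fineK; last exact: (integrable_fin_num measurableT iH).
rewrite [LHS]/= /pushforward /product_measure1; apply: eq_integral => x _.
rewrite /= -power_measure_chain_section; congr power_measure.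
by apply/seteqP; split => z; rewrite /xsection/= inE.
Qed.

End chain_set.

(** * Measures with compact support *)
Section bounded_support.
Variables (R : realType) (d : nat).
Let X := borelRd R d.
Variables (mu : {measure set X -> \bar R}) (s C0 : R).
Hypothesis supp_compact : compact (supp_measure mu).
Hypothesis ball : forall x r, 0 < r -> (mu (eball x r) <= (C0 * r `^ s)%:E)%E.

Lemma open_measurable_borel (U : set 'rV[R]_d) : open U ->
  measurable (U : set X).
Proof. by move=> oU; exact: sub_sigma_algebra. Qed.

(** If K were not negligible, the sets that contain K up to a negligible part
    would form a proper filter.  It would have a cluster point in K, and yet
    that point has a null neighbourhood. *)
Lemma compact_off_support_negligible (K : set 'rV[R]_d) : compact K ->
  K `&` supp_measure mu = set0 -> mu.-negligible (K : set X).
Proof.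
move=> cK Ks; apply: contrapT => nK.
pose F : set_system 'rV[R]_d := [set A | mu.-negligible (K `\` A : set X)].
have FF : ProperFilter F.
  split; first by rewrite /F/= setD0.
  split.
  - by rewrite /F/= setDT; exact: negligible_set0.
  - move=> A B FA FB; rewrite /F/= setDIr; exact: negligibleU.
  - by move=> A B AB; apply: negligibleS => x [Kx nB]; split => // /AB.
have FK : F K by rewrite /F/= setDv; exact: negligible_set0.
have [x [Kx clx]] := cK _ FF FK.
have : ~ supp_measure mu x by move=> sx; have : (K `&` supp_measure mu) x
  by []; rewrite Ks.
move/existsNP => [U /not_implyP[oU /not_implyP[Ux U0]]].
have FU : F (~` U).
  rewrite /F/= setDE setCK; apply: negligibleS (@subIsetr _ _ _) _.
  apply/(negligibleP _ (open_measurable_borel oU)).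
  by apply/eqP; rewrite eq_le measure_ge0 andbT leNgt; exact/negP.
have [y []] := clx _ _ FU (open_nbhs_nbhs (conj oU Ux)).
by [].
Qed.

Lemma enorm_le_mx_norm (x : 'rV[R]_d) : enorm x <= d%:R * `|x|.
Proof.
have coord i : x ord0 i ^+ 2 <= `|x| ^+ 2.
  rewrite -real_normK ?num_real//; apply: lerXn2r; rewrite ?nnegrE//.
  rewrite [`|x|]mx_normrE;
    exact: (le_bigmax _ (fun ij => `|x ij.1 ij.2|) (ord0, i)).
rewrite -(@ler_pXn2r _ 2) ?nnegrE ?enorm_ge0 ?mulr_ge0// sqr_enorm.
apply: (@le_trans _ _ (\sum_(i < d) `|x| ^+ 2)); first exact: ler_sum.
rewrite sumr_const card_ord -[X in X <= _]mulr_natl exprMn.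
apply: ler_wpM2r; first exact: sqr_ge0.
by rewrite -natrX ler_nat; case: (d) => // d'; rewrite expnS expn1 leq_pmulr.
Qed.

(** Away from a large ball the space is a countable union of compact annuli
    that miss the support. *)
Lemma bounded_support : exists2 D : R, 0 < D & mu (~` eball 0 D) = 0%E.
Proof.
have [M [_ HM]] := compact_bounded supp_compact.
pose B := Num.max 0 M + 1.
have B0 : 0 < B by rewrite ltr_wpDl// le_max lexx.
have HB x : supp_measure mu x -> `|x| <= B.
  by apply: HM; rewrite ltr_pwDr// le_max lexx orbT.
pose K n := [set x : 'rV[R]_d | B + 1 <= `|x| <= n%:R].
have cont : continuous (fun x : 'rV[R]_d => `|x|) by exact: norm_continuous.
have KE n : K n = (fun x : 'rV[R]_d => `|x|) @^-1` `[B + 1, n%:R].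
  by apply/seteqP; split => x; rewrite /K/= in_itv/=.
have nK n : mu.-negligible (K n : set X).
  apply: compact_off_support_negligible.
    apply: bounded_closed_compact.
      exists n%:R; split; first exact: num_real.
      by move=> r nr x /= /andP[_ xn]; exact: le_trans xn (ltW nr).
    by rewrite KE; apply: preimage_closed;
      [move=> x _; exact: cont|exact: interval_closed].
  apply/seteqP; split => // x [/= /andP[xB _] /HB]; rewrite leNgt =>
    /negP; apply.
  by apply: lt_le_trans xB; rewrite ltrDl.
exists (d%:R * (B + 1) + 1).
  by rewrite ltr_wpDl// mulr_ge0// addr_ge0// ltW.
have mE := measurableC (measurable_eball (0 : 'rV[R]_d) (d%:R * (B + 1) + 1)).
apply/(negligibleP _ mE); apply: negligibleS (negligible_bigcup nK).
move=> x /= /negP; rewrite /eball/= subr0 -leNgt => Hx.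
exists (Num.truncn `|x|).+1 => //; rewrite /K/=.
apply/andP; split; last by rewrite ltW// truncnS_gt.
have := le_trans Hx (enorm_le_mx_norm x).
case: (leP (B + 1) `|x|) => // xB.
have := ler_wpM2l (ler0n R d) (ltW xB); lra.
Qed.

Lemma compact_support_finite : exists nu : {finite_measure set X -> \bar R},
  nu = mu :> (set X -> \bar R).
Proof.
have [D D0 HD] := bounded_support.
have mB := measurable_eball (0 : 'rV[R]_d) D.
have fin : fin_num_fun mu.
  move=> A mA; rewrite ge0_fin_numE//.
  apply: (@le_lt_trans _ _ (mu setT)); first by apply: le_measure; rewrite ?inE.
  have H : (mu setT <= mu (eball 0 D) + 0)%E.
    by rewrite -HD -(setUv (eball 0 D));
      exact: (measureU2 mu mB (measurableC mB)).
  apply: (le_lt_trans H).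
  by rewrite adde0; apply: le_lt_trans (ball 0 D0) _; rewrite ltry.
have sfin : sigma_finite setT mu by apply: fin_num_fun_sigma_finite fin;
  rewrite measure0.
pose H1 := isSFinite.Build _ _ _ (Measure.sort mu)
  (sfinite_measure_sigma_finite sfin).
pose H2 := isSigmaFinite.Build _ _ _ (Measure.sort mu) sfin.
pose H3 := isFinite.Build _ _ _ (Measure.sort mu) fin.
pose nu := HB.pack_for (FiniteMeasure.type X R) (Measure.sort mu) H1 H2 H3.
by exists nu.
Qed.

End bounded_support.

Theorem theorem1p8 (R : realType) (d k : nat) (hd : (1 <= d)%N)
    (hk : (1 <= k)%N)
    (mu : {measure set (borelRd R d) -> \bar R})
    (mu_compact : compact (supp_measure mu))
    (mu_dim : exists s : R, (d%:R + 1) / 2 < s <= d%:R /\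
       exists C0 : R, 0 < C0 /\
         forall (x : 'rV[R]_d) (r : R), 0 < r ->
           (mu (eball x r) <= (C0 * r `^ s)%:E)%E) :
  exists C : R, 0 < C /\
    forall (t : 'I_k -> R) (eps : R), (forall i, 0 < t i) -> 0 < eps ->
      (power_measure mu k.+1 (chain_set t eps) <= (C * eps ^+ k)%:E)%E.
Proof.
case: d hd mu mu_compact mu_dim => [//|[|m]] _ mu mu_compact
  [s [/andP[s1 sd] [C0 [/ltW C00 ball]]]].
  (* In dimension 1 no s is admissible. *)
  by exfalso; move: s1 sd; lra.
have [nu nuE] := compact_support_finite mu_compact ball.
have [D D0 Dsupp] := bounded_support mu_compact.
have ball' x r : 0 < r -> (nu (eball x r) <= (C0 * r `^ s)%:E)%E.
  by rewrite nuE; exact: ball.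
have Dsupp' : nu (~` eball 0 D) = 0%E by rewrite nuE.
have [C Cge0 form] := annulus_form_bound s1 sd C00 ball' D0 Dsupp'.
pose L : R := fine (nu setT); have L0 : 0 <= L by exact: fine_ge0.
exists ((4 * (C + 1)) ^+ k * L + 1); split.
  by rewrite ltr_wpDl// mulr_ge0// exprn_ge0// mulr_ge0// addr_ge0.
move=> t eps t0 e0; rewrite -nuE power_measure_chain lee_fin.
have c0 : 0 < (C + 1) * eps by rewrite mulr_gt0// ltr_wpDl.
apply: le_trans (chain_integral_le c0 _ _ _) _.
- by move=> i; exact: measurable_annulus_indic.
- by move=> i z; rewrite annulus_indic_ge0 annulus_indic_le1.
- move=> i f b mf f0 fb;
    apply: le_trans (form (t i) eps b f (t0 i) e0 mf f0 fb) _.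
  apply: ler_wpM2r; first by apply: Rintegral_ge0 => x _; exact: sqr_ge0.
  by apply: ler_wpM2r; [exact: ltW|rewrite lerDl].
have e0k : 0 <= eps ^+ k by rewrite exprn_ge0// ltW.
have -> : (4 * ((C + 1) * eps)) ^+ k * L = (4 * (C + 1)) ^+ k * L * eps ^+ k.
  by rewrite mulrA [(_ * eps) ^+ k]exprMn mulrAC.
by rewrite [leRHS]mulrDl mul1r lerDl.
Qed.
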